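(* Let $\mathcal{S}=\{S_1,\ldots,S_N\}$ be a family of $N$ integer sets, each of size $|S_i|=n_i$ and universe $[0..u)$. There exists a data structure representing each set $S_i$ using $2(\mathrm{trie}(S_i)-n_i+1)+o(\mathrm{trie}(S_i))$ bits such that, given a query $\mathcal{Q}=\{i_1,\ldots,i_k\}\subseteq[1..N]$, the intersection $\mathcal{I}(\mathcal{Q})=\bigcap_{i\in\mathcal{Q}}S_i$ can be computed in $O(k\,\delta\lg(u/\delta))$ time, where $\delta$ is the alternation measure of $\mathcal{Q}$. Moreover, for all $x\in\mathcal{I}(\mathcal{Q})$, the data structure also yields the sequence $\langle \mathrm{rank}(S_{i_1},x),\ldots,\mathrm{rank}(S_{i_k},x)\rangle$ within the same asymptotic time bound.
   Context: Model: word RAM with word size $w=\Theta(\lg u)$. Let $\ell=\lceil\lg u\rceil$. For $S\subseteq[0..u)$, $\mathrm{bintrie}(S)$ is the binary trie obtained by inserting the $\ell$-bit binary encodings of all elements of $S$ (only paths leading to elements exist; all $|S|$ leaves at depth $\ell$), and $\mathrm{trie}(S)$ denotes the number of edges of $\mathrm{bintrie}(S)$. $\mathrm{rank}(S,x)=|\{y\in S: y\le x\}|$. A partition certificate of $\mathcal{Q}$ is a partition $\mathcal{P}$ of $[0..u)$ into intervals such that (1) for every $x\in\mathcal{I}(\mathcal{Q})$, $[x..x]\in\mathcal{P}$; (2) for every $x\notin\mathcal{I}(\mathcal{Q})$ there is $I_j\in\mathcal{P}$ with $x\in I_j$ and some $q\in\mathcal{Q}$ with $S_q\cap I_j=\emptyset$.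 The alternation measure $\delta$ of $\mathcal{Q}$ is the size of the smallest partition certificate of $\mathcal{Q}$.
   Formalization: The factor lg(u/δ) in the time bound is read as max(1, lg(u/δ)), since for δ = u (e.g. a single set equal to [0..u)) the literal bound is 0; set indices and universe elements are assumed to fit in one machine word, and the query is nonempty. *)

(* Defs.v *)
From HB Require Import structures.
From mathcomp Require Import all_boot all_order all_algebra.
From mathcomp Require Import all_classical all_reals all_analysis.

Set Implicit Arguments.
Unset Strict Implicit.
Unset Printing Implicit Defensive.

Import Order.TTheory GRing.Theory Num.Theory.
Import numFieldNormedType.Exports.

Local Open Scope nat_scope.

(** * Tries *)

(* A nonempty tree is a [BNode]; a leaf is [BNode BNil BNil], and a [BNil]
   child stands for a missing edge. *)
Inductive btree := BNil | BNode of btree & btree.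

Fixpoint binsert (b : bitseq) (t : btree) : btree :=
  let: (l, r) := if t is BNode l r then (l, r) else (BNil, BNil) in
  match b with
  | [::] => BNode l r
  | c :: b' => if c then BNode l (binsert b' r) else BNode (binsert b' l) r
  end.

Fixpoint bsize (t : btree) : nat :=
  if t is BNode l r then (bsize l + bsize r).+1 else 0.

Definition bedges (t : btree) : nat := (bsize t).-1.

(* The [l]-bit encoding of [x], most significant bit first. *)
Definition bin_enc (l x : nat) : bitseq :=
  mkseq (fun i => odd (x %/ 2 ^ (l - i.+1))) l.

(* [up_log 2 u] is the ceiling of the binary logarithm of [u].  The trie of
   the empty set is reduced to its root. *)
Definition bintrie u (A : {set 'I_u}) : btree :=
  foldr binsert (BNode BNil BNil)
    [seq bin_enc (up_log 2 u) x | x : 'I_u <- enum A].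

Definition trie u (A : {set 'I_u}) : nat := bedges (bintrie A).

(** * Ranks, intersections and the alternation measure *)

Definition setrank u (A : {set 'I_u}) (x : 'I_u) : nat :=
  #|[set y in A | y <= x]|.

Definition inter u N (S : 'I_N -> {set 'I_u}) (Q : seq 'I_N) : {set 'I_u} :=
  \bigcap_(i in Q) S i.

Definition is_interval u (B : {set 'I_u}) : bool :=
  [exists a : 'I_u, exists b : 'I_u, B == [set x : 'I_u | a <= x <= b]].

Definition certificate u N (S : 'I_N -> {set 'I_u}) (Q : seq 'I_N)
    (P : {set {set 'I_u}}) : bool :=
  [&& finset.partition P [set: 'I_u],
      [forall B in P, is_interval B],
      [forall x in inter S Q, [set x] \in P] &
      [forall x in ~: inter S Q, [exists B in P,
         (x \in B) && [exists q in Q, S q :&: B == finset.set0]]]].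

Definition singleton_blocks u : {set {set 'I_u}} :=
  [set [set x] | x in [set: 'I_u]].

(* The default value of the minimum is harmless: [singleton_blocks u] is always
   a certificate. *)
Definition alternation u N (S : 'I_N -> {set 'I_u}) (Q : seq 'I_N) : nat :=
  #|[arg min_(P < singleton_blocks u | certificate S Q P) #|P|]|.

(** * The word RAM

   Words are the naturals below [2 ^ w]; all arithmetic is modulo [2 ^ w].
   Programs are built from unit-cost instructions with structured control flow.
   The machine has registers, a working memory, a write-only output stream, and
   a read-only memory [D] holding the represented sets: [D i j] is the [j]-th
   word of the representation of the [i]-th set.  An address of the working
   memory consists of two words, since a single one need not be able to address
   the input indices and the working storage at the same time. *)

Inductive operand := Reg of nat | Cst of nat.

Inductive binop :=
  | OpAdd | OpSub | OpMul | OpDiv | OpMod | OpAnd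
  | OpOr | OpXor | OpShl | OpShr | OpLt | OpEq.

Inductive cmd :=
  | Skip
  | Op of nat & binop & operand & operand  (* Op r o a b: r := a o b *)
  | Fetch of nat & operand & operand       (* Fetch r a b: r := mem[a, b] *)
  | Store of operand & operand & operand   (* Store a b v: mem[a, b] := v *)
  | Probe of nat & operand & operand       (* Probe r i j: r := D[i, j] *)
  | Emit of operand                        (* append to the output *)
  | Seq of cmd & cmd
  | If of operand & cmd & cmd
  | While of operand & cmd.

Record state := State {
  regs : nat -> nat;
  mem : nat -> nat -> nat;
  out : seq nat
}.

Definition eval (w : nat) (s : state) (o : operand) : nat :=
  match o with Reg r => regs s r | Cst c => c %% 2 ^ w end.

Definition binop_fun (w : nat) (o : binop) (a b : nat) : nat :=
  match o with
  | OpAdd => a + b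
  | OpSub => a + (2 ^ w - b)
  | OpMul => a * b
  | OpDiv => a %/ b
  | OpMod => a %% b
  | OpAnd => Nat.land a b
  | OpOr => Nat.lor a b
  | OpXor => Nat.lxor a b
  | OpShl => a * 2 ^ b
  | OpShr => a %/ 2 ^ b
  | OpLt => a < b
  | OpEq => a == b
  end %% 2 ^ w.

Definition set_reg (s : state) (r v : nat) : state :=
  State [eta regs s with r |-> v] (mem s) (out s).

Definition set_mem (s : state) (a b v : nat) : state :=
  State (regs s)
    (fun x y => if (x == a) && (y == b) then v else mem s x y) (out s).

Definition add_out (s : state) (v : nat) : state :=
  State (regs s) (mem s) (rcons (out s) v).

(* [exec w D c s t s']: on words of [w] bits, [c] started in state [s] halts in
   state [s'] after [t] steps. *)
Inductive exec (w : nat) (D : nat -> nat -> nat) :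
    cmd -> state -> nat -> state -> Prop :=
  | ExecSkip s : exec w D Skip s 1 s
  | ExecOp r o a b s :
      exec w D (Op r o a b) s 1
        (set_reg s r (binop_fun w o (eval w s a) (eval w s b)))
  | ExecFetch r a b s :
      exec w D (Fetch r a b) s 1
        (set_reg s r (mem s (eval w s a) (eval w s b)))
  | ExecStore a b v s :
      exec w D (Store a b v) s 1
        (set_mem s (eval w s a) (eval w s b) (eval w s v))
  | ExecProbe r i j s :
      exec w D (Probe r i j) s 1
        (set_reg s r (D (eval w s i) (eval w s j)))
  | ExecEmit a s : exec w D (Emit a) s 1 (add_out s (eval w s a))
  | ExecSeq c1 c2 s1 s2 s3 t1 t2 :
      exec w D c1 s1 t1 s2 -> exec w D c2 s2 t2 s3 ->
      exec w D (Seq c1 c2) s1 (t1 + t2) s3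
  | ExecIf a c1 c2 s t s' :
      exec w D (if eval w s a != 0 then c1 else c2) s t s' ->
      exec w D (If a c1 c2) s t.+1 s'
  | ExecWhileF a c s : eval w s a = 0 -> exec w D (While a c) s 1 s
  | ExecWhileT a c s1 s2 s3 t1 t2 :
      eval w s1 a != 0 ->
      exec w D c s1 t1 s2 -> exec w D (While a c) s2 t2 s3 ->
      exec w D (While a c) s1 (t1 + t2).+1 s3.

(* The [j]-th [w]-bit word of [b], least significant bit first; [b] is padded
   with zeros, so that its length is not available for free. *)
Definition bits_word (w : nat) (b : bitseq) (j : nat) : nat :=
  \sum_(d < w) nth false b (j * w + d) * 2 ^ d.

Definition data_mem (w N : nat) (rep : 'I_N -> bitseq) (i j : nat) : nat :=
  if insub i is Some i' then bits_word w (rep i') j else 0.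

(* A query starts with its size in register 0, the universe size in register 1
   and the indices of the queried sets in row 0 of the working memory; all the
   other registers and cells are 0, and the output is empty. *)
Definition query_state (u N : nat) (Q : seq 'I_N) : state :=
  State
    (fun r => match r with 0 => size Q | 1 => u | _ => 0 end)
    (fun a b => if a is 0 then nth 0 [seq val i | i <- Q] b else 0)
    [::].

(** * Logarithms *)

Local Open Scope ring_scope.

Definition lg (R : realType) (x : R) : R := ln x / ln 2.

(* Read in an asymptotic bound, where a logarithm is understood to be at least
   a positive constant: [delta] may be as large as [u], and [lg 1 = 0]. *)
Definition lg1 (R : realType) (x : R) : R := Num.max 1 (lg x).

(* Main.v *)
(* A set is stored as its trie in level order, two bits per internal node, so
   that the number of the [c]-child of node [n] is one plus the number of ones
   before position [2 n + c]; within the last level, node numbers are ranks.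
   Rank takes constant time: each field of [2 lam^2] bits, [lam] being about
   [lg w], carries the number of ones since the start of its superblock, and
   the ones inside a field are counted by a multiplication, a mask and a
   division.

   A query walks depth-first through the nodes common to all the tries.  Send a
   common node to the certificate block that contains the first element below
   it: two nodes of equal depth cannot share a block [I], since every element
   below the first one would lie in [I], which is a singleton or misses some
   set of the query.  There are thus at most [min (2^d, delta)] common nodes at
   depth [d], and [O (delta lg (u / delta))] in total.

   Internal node numbers and ranks fit in words, but bit positions need not,
   as [2^w] may barely exceed [u]; positions are therefore computed from node
   numbers by division, and counts are taken modulo [2^w]. *)

Require Import Defs.
From mathcomp Require Import all_boot all_order all_algebra.
From mathcomp Require Import all_classical all_reals all_analysis.
From mathcomp Require Import zify ring lra.
From Stdlib Require PeanoNat.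

Set Implicit Arguments.
Unset Strict Implicit.
Unset Printing Implicit Defensive.

Local Open Scope nat_scope.

(** * Binary expansions and population count *)

(** The counting trick needs [b * b.+1 <= w] for fields of b = 2 lam^2 bits, which holds only above
    some constant word size [w0]. Universes below 2^w0 are therefore stored as bitmaps, whose size
    and query time are constants absorbed by the lower-order term and by [time_factor].

    The redundancy must be small in terms of [trie A] alone, although the directory depends on [w]:
    it is O((bits + w) / lam). The trie of a nonempty set contains a full path, so lg u, and hence
    [w], is O(trie A); and trie A < 2^(lg u + 1) makes [lam] at least about lg lg (trie A). The same
    concern forbids rounding up to whole words, since the trie of a single element has only about lg
    u edges, and it forces the empty string for the empty set.

    A query also pays O(w) for finding the word size and the parameters derived from it, and O(k lg
    u) for locating the first leaves. Both fit in the bound because lg delta < delta. *)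

Definition bval (n : nat) (b : nat -> bool) : nat := \sum_(d < n) b d * 2 ^ d.

Lemma bvalS n b : bval n.+1 b = b 0 + 2 * bval n (b \o S).
Proof.
rewrite /bval big_ord_recl muln1; congr (_ + _).
by rewrite big_distrr; apply: eq_bigr => i _; rewrite /= /bump /= expnS mulnCA.
Qed.

Lemma eq_bval n b c : (forall d, d < n -> b d = c d) -> bval n b = bval n c.
Proof. by move=> bc; apply: eq_bigr => d _; rewrite bc. Qed.

Lemma bval_lt n b : bval n b < 2 ^ n.
Proof.
elim: n b => [|n IH] b; first by rewrite /bval big_ord0.
by rewrite bvalS expnS; have := IH (b \o S); case: (b 0) => /=; lia.
Qed.

Lemma bvalD m n b : bval (m + n) b = bval m b + 2 ^ m * bval n (fun d => b (m + d)).
Proof.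
rewrite /bval big_split_ord big_distrr; congr (_ + _).
by apply: eq_bigr => i _; rewrite /= expnD mulnCA.
Qed.

Lemma bval_mod k n b : k <= n -> bval n b %% 2 ^ k = bval k b.
Proof.
move=> kn; rewrite -(subnKC kn) bvalD addnC mulnC modnMDl modn_small //.
exact: bval_lt.
Qed.

Lemma odd_bval n b i : odd (bval n b %/ 2 ^ i) = (i < n) && b i.
Proof.
case: ltnP => [lt_in|le_ni] /=; last first.
  by rewrite divn_small // (leq_trans (bval_lt n b)) // leq_exp2l.
have -> : n = i + (n - i.+1).+1 by lia.
rewrite bvalD mulnC divnDMl ?expn_gt0 // divn_small ?bval_lt // add0n.
by rewrite bvalS /= addn0 oddD oddM /=; case: (b i).
Qed.

Lemma bval_odd n x : x < 2 ^ n -> bval n (fun d => odd (x %/ 2 ^ d)) = x.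
Proof.
elim: n x => [|n IH] x; first by rewrite /bval big_ord0; case: x.
move=> lt_x; rewrite bvalS expn0 divn1.
rewrite -[RHS](odd_double_half x) -mul2n -(IH x./2); last first.
  by rewrite expnS in lt_x; lia.
congr (_ + 2 * _); apply: eq_bval => d _ /=.
by rewrite expnS divnMA divn2.
Qed.

Lemma testbit_bval n b i : Nat.testbit (bval n b) i = (i < n) && b i.
Proof.
elim: i n b => [|i IH] [|n] b; rewrite ?bvalS.
- by rewrite /bval big_ord0.
- by rewrite -[RHS]/(b 0) -[LHS]/(Nat.odd _) -plusE -multE PeanoNat.Nat.odd_add_mul_2; case: (b 0).
- by have := IH 0 b; rewrite /bval !big_ord0.
rewrite /= (_ : Nat.div2 _ = bval n (b \o S)) ?IH //.
case: (b 0); first exact: PeanoNat.Nat.div2_succ_double.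
exact: PeanoNat.Nat.div2_double.
Qed.

Lemma land_bval m n b c :
  Nat.land (bval m b) (bval n c) = bval n (fun d => [&& d < m, b d & c d]).
Proof.
apply: PeanoNat.Nat.bits_inj => i; rewrite PeanoNat.Nat.land_spec !testbit_bval.
by case: (i < m); case: (i < n); case: (b i); case: (c i).
Qed.

Lemma digit_divmod B (q k : nat) (x : nat -> nat) :
  (forall i, i < q -> x i < B) -> k < q ->
  (\sum_(i < q) x i * B ^ i) %/ B ^ k %% B = x k.
Proof.
elim: q k x => [//|q IH] k x xB lt_k.
have B0 : 0 < B by apply: leq_ltn_trans (xB k lt_k).
have -> : \sum_(i < q.+1) x i * B ^ i = x 0 + (\sum_(i < q) x i.+1 * B ^ i) * B.
  rewrite big_ord_recl muln1 big_distrl /=; congr (_ + _).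
  by apply: eq_bigr => i _; rewrite /bump /= add1n expnSr mulnA.
case: k lt_k => [_|k lt_k]; first by rewrite divn1 addnC modnMDl modn_small ?xB.
rewrite expnS divnMA addnC divnMDl // [x 0 %/ B]divn_small ?xB // addn0.
by apply: (IH k (x \o S)) => // i lt_i; apply: xB.
Qed.

Lemma digit_sum_lt B q (x : nat -> nat) :
  (forall i, i < q -> x i < B) -> \sum_(i < q) x i * B ^ i < B ^ q.
Proof.
elim: q => [|q IH] xB; first by rewrite big_ord0.
rewrite big_ord_recr /= expnS.
have := IH (fun i lt_i => xB i (ltnW lt_i)); have := xB q (ltnSn q).
by move: (\sum_(i < q) _) (B ^ q) => s p; nia.
Qed.

(** The repeated patterns of the population count are obtained on the machine in this way: a shift,
    a decrement and a division, without a loop. *)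
Lemma geometric_quotient B n : 1 < B -> (B ^ n - 1) %/ (B - 1) = \sum_(i < n) B ^ i.
Proof.
move=> B1; rewrite !subn1 predn_exp mulKn //.
by case: B B1 => [|[]].
Qed.

Section Popcount.
Variables (n : nat) (b : nat -> bool).
Hypothesis n_gt0 : 0 < n.

Lemma bval_chunks (k a : nat) (c : nat -> bool) :
  bval (k * a) c = \sum_(i < k) 2 ^ (i * a) * bval a (fun d => c (i * a + d)).
Proof.
elim: k => [|k IH]; first by rewrite mul0n /bval !big_ord0.
by rewrite mulSn addnC bvalD IH big_ord_recr.
Qed.

Lemma bval_copies : bval n b * \sum_(i < n) (2 ^ n) ^ i = bval (n * n) (fun d => b (d %% n)).
Proof.
rewrite bval_chunks big_distrr; apply: eq_bigr => i _ /=.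
rewrite -expnM (mulnC n i) mulnC; congr (_ * _); apply: eq_bval => d lt_d.
by rewrite modnMDl modn_small.
Qed.

Lemma bval_single a c : (forall d, 0 < d -> d < a -> c d = false) -> 0 < a -> bval a c = c 0.
Proof.
case: a => // a c0 _; rewrite bvalS -[RHS]addn0; congr (_ + _).
by rewrite /bval big1 // => i _; rewrite /= c0 // ltnS ltn_ord.
Qed.

(* The product with [sum (2^n)^i] makes [n] copies of the word, [n] bits apart;
   the mask keeps the [i]-th bit of the [i]-th copy, at position [i * (n+1)],
   and the residue modulo [2^(n+1) - 1] adds up these digits. *)
Lemma popcount :
  Nat.land (bval n b * \sum_(i < n) (2 ^ n) ^ i) (\sum_(i < n) (2 ^ n.+1) ^ i)
    %% (2 ^ n.+1 - 1) = \sum_(i < n) b i.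
Proof.
have -> : \sum_(i < n) (2 ^ n.+1) ^ i = bval (n * n.+1) (fun d => n.+1 %| d).
  rewrite bval_chunks; apply: eq_bigr => i _.
  rewrite bval_single //; last first.
    move=> d d0 dn; rewrite dvdn_addr ?dvdn_mull //.
    by apply/negP => /(dvdn_leq d0); rewrite leqNgt dn.
  by rewrite addn0 dvdn_mull // muln1 -expnM mulnC.
rewrite bval_copies land_bval bval_chunks.
rewrite (eq_bigr (fun i : 'I_n => b i * (2 ^ n.+1) ^ i)); last first.
  move=> i _; rewrite bval_single //; last first.
    move=> d d0 dn; rewrite dvdn_addr ?dvdn_mull //.
    rewrite (_ : (n.+1 %| d) = false) ?andbF //.
    by apply/negP => /(dvdn_leq d0); rewrite leqNgt dn.
  rewrite addn0 dvdn_mull // andbT mulnC -expnM (mulnC n.+1).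
  have lt_in := ltn_ord i.
  (* The last masked position is (n - 1)(n + 1) = n^2 - 1, still inside the product of n^2 bits;
     modulo n, position i (n + 1) reads bit i. *)
  have -> : i * n.+1 < n * n by nia.
  by rewrite mulnS addnC modnMDl modn_small.
have Z1 i : (2 ^ n.+1) ^ i = 1 %[mod 2 ^ n.+1 - 1].
  have {1}-> : 2 ^ n.+1 = (2 ^ n.+1 - 1) + 1 by rewrite subnK // expn_gt0.
  by rewrite -modnXm modnDl modnXm exp1n.
have -> : \sum_(i < n) b i * (2 ^ n.+1) ^ i = \sum_(i < n) b i %[mod 2 ^ n.+1 - 1].
  elim/big_ind2: _ => // [x1 x2 y1 y2 e1 e2 | i _]; first by rewrite -modnDm e1 e2 modnDm.
  by rewrite -modnMmr Z1 modnMmr muln1.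
rewrite modn_small //; apply: (@leq_ltn_trans n).
  by rewrite -[X in _ <= X]card_ord -sum1_card; apply: leq_sum => i _; case: (b i).
have := ltn_expl n (isT : 1 < 2); rewrite expnS; lia.
Qed.
End Popcount.

(** * Tries in level order *)

Definition ones (B : bitseq) (k : nat) : nat := count id (take k B).

Lemma onesD B m n : ones B (m + n) = ones B m + \sum_(i < n) nth false B (m + i).
Proof.
elim: n => [|n IH]; first by rewrite addn0 big_ord0 addn0.
rewrite addnS big_ord_recr /= addnA -IH /ones.
case: (ltnP (m + n) (size B)) => [lt_B|ge_B].
  by rewrite (take_nth false lt_B) -cats1 count_cat /= addn0.
by rewrite !take_oversize // ?nth_default ?addn0 // (leq_trans ge_B).
Qed.

Section LevelOrder.

(** [T d v] is meant to say that the node with the [d]-bit prefix [v] exists. The hypotheses make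
    this a tree: a single root, and closure under parents, as [v./2] drops the last bit. *)
Variable T : nat -> pred nat.
Hypothesis T0 : forall v, T 0 v = (v == 0).
Hypothesis TS : forall d v, T d.+1 v -> T d v./2.

Definition level (d n : nat) : seq (nat * nat) := [seq (d, v) | v <- iota 0 n & T d v].
Definition nodes (n : nat) : seq (nat * nat) := flatten (mkseq (fun d => level d (2 ^ d)) n).
Definition kids (p : nat * nat) : bitseq := [:: T p.1.+1 p.2.*2; T p.1.+1 p.2.*2.+1].
Definition trie_bits (n : nat) : bitseq := flatten [seq kids p | p <- nodes n].
Definition before (d v : nat) : nat := count (T d) (iota 0 v).
(** As numbering starts at 0, this is also the number of the first node at depth [d]. *)
Definition start (d : nat) : nat := \sum_(e < d) before e (2 ^ e).
Definition node_index (d v : nat) : nat := start d + before d v.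

Lemma node_lt d v : T d v -> v < 2 ^ d.
Proof.
elim: d v => [|d IH] v; first by rewrite T0 => /eqP->.
by move/TS/IH; rewrite expnS; lia.
Qed.

Lemma size_level d n : size (level d n) = before d n.
Proof. by rewrite size_map size_filter. Qed.

Lemma nodesS n : nodes n.+1 = nodes n ++ level n (2 ^ n).
Proof. by rewrite /nodes /mkseq -[n.+1]addn1 iotaD map_cat flatten_cat /= cats0. Qed.

Lemma startS d : start d.+1 = start d + before d (2 ^ d).
Proof. by rewrite /start big_ord_recr. Qed.

Lemma size_nodes n : size (nodes n) = start n.
Proof.
elim: n => [|n IH]; first by rewrite /start big_ord0.
by rewrite nodesS size_cat IH startS size_level.
Qed.

Lemma size_flatten_kids s : size (flatten [seq kids p | p <- s]) = (size s).*2.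
Proof. by elim: s => //= p s ->. Qed.

Lemma size_trie_bits n : size (trie_bits n) = (start n).*2.
Proof. by rewrite size_flatten_kids size_nodes. Qed.

Lemma before_le d v : before d v <= v.
Proof. by rewrite -[leqRHS](size_iota 0) count_size. Qed.

Lemma start_lt n : start n < 2 ^ n.
Proof.
elim: n => [|n IH]; first by rewrite /start big_ord0.
by rewrite startS expnS; have := before_le n (2 ^ n); lia.
Qed.

Lemma start_le m n : m <= n -> start m <= start n.
Proof.
move=> /subnKC<-; elim: (n - m) => [|k IH]; first by rewrite addn0.
by rewrite addnS startS (leq_trans IH) // leq_addr.
Qed.

Lemma beforeS d v : before d v.+1 = before d v + T d v.
Proof. by rewrite /before -[v.+1]addn1 iotaD count_cat /= addn0 add0n. Qed.

Lemma before_mono d v v' : v <= v' -> before d v <= before d v'.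
Proof.
move=> /subnKC<-; elim: (v' - v) => [|k IH]; first by rewrite addn0.
by rewrite addnS beforeS (leq_trans IH) // leq_addr.
Qed.

Lemma node_index_lt d v n : d < n -> T d v -> node_index d v < start n.
Proof.
move=> lt_dn Tv; apply: leq_trans (start_le lt_dn); rewrite startS ltn_add2l.
by have := before_mono d (node_lt Tv); rewrite beforeS Tv addn1.
Qed.

(** Every node has its parent on the previous level, and the prefixes below 2n are the children of
    those below n; so each node of the next level contributes exactly one 1. *)
Lemma count_level_kids d n :
  count id (flatten [seq kids p | p <- level d n]) = before d.+1 n.*2.
Proof.
elim: n => [//|n IH].
rewrite doubleS !beforeS -IH /level -[n.+1]addn1 iotaD filter_cat !map_cat flatten_cat count_cat /=.
rewrite add0n -addnA; congr (_ + _).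
(* An absent parent writes no bits, and by [TS] neither of its children exists. *)
case: ifP => [//|/negbT nT]; first by rewrite /= addn0.
by case: (boolP (T d.+1 _)) => [/TS|_]; [|case: (boolP (T d.+1 _)) => [/TS|_] //];
  rewrite ?uphalf_double ?doubleK /= ?uphalf_double (negbTE nT).
Qed.

(** Each node except the root is announced by one 1 among the bits of its parent; the successor
    accounts for the root. *)
Lemma count_trie_bits d : (count id (trie_bits d)).+1 = start d.+1.
Proof.
elim: d => [|d IH]; first by rewrite /start big_ord1 /before /= T0.
rewrite /trie_bits nodesS map_cat flatten_cat count_cat -addSn IH count_level_kids.
by rewrite [RHS]startS expnS mul2n.
Qed.

Lemma nodes_prefix d n : d < n -> exists s, nodes n = nodes d ++ level d (2 ^ d) ++ s.
Proof.
move=> lt_dn; rewrite -(subnKC lt_dn); elim: (n - d.+1) => [|k [s IH]].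
  by exists [::]; rewrite addn0 nodesS cats0.
by exists (s ++ level (d.+1 + k) (2 ^ (d.+1 + k))); rewrite addnS nodesS IH !catA.
Qed.

Lemma trie_bits_split d v n : d < n -> T d v -> exists s,
  trie_bits n = flatten [seq kids p | p <- nodes d ++ level d v] ++ kids (d, v) ++ s.
Proof.
move=> lt_dn Tv; have [s Es] := nodes_prefix lt_dn; have lt_v := node_lt Tv.
have -> : trie_bits n = flatten [seq kids p | p <- nodes d ++ level d (2 ^ d) ++ s].
  by rewrite -Es.
have E2 : 2 ^ d = v + (2 ^ d - v.+1).+1 by lia.
rewrite [level d (2 ^ d)]/level E2 iotaD filter_cat map_cat.
rewrite add0n /= Tv /= !(map_cat, flatten_cat) /= -/(level d v) -!catA /=.
by eexists; rewrite -catA.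
Qed.

Lemma nth_trie_bits d v n (c : bool) : d < n -> T d v ->
  nth false (trie_bits n) ((node_index d v).*2 + c) = T d.+1 (v.*2 + c).
Proof.
move=> lt_dn Tv; have [s ->] := trie_bits_split lt_dn Tv.
rewrite nth_cat size_flatten_kids size_cat size_nodes size_level -/(node_index d v).
by rewrite ltnNge leq_addr addKn; case: c; rewrite ?addn0 ?addn1.
Qed.

(** The ones before a bit announce, in level order, all nodes that precede the corresponding child,
    except the root. For an absent child this gives the number that it would have. *)
Lemma ones_trie_bits d v n (c : bool) : d < n -> T d v ->
  (ones (trie_bits n) ((node_index d v).*2 + c)).+1 = node_index d.+1 (v.*2 + c).
Proof.
move=> lt_dn Tv; have [s Es] := trie_bits_split lt_dn Tv.
have E0 : (ones (trie_bits n) (node_index d v).*2).+1 = node_index d.+1 v.*2.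
  rewrite /ones Es take_size_cat; last first.
    by rewrite size_flatten_kids size_cat size_nodes size_level.
  rewrite map_cat flatten_cat count_cat -addSn -/(trie_bits d) count_trie_bits.
  by rewrite count_level_kids.
case: c; rewrite ?addn0 // onesD -addSn E0 big_ord1 addn0.
by rewrite -[X in nth _ _ X]addn0 (nth_trie_bits false) // addn0 addn1 /node_index beforeS addnA.
Qed.

(** Following the 0-side from the first node of each level leads to the first leaf, even where that
    child is absent. The offset of the leaf numbers is thus computed rather than stored. *)
Lemma ones_trie_bits_start d n : d < n -> (ones (trie_bits n) (start d).*2).+1 = start d.+1.
Proof.
move=> lt_dn; have [s Es] := nodes_prefix lt_dn.
rewrite /ones /trie_bits Es map_cat flatten_cat take_size_cat ?count_trie_bits //.
by rewrite size_flatten_kids size_nodes.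
Qed.

Lemma uniq_nodes n : uniq (nodes n).
Proof.
elim: n => [//|n IH]; rewrite nodesS cat_uniq IH /=; apply/andP; split; last first.
  by rewrite map_inj_uniq ?filter_uniq ?iota_uniq // => x y [].
apply/hasPn => p /mapP[v _ ->]; apply/negP => /flattenP[s /mapP[d]].
by rewrite mem_iota /= => lt_d -> /mapP[v' _ [Ed]]; rewrite Ed ltnn in lt_d.
Qed.

End LevelOrder.

(** * Packing the bits and the rank directory into words *)

Definition bitlen (n : nat) : nat := up_log 2 n.+1.

Lemma bitlen_lt n : n < 2 ^ bitlen n.
Proof. exact: up_logP. Qed.

Definition wordlog (w : nat) := bitlen w.
(** A node takes two bits, so a field of [data_bits w] bits spans exactly this many nodes; dividing
    a node number by it gives the field without forming a global bit position. *)
Definition node_field (w : nat) := wordlog w * wordlog w.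
Definition data_bits (w : nat) := (node_field w).*2.
Definition count_bits (w : nat) := (wordlog w).*2.
Definition field_bits (w : nat) := count_bits w + data_bits w.
Definition word_fields (w : nat) := w %/ field_bits w.

Section Packing.

Variables (w : nat) (B : bitseq).

Local Notation lam := (wordlog w).
Local Notation b := (data_bits w).
Local Notation c := (count_bits w).
Local Notation phi := (field_bits w).
Local Notation q := (word_fields w).

Definition field_data (F : nat) : nat := bval b (fun k => nth false B (F * b + k)).
Definition super_start (t : nat) : nat := t * lam * q * b.
(* Counts beyond the end of [B] are zeroed, so that [packed] can be cut there. *)
Definition field_count (F : nat) : nat :=
  if F * b < size B then ones B (F * b) - ones B (super_start (F %/ q %/ lam)) else 0.
Definition field (F : nat) : nat := field_count F + field_data F * 2 ^ c.
Definition data_word (J : nat) : nat := \sum_(f < q) field (J * q + f) * (2 ^ phi) ^ f.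

(* Every [lam] data words are followed by a word holding the number of ones
   that precede the next superblock, modulo [2 ^ w]. *)
Definition word (j : nat) : nat :=
  let t := j %/ lam.+1 in
  if j %% lam.+1 == lam then
    if super_start t.+1 < size B then ones B (super_start t.+1) %% 2 ^ w else 0
  else data_word (t * lam + j %% lam.+1).

Definition overhead (n : nat) : nat :=
  (n %/ b).+1 * c + n %/ (b * q) * phi + n %/ (b * q * lam) * w.

(** The last word is cut rather than stored whole: rounding up could waste almost [w] bits, which is
    not of lower order for the trie of a few elements. Reading pads with zeros. *)
Definition packed : bitseq :=
  mkseq (fun p => odd (word (p %/ w) %/ 2 ^ (p %% w))) (size B + overhead (size B)).

Hypothesis w_gt0 : 0 < w.
Hypothesis w_large : b * b.+1 <= w.

Lemma lam_gt0 : 0 < lam.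
Proof.
have := bitlen_lt w; rewrite -/(wordlog w).
by case: (wordlog w) => //; rewrite expn0 ltnNge w_gt0.
Qed.

Lemma b_gt0 : 0 < b.
Proof. by rewrite double_gt0 muln_gt0 lam_gt0. Qed.

Lemma lam_le_q : lam <= q.
Proof.
have lam0 := lam_gt0; rewrite /word_fields leq_divRL; last first.
  by rewrite /field_bits addn_gt0 b_gt0 orbT.
apply: leq_trans w_large; rewrite /field_bits /count_bits /data_bits /node_field.
by nia.
Qed.

Lemma q_gt0 : 0 < q.
Proof. exact: leq_trans lam_gt0 lam_le_q. Qed.

Lemma q_phi_le : q * phi <= w.
Proof. exact: leq_divM. Qed.

Lemma onesB_le m n : ones B (m + n) - ones B m <= n.
Proof.
rewrite onesD addKn -[leqRHS]card_ord -sum1_card.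
by apply: leq_sum => i _; case: (nth _ _ _).
Qed.

Lemma super_startE F :
  F * b = super_start (F %/ q %/ lam) + (F %% (q * lam)) * b.
Proof.
rewrite /super_start -divnMA {1}(divn_eq F (q * lam)) mulnDl; congr (_ + _).
by rewrite -!mulnA (mulnCA q).
Qed.

(** A superblock has q lam fields of b bits, so the count is below w lam, and both factors are below
    2^lam. *)
Lemma field_count_lt F : field_count F < 2 ^ c.
Proof.
rewrite /field_count; case: ifP => _; last by rewrite expn_gt0.
rewrite super_startE; apply: leq_ltn_trans (onesB_le _ _) _.
have lt_F : F %% (q * lam) < q * lam by rewrite ltn_mod muln_gt0 q_gt0 lam_gt0.
apply: (@leq_ltn_trans (w * lam)); last first.
  rewrite /count_bits -addnn expnD ltn_mul ?bitlen_lt //; exact: ltn_expl.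
have := q_phi_le; rewrite /field_bits; nia.
Qed.

Lemma field_data_lt F : field_data F < 2 ^ b.
Proof. exact: bval_lt. Qed.

Lemma field_lt F : field F < 2 ^ phi.
Proof.
rewrite /field /field_bits expnD.
have := field_count_lt F; have := field_data_lt F.
by move: (2 ^ b) (2 ^ c); nia.
Qed.

Lemma data_word_lt J : data_word J < (2 ^ phi) ^ q.
Proof. by apply: (digit_sum_lt (x := fun f => field (J * q + f))) => f _; apply: field_lt. Qed.

Lemma word_lt j : word j < 2 ^ w.
Proof.
rewrite /word; case: ifP => _.
  by case: ifP => _; rewrite ?expn_gt0 // ltn_mod expn_gt0.
apply: leq_trans (data_word_lt _) _.
by rewrite -expnM leq_exp2l // mulnC q_phi_le.
Qed.

Lemma data_wordE J f : f < q -> data_word J %/ 2 ^ (f * phi) %% 2 ^ phi = field (J * q + f).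
Proof.
move=> lt_f; rewrite mulnC expnM.
by apply: (digit_divmod (x := fun f => field (J * q + f))) => // i _; apply: field_lt.
Qed.

(** J / lam words with superblock counts precede data word [J]. The one for superblock [t] sits
    right before its first data word, and superblock 0 has none. *)
Lemma word_data J : word (J + J %/ lam) = data_word J.
Proof.
have -> : J + J %/ lam = J %/ lam * lam.+1 + J %% lam.
  by rewrite {1}(divn_eq J lam) mulnS; lia.
have lt_r : J %% lam < lam by rewrite ltn_mod lam_gt0.
rewrite /word divnMDl // modnMDl (divn_small (leqW lt_r)) (modn_small (leqW lt_r)).
by rewrite (ltn_eqF lt_r) addn0 -divn_eq.
Qed.

Lemma word_header t : 0 < t -> super_start t < size B ->
  word (t * lam.+1 - 1) = ones B (super_start t) %% 2 ^ w.
Proof.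
case: t => // t _ lt_t; rewrite /word mulSn addnC subn1 addnS /=.
by rewrite divnMDl // modnMDl divn_small // modn_small // eqxx addn0 lt_t.
Qed.

Lemma odd_modn_exp n o x : o < n -> odd ((x %% 2 ^ n) %/ 2 ^ o) = odd (x %/ 2 ^ o).
Proof.
move=> lt_o; rewrite [in RHS](divn_eq x (2 ^ n)).
have -> : 2 ^ n = 2 ^ (n - o.+1) * 2 * 2 ^ o by rewrite -expnSr -expnD; congr (_ ^ _); lia.
by rewrite mulnA divnMDl ?expn_gt0 // oddD !oddM /= !andbF.
Qed.

(** A one among the data bits comes from a one of [B], shifted by the [c] bits of the count; a one
    in the count only requires the field to start inside [B]. *)
Lemma odd_field_lt F o : o < phi -> odd (field F %/ 2 ^ o) ->
  F * b < size B /\ F * b + o < size B + c.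
Proof.
move=> lt_o odd_F; have Fb : F * b < size B.
  rewrite ltnNge; apply/negP => ge_B; move: odd_F.
  rewrite /field /field_count ltnNge ge_B /= add0n.
  have -> : field_data F = 0.
    rewrite /field_data (eq_bval (c := fun=> false)) => [|d _].
      by rewrite /bval big1 // => i _.
    by rewrite nth_default // (leq_trans ge_B) // leq_addr.
  by rewrite mul0n div0n.
split=> //; case: (ltnP o c) => [lt_oc|le_co]; first by lia.
move: odd_F; rewrite -{1}(subnKC le_co) expnD divnMA /field addnC divnMDl ?expn_gt0 //.
rewrite (divn_small (field_count_lt F)) addn0 odd_bval => /andP[_ nB].
have : F * b + (o - c) < size B; last by lia.
by rewrite ltnNge; apply/negP => /(nth_default false) E; rewrite E in nB.
Qed.

(** Each of the [J] data words takes at most one field more than its q fields, each earlier field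
    takes [c] bits more than its data, and there are [t] count words; these three excesses are
    matched with the terms of [overhead]. *)
Lemma position_bound J f o t : f < q -> t <= J %/ lam ->
  (J * q + f) * b < size B -> (J * q + f) * b + o < size B + c ->
  (J + t) * w + (f * phi + o) < size B + overhead (size B).
Proof.
move=> lt_f le_t Fb Fo.
have [b0 q0] := (b_gt0, q_gt0).
have leF : J * q + f <= size B %/ b by rewrite leq_divRL // ltnW.
have leJ : J <= size B %/ (b * q).
  by rewrite divnMA leq_divRL // (leq_trans _ leF) // leq_addr.
have le_t' : t <= size B %/ (b * q * lam).
  by rewrite divnMA (leq_trans le_t) // leq_div2r.
have w_le : w <= q * phi + phi.
  rewrite {1}(divn_eq w phi) leq_add2l ltnW // ltn_mod.
  by rewrite /field_bits addn_gt0 b0 orbT.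
have le1 : (J + t) * w <= J * q * phi + J * phi + t * w.
  by rewrite mulnDl leq_add2r (leq_trans (leq_mul (leqnn J) w_le)) // mulnDr mulnA.
have le2 := leq_mul leJ (leqnn phi).
have le3 := leq_mul le_t' (leqnn w).
have le4 := leq_mul leF (leqnn c).
rewrite /overhead mulSn.
have e : J * q * phi + f * phi = (J * q + f) * c + (J * q + f) * b.
  by rewrite -mulnDl -mulnDr.
move: {lt_f le_t leF leJ le_t' w_le} le1 le2 le3 le4 e Fo Fb.
move: ((J + t) * w) (J * q * phi) (J * phi) (t * w) (f * phi) ((J * q + f) * c).
move: ((J * q + f) * b) (size B %/ b * c) (size B %/ (b * q) * phi).
move: (size B %/ (b * q * lam) * w) (size B) c => *; lia.
Qed.

Lemma position_bound_header t : super_start t < size B -> 0 < t ->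
  t * lam.+1 * w <= size B + overhead (size B).
Proof.
move=> lt_t t0; have lam0 := lam_gt0.
have := @position_bound (t * lam) 0 0 t q_gt0;
  rewrite mulnK // leqnn addn0 mul0n !addn0 mulnS [t + _]addnC.
rewrite /super_start in lt_t; move=> /(_ isT lt_t) lt_p.
by apply/ltnW/lt_p; rewrite ltn_addr.
Qed.

(** This makes the cut in [packed] lossless: everything behind it is zero. A count word is written
    only if its superblock starts inside [B], and then it precedes a data position that is covered
    by the data bound. *)
Lemma word_support p :
  odd (word (p %/ w) %/ 2 ^ (p %% w)) -> p < size B + overhead (size B).
Proof.
have lam0 := lam_gt0.
set j := p %/ w; rewrite {2}(divn_eq p w) -/j; have : p %% w < w by rewrite ltn_mod.
move: (p %% w) => r lt_r; rewrite /word; set t := j %/ lam.+1.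
case: ifP => [/eqP E|/negbT neq].
  case: ifP => [lt_t _|_]; last by rewrite div0n.
  apply: leq_trans (position_bound_header lt_t _) => //.
  by rewrite {1}(divn_eq j lam.+1) E -/t; nia.
have lt_s : j %% lam.+1 < lam by rewrite ltn_neqAle neq -ltnS ltn_mod.
set J := t * lam + _; move=> odd_J.
have Et : t = J %/ lam by rewrite divnMDl // divn_small // addn0.
have Ej : j = J + t by rewrite {1}(divn_eq j lam.+1) -/t mulnS /J; lia.
have phi0 : 0 < phi by rewrite /field_bits addn_gt0 b_gt0 orbT.
have lt_f : r %/ phi < q.
  rewrite ltn_divLR // ltnNge; apply/negP => le_r; move: odd_J.
  by rewrite divn_small // (leq_trans (data_word_lt _)) // -expnM leq_exp2l // mulnC.
have lt_o : r %% phi < phi by rewrite ltn_mod.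
have [Fb Fo] : (J * q + r %/ phi) * b < size B /\
    (J * q + r %/ phi) * b + r %% phi < size B + c.
  apply: odd_field_lt => //; rewrite -data_wordE // odd_modn_exp //.
  by rewrite -divnMA -expnD -divn_eq.
by rewrite Ej {1}(divn_eq r phi) position_bound // Et.
Qed.

Lemma nth_packed p : nth false packed p = odd (word (p %/ w) %/ 2 ^ (p %% w)).
Proof.
case: (ltnP p (size B + overhead (size B))) => [lt_p|ge_p]; first by rewrite nth_mkseq.
rewrite nth_default ?size_mkseq //; apply/esym/negbTE/negP => /word_support.
by rewrite ltnNge ge_p.
Qed.

Lemma bval_packed j : bval w (fun d => nth false packed (j * w + d)) = word j.
Proof.
rewrite -[RHS](bval_odd (word_lt j)); apply: eq_bval => d lt_d.
by rewrite nth_packed divnMDl // modnMDl (divn_small lt_d) (modn_small lt_d) addn0.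
Qed.

(** * Reading one field and its counts *)

Section Lookup.
Variable k : nat.
Hypothesis lt_k : k < size B.
Let F := k %/ b.
Let J := F %/ q.
Let t := J %/ lam.
Let X := word (J + t) %/ 2 ^ (F %% q * phi).

Lemma lookup_field : X %% 2 ^ phi = field F.
Proof. by rewrite /X word_data data_wordE -?divn_eq // ltn_mod q_gt0. Qed.

Lemma lookup_count : X %% 2 ^ c = field_count F.
Proof.
have -> : X %% 2 ^ c = X %% 2 ^ phi %% 2 ^ c by rewrite modn_dvdm // /field_bits expnD dvdn_mulr.
by rewrite lookup_field /field addnC modnMDl modn_small ?field_count_lt.
Qed.

Lemma lookup_data : X %/ 2 ^ c %% 2 ^ b = field_data F.
Proof.
rewrite modn_divl -expnD addnC -/phi lookup_field.
by rewrite /field addnC divnMDl ?expn_gt0 // divn_small ?field_count_lt // addn0.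
Qed.

Lemma lookup_bit : field_data F %/ 2 ^ (k %% b) %% 2 = nth false B k.
Proof. by rewrite modn2 odd_bval ltn_mod b_gt0 -divn_eq. Qed.

Lemma lookup_low : field_data F %% 2 ^ (k %% b) =
  bval b (fun i => (i < k %% b) && nth false B (F * b + i)).
Proof.
have lt_kb : k %% b <= b by rewrite ltnW // ltn_mod b_gt0.
rewrite bval_mod // -{3}(subnKC lt_kb) bvalD [X in _ = _ + _ * X](eq_bval (c := fun=> false)).
  rewrite {3}/bval big1 // muln0 addn0; apply: eq_bval => d -> //.
by move=> d _; rewrite ltnNge leq_addr.
Qed.

Lemma lookup_ones :
  ones B (super_start t) + field_count F + \sum_(i < b) ((i < k %% b) && nth false B (F * b + i))
    = ones B k.
Proof.
have lt_kb : k %% b <= b by rewrite ltnW // ltn_mod b_gt0.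
(* Position [k] lies in [B], so the count of its field has not been zeroed. *)
have Fb : F * b < size B by apply: leq_ltn_trans lt_k; rewrite [leqRHS](divn_eq k b) leq_addr.
rewrite /field_count Fb subnKC; last first.
  by rewrite [F * b]super_startE onesD leq_addr.
rewrite [in RHS](divn_eq k b) onesD; congr (_ + _).
rewrite (big_ord_widen b (fun i => nth false B (F * b + i) : nat) lt_kb).
by rewrite [RHS]big_mkcond; apply: eq_bigr => i _; case: ifP.
Qed.

Lemma super_start_lookup : super_start t < size B.
Proof.
apply: leq_ltn_trans lt_k; rewrite [leqRHS](divn_eq k b).
by apply: leq_trans (leq_addr _ _); rewrite [X in _ <= X](super_startE F) leq_addr.
Qed.

End Lookup.

(** Multiplying by [lam] keeps the estimate in the naturals. The terms are small because lam c = b,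
    lam phi <= 2 b q and w <= 4 b q; the additive [w] comes from the last, possibly partial
    field. *)
Lemma overhead_le n : lam * overhead n <= 7 * n + w.
Proof.
have [lam0 [b0 q0]] := (lam_gt0, (b_gt0, q_gt0)); have lam_q := lam_le_q.
have c_le : c <= b by rewrite leq_double leq_pmulr.
have phi_le : phi <= 2 * b by rewrite /field_bits; lia.
have w_le : w <= 4 * (b * q).
  rewrite {1}(divn_eq w phi) -/q.
  have lt_r : w %% phi < phi by rewrite ltn_mod /field_bits addn_gt0 b0 orbT.
  have le1 := leq_mul (leqnn q) phi_le; have le2 := leq_pmulr b q0.
  rewrite mulnCA (mulnC q b) in le1; apply: leq_trans (leq_add le1 (ltnW lt_r)) _.
  by move: (b * q) le2 => bq le2; lia.
have le1 := leq_divM n b; have le2 := leq_divM n (b * q).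
have le3 := leq_divM n (b * q * lam).
have b_le : b <= w by apply: leq_trans w_large; rewrite leq_pmulr.
have bE : lam * c = b by rewrite /count_bits -muln2 mulnA muln2.
have {}le1 : lam * ((n %/ b).+1 * c) <= n + w by rewrite mulnCA bE mulSn; lia.
have {}le2 : lam * (n %/ (b * q) * phi) <= 2 * n.
  apply: leq_trans (leq_mul (leqnn 2) le2).
  rewrite mulnCA [leqRHS]mulnCA leq_mul2l; apply/orP; right.
  by rewrite mulnA mulnC; apply: leq_mul.
have {}le3 : lam * (n %/ (b * q * lam) * w) <= 4 * n.
  apply: leq_trans (leq_mul (leqnn 4) le3).
  rewrite mulnCA [leqRHS]mulnCA leq_mul2l; apply/orP; right.
  by rewrite mulnA mulnC; apply: leq_mul.
rewrite /overhead 2!(mulnDr lam); apply: leq_trans (leq_add (leq_add le1 le2) le3) _.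
by clear; lia.
Qed.

End Packing.

(** * The binary trie of a set *)

(** Nodes are identified with their root paths, which turns the size of a trie into the cardinality
    of a set of prefixes, independent of the order of insertion. *)
Fixpoint paths (t : btree) : seq bitseq :=
  if t is BNode l r then
    [::] :: [seq false :: p | p <- paths l] ++ [seq true :: p | p <- paths r]
  else [::].

Lemma size_paths t : size (paths t) = bsize t.
Proof. by elim: t => //= l IHl r IHr; rewrite size_cat !size_map IHl IHr. Qed.

Lemma mem_paths_node l r p : (p \in paths (BNode l r)) =
  if p is c :: p' then p' \in paths (if c then r else l) else true.
Proof.
have inj c : injective (cons c) by move=> x y [].
rewrite /= inE mem_cat; case: p => [//|c p] /=.
have F (s : seq bitseq) c' : (c :: p \in [seq c' :: p0 | p0 <- s]) = (c == c') && (p \in s).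
  apply/mapP/andP => [[p0 ps [-> ->]]|[/eqP-> ps]]; first by rewrite eqxx.
  by exists p.
by rewrite !F; case: c {F}; rewrite ?orbF.
Qed.

Lemma uniq_paths t : uniq (paths t).
Proof.
have inj c : injective (@cons bool c) by move=> x y [].
elim: t => //= l IHl r IHr; rewrite cat_uniq !(map_inj_uniq (inj _)) IHl IHr andbT /=.
rewrite mem_cat negb_or; apply/andP; split.
  by apply/andP; split; apply/mapP => -[].
by apply/hasPn => p /mapP[p' _ ->]; apply/mapP => -[].
Qed.

Lemma mem_paths_insert s t p : (p \in paths (binsert s t)) = prefix p s || (p \in paths t).
Proof.
elim: s t p => [|c s IH] t p.
  by case: t => [|l r]; rewrite /= ?mem_paths_node; case: p => [|c p].
case: t => [|l r]; case: p => [|c' p]; case: c; rewrite ?mem_paths_node ?IH //=;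
  case: c'; rewrite ?IH //= ?orbF.
Qed.

Lemma mem_paths_foldr ss t p :
  (p \in paths (foldr binsert t ss)) = has (prefix p) ss || (p \in paths t).
Proof. by elim: ss => //= s ss IH; rewrite mem_paths_insert IH orbA. Qed.

(** Depth 0 is separate so that the empty set keeps its root, as in [bintrie]. *)
Definition trie_node u (A : {set 'I_u}) (d v : nat) : bool :=
  if d is 0 then v == 0
  else (d <= up_log 2 u) && [exists x in A, x %/ 2 ^ (up_log 2 u - d) == v].

Section TrieNode.
Variables (u : nat) (A : {set 'I_u}).
Local Notation l := (up_log 2 u).

Lemma trie_node0 v : trie_node A 0 v = (v == 0).
Proof. by []. Qed.

Lemma ord_lt_exp (x : 'I_u) : x < 2 ^ l.
Proof. exact: leq_trans (ltn_ord x) (up_logP _ _). Qed.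

Lemma trie_nodeS d v : trie_node A d.+1 v -> trie_node A d v./2.
Proof.
move=> /andP[lt_d /existsP[x /andP[xA /eqP E]]].
have E' : x %/ 2 ^ (l - d) = v./2.
  by rewrite -E -divn2 -divnMA -expnSr; congr (_ %/ 2 ^ _); lia.
case: d lt_d E E' => [|d] lt_d E E' /=; last first.
  by rewrite ltnW //; apply/existsP; exists x; rewrite xA E' /=.
by rewrite -E' subn0 divn_small ?ord_lt_exp.
Qed.

Lemma trie_node_in (x : 'I_u) d : x \in A -> d <= l -> trie_node A d (x %/ 2 ^ (l - d)).
Proof.
move=> xA; case: d => [|d] le_d /=; first by rewrite subn0 divn_small ?ord_lt_exp.
by rewrite le_d; apply/existsP; exists x; rewrite xA eqxx.
Qed.

Lemma trie_node_leaf v : 0 < l -> trie_node A l v = [exists x in A, val x == v].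
Proof.
rewrite /trie_node; case E: l => [//|n] _; rewrite -E leqnn subnn /=.
by apply: eq_existsb => x; rewrite divn1.
Qed.

Lemma count_leaves v : 0 < l -> before (trie_node A) l v = #|[set y in A | y < v]|.
Proof.
move=> l0; rewrite /before -size_filter cardE -(size_map val).
apply: perm_size; apply: uniq_perm.
- by rewrite filter_uniq ?iota_uniq.
- by rewrite (map_inj_uniq val_inj) enum_uniq.
move=> y; rewrite mem_filter mem_iota /= add0n trie_node_leaf //.
apply/andP/mapP => [[/existsP[x /andP[xA /eqP Ex]] lt_y]|[x]].
  by exists x => //; rewrite mem_enum inE xA Ex.
rewrite mem_enum inE => /andP[xA lt_x] ->; split => //.
by apply/existsP; exists x; rewrite xA /=.
Qed.

Lemma prefix_bin_enc n x p : prefix p (bin_enc n x) =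
  (size p <= n) && (p == bin_enc (size p) (x %/ 2 ^ (n - size p))).
Proof.
rewrite prefixE /bin_enc; case: leqP => [le_p|gt_p]; last first.
  apply/negbTE; apply: contraTneq gt_p => <-.
  by rewrite -leqNgt size_take size_mkseq geq_minr.
rewrite /= [LHS]eq_sym; congr (_ == _); rewrite /mkseq -map_take take_iota (minn_idPl le_p).
apply/eq_in_map => i; rewrite mem_iota /= => lt_i.
by rewrite -divnMA -expnD; congr (odd (_ %/ 2 ^ _)); rewrite addnBA // subnK.
Qed.

Lemma bin_enc_inj n x y : x < 2 ^ n -> y < 2 ^ n -> bin_enc n x = bin_enc n y -> x = y.
Proof.
move=> ltx lty E; rewrite -(bval_odd ltx) -(bval_odd lty); apply: eq_bval => d lt_d.
have := congr1 (fun s => nth false s (n - d.+1)) E.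
rewrite !nth_mkseq; try lia.
by rewrite (_ : n - (n - d.+1).+1 = d) //; lia.
Qed.

Lemma size_bin_enc n x : size (bin_enc n x) = n.
Proof. exact: size_mkseq. Qed.

(** Both sides count prefixes: the [d]-bit prefix of the code of [x] is the code of x / 2^(l - d),
    and distinct nodes have distinct codes. *)
Lemma bsize_bintrie : bsize (bintrie A) = start (trie_node A) l.+1.
Proof.
rewrite -size_paths -(size_nodes (trie_node A)).
rewrite -(size_map (fun p => bin_enc p.1 p.2)).
have mem_nodes p : (p \in nodes (trie_node A) l.+1) =
    (p.1 <= l) && trie_node A p.1 p.2.
  case: p => d v; apply/flattenP/andP => /= [[s /mapP[e]]|[le_d Tv]].
    rewrite mem_iota /= => lt_e -> /mapP[x].
    by rewrite mem_filter => /andP[Tx _] [-> ->].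
  exists (level (trie_node A) d (2 ^ d)).
    by apply/mapP; exists d; rewrite ?mem_iota.
  apply/mapP; exists v => //; rewrite mem_filter Tv mem_iota /=.
  exact: (node_lt trie_node0 trie_nodeS).
apply: perm_size; apply: uniq_perm; first exact: uniq_paths.
  rewrite map_inj_in_uniq => [|[d v] [d' v']]; last first.
    rewrite !mem_nodes /= => /andP[_ Tv] /andP[_ Tv'] E.
    have Ed : d = d' by have := congr1 size E; rewrite !size_bin_enc.
    rewrite -Ed in Tv' E *; congr (_, _); apply: bin_enc_inj E;
      exact: (node_lt trie_node0 trie_nodeS).
  apply: uniq_nodes.
move=> p; rewrite mem_paths_foldr mem_paths_node.
apply/orP/mapP => [|[[d v]]].
  case: p => [_|c p].
    by exists (0, 0); rewrite ?mem_nodes.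
  case; last by case: c.
  move=> /hasP[s /mapP[x xA ->]]; rewrite prefix_bin_enc => /andP[le_p /eqP Ep].
  rewrite mem_enum in xA.
  eexists (size (c :: p), _); last exact: Ep.
  by rewrite mem_nodes le_p trie_node_in.
rewrite mem_nodes /= => /andP[le_d Tv] ->.
case: d le_d Tv => [|d] le_d; first by right.
move=> /andP[_ /existsP[x /andP[xA /eqP Ev]]]; left; apply/hasP.
exists (bin_enc l x); first by apply/mapP; exists x; rewrite ?mem_enum.
by rewrite prefix_bin_enc size_bin_enc le_d Ev eqxx.
Qed.

(** There is one edge less than nodes, and the nodes of depth [l] are the elements. Two bits per
    internal node therefore give the leading term 2 (trie - n + 1). *)
Lemma trie_start : 0 < l -> start (trie_node A) l + #|A| = (trie A).+1.
Proof.
move=> l0; rewrite /trie /bedges bsize_bintrie prednK; last first.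
  by apply: leq_trans (start_le (trie_node A) (ltn0Sn l)); rewrite /start big_ord1.
rewrite startS count_leaves //; congr (_ + _).
by apply: eq_card => x; rewrite inE ord_lt_exp andbT.
Qed.

End TrieNode.

(** * Nodes common to all tries of a query *)

Section Alternation.
Variables (u N : nat) (S : 'I_N -> {set 'I_u}) (Q : seq 'I_N).
Hypothesis (u_gt0 : 0 < u) (Q_gt0 : 0 < size Q).
Local Notation l := (up_log 2 u).

Definition alive (d v : nat) : bool := all (fun i => trie_node (S i) d v) Q.

Lemma mem_inter x : (x \in inter S Q) = all (fun i => x \in S i) Q.
Proof. by apply/bigcapP/allP. Qed.

Lemma singleton_certificate : certificate S Q (singleton_blocks u).
Proof.
apply/and4P; split.
- apply/and3P; split.
  + apply/eqP/setP => x; rewrite finset.in_setT; apply/bigcupP.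
    exists [set x]; last by rewrite inE.
    by apply/imsetP; exists x; rewrite ?finset.in_setT.
  + apply/finset.trivIsetP => A B /imsetP[x _ ->] /imsetP[y _ ->] neq.
    rewrite disjoints1 inE; apply: contraNN neq => /eqP->; exact: eqxx.
  + by apply/imsetP => -[x _] /setP/(_ x); rewrite !inE eqxx.
- apply/forall_inP => B /imsetP[x _ ->]; apply/existsP; exists x; apply/existsP; exists x.
  by apply/eqP/setP => y; rewrite !inE -eqn_leq eq_sym.
- by apply/forall_inP => x _; apply/imsetP; exists x; rewrite ?finset.in_setT.
apply/forall_inP => x; rewrite finset.in_setC mem_inter => /allPn[q qQ xq].
apply/existsP; exists [set x]; rewrite [X in X && _](_ : _ = true); last first.
  by apply/imsetP; exists x; rewrite ?finset.in_setT.
rewrite inE eqxx /=; apply/existsP; exists q; rewrite qQ /=.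
by rewrite finset.setIC finset.setI_eq0 disjoints1.
Qed.

Lemma alternation_certificate : exists2 P, certificate S Q P & alternation S Q = #|P|.
Proof.
rewrite /alternation; case: arg_minnP => [|P cP _]; first exact: singleton_certificate.
by exists P.
Qed.

(** The interval of a node may reach beyond the universe, but its first point is 0 at the root, and
    elsewhere at most an element of a queried set below the node. *)
Lemma alive_first_lt d v : d <= l -> alive d v -> v * 2 ^ (l - d) < u.
Proof.
have [q qQ] : exists q, q \in Q by case: Q Q_gt0 => // q Q' _; exists q; rewrite inE eqxx.
move=> le_d /allP/(_ q qQ).
case: d le_d => [|d] le_d; first by move=> /eqP->; rewrite mul0n.
move=> /andP[_ /existsP[x /andP[_ /eqP<-]]].
by apply: leq_ltn_trans (ltn_ord x); exact: leq_divM.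
Qed.

Lemma alive_in d v q : d <= l -> alive d.+1 v -> q \in Q ->
  exists2 x : 'I_u, x \in S q & x %/ 2 ^ (l - d.+1) = v.
Proof.
by move=> _ /allP al /al /andP[_ /existsP[x /andP[xS /eqP E]]]; exists x.
Qed.

Lemma alive_distinct_blocks d v v' (x0 : 'I_u) P B : certificate S Q P ->
  d < l -> alive d.+1 v -> alive d.+1 v' -> v < v' -> B \in P ->
  insubd x0 (v * 2 ^ (l - d.+1)) \in B -> insubd x0 (v' * 2 ^ (l - d.+1)) \in B -> False.
Proof.
move=> /and4P[/and3P[_ tP _] /forall_inP intP /forall_inP inP /forall_inP outP].
move=> lt_d al al' lt_v BP; set a := insubd _ _; set a' := insubd _ _ => aB a'B.
have Ea : val a = v * 2 ^ (l - d.+1) by rewrite val_insubd (alive_first_lt lt_d al).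
have Ea' : val a' = v' * 2 ^ (l - d.+1) by rewrite val_insubd (alive_first_lt lt_d al').
have blockE C : C \in P -> a \in C -> C = B.
  by move=> CP aC; rewrite -(finset.def_pblock tP CP aC) -(finset.def_pblock tP BP aB).
have p0 : 0 < 2 ^ (l - d.+1) by rewrite expn_gt0.
have [ai|ani] := boolP (a \in inter S Q).
  have E := blockE _ (inP a ai) (finset.set11 a).
  move: a'B; rewrite -E inE => /eqP/(congr1 val); rewrite Ea Ea' => /eqP.
  by rewrite eqn_pmul2r // gtn_eqF.
have /outP/existsP[C /and3P[CP aC /existsP[q /andP[qQ /eqP SC]]]] : a \in ~: inter S Q.
  by rewrite finset.in_setC.
have [x xS Ex] := alive_in (ltnW lt_d) al qQ.
suff : x \in S q :&: C by rewrite SC finset.in_set0.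
rewrite inE xS (blockE C CP aC) /=.
have /existsP[s /existsP[t /eqP EB]] := intP B BP.
move: aB a'B; rewrite EB !inE => /andP[sa _] /andP[_ a't].
have le_ax : a <= x by rewrite Ea -Ex leq_divM.
have lt_xa' : x < a'.
  rewrite Ea'; apply: leq_trans (ltn_ceil x p0) _; rewrite Ex.
  by rewrite leq_mul2r lt_v orbT.
by rewrite (leq_trans sa le_ax) (leq_trans (ltnW lt_xa') a't).
Qed.

Lemma count_alive_certificate d P : certificate S Q P -> d <= l ->
  before alive d (2 ^ d) <= #|P|.
Proof.
move=> cP le_d; have x0 : 'I_u := Ordinal u_gt0.
have /and3P[/eqP coverP tP _] : finset.partition P [set: 'I_u] by case/and4P: cP.
have blockP x : finset.pblock P x \in P by rewrite finset.pblock_mem // coverP finset.in_setT.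
have mem_block x : x \in finset.pblock P x by rewrite finset.mem_pblock coverP finset.in_setT.
(* The root is alive even with no element below it, so depth 0 only uses that the partition is
   nonempty. *)
case: d le_d => [|d] le_d.
  by apply: leq_trans (before_le _ _ _) _; rewrite expn0 card_gt0; apply/set0Pn;
    exists (finset.pblock P x0).
rewrite /before -size_filter -(size_map (fun v => finset.pblock P (insubd x0 (v * 2 ^ (l -
  d.+1))))) cardE.
apply: uniq_leq_size; last first.
  by move=> B /mapP[v _ ->]; rewrite mem_enum.
rewrite map_inj_in_uniq ?filter_uniq ?iota_uniq // => v v'.
rewrite !mem_filter => /andP[al _] /andP[al' _] E.
case: (ltngtP v v') => // lt_v.
  have := alive_distinct_blocks (x0 := x0) cP le_d al al' lt_v (blockP _) (mem_block _).
  by rewrite E => /(_ (mem_block _)).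
have := alive_distinct_blocks (x0 := x0) cP le_d al' al lt_v (blockP _) (mem_block _).
by rewrite -E => /(_ (mem_block _)).
Qed.

Lemma count_alive d : d <= l -> before alive d (2 ^ d) <= alternation S Q.
Proof. by move=> le_d; have [P cP ->] := alternation_certificate;
  exact: count_alive_certificate. Qed.

Lemma alternation_gt0 : 0 < alternation S Q.
Proof.
have [P /and4P[/and3P[/eqP cP _ _] _ _ _] ->] := alternation_certificate.
rewrite card_gt0; apply: contra_eq_neq cP => ->.
rewrite /finset.cover finset.big_set0; apply/eqP => /setP/(_ (Ordinal u_gt0)).
by rewrite !inE.
Qed.

Lemma alternation_le : alternation S Q <= u.
Proof.
rewrite /alternation; case: arg_minnP => [|P _ min]; first exact: singleton_certificate.
apply: leq_trans (min _ singleton_certificate) _.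
by rewrite (leq_trans (leq_imset_card _ _)) // cardsT card_ord.
Qed.

(** * Summing the common nodes over the levels *)

Definition height_excess : nat := l - trunc_log 2 (alternation S Q).

(** The levels above depth e = floor (lg delta) have fewer than 2^e <= delta nodes altogether; each
    of the others has at most delta common ones. *)
Lemma total_alive : start alive l.+1 <= alternation S Q * height_excess.+2.
Proof.
set e := trunc_log 2 (alternation S Q).
have d0 := alternation_gt0.
have le_e : 2 ^ e <= alternation S Q by exact: trunc_logP.
have el : e <= l.
  rewrite -(leq_exp2l (m := 2)) // (leq_trans le_e) // (leq_trans alternation_le) //.
  exact: up_logP.
have F k : e + k <= l.+1 -> start alive (e + k) <= alternation S Q * k.+1.
  elim: k => [_|k IH le_k].
    by rewrite addn0 muln1 (leq_trans _ le_e) // ltnW // start_lt.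
  rewrite addnS startS [in leqRHS]mulnS addnC leq_add ?IH ?count_alive //; lia.
have -> : l.+1 = e + (height_excess).+1 by rewrite /height_excess -/e; lia.
by apply: F; rewrite /height_excess -/e; lia.
Qed.

(** Since e < 2^e <= delta. This charges the O(w) and O(k lg u) start-up costs of a query to the
    main bound. *)
Lemma height_le : l <= alternation S Q * height_excess.+1.
Proof.
set e := trunc_log 2 (alternation S Q).
have d0 := alternation_gt0.
have : e < alternation S Q by apply: leq_trans (trunc_logP (isT : 1 < 2) d0); apply: ltn_expl.
by rewrite /height_excess -/e; nia.
Qed.

End Alternation.

Local Notation eval := Defs.eval.
Local Notation mem := Defs.mem.
Local Notation set_mem := Defs.set_mem.

(** * Reasoning about programs *)

Section Machine.
Variables (w : nat) (D : nat -> nat -> nat).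
Implicit Types (c : cmd) (s : state) (P : state -> Prop).

Definition runs c s n P : Prop :=
  exists t s', [/\ exec w D c s t s', t <= n & P s'].

Lemma runs_weaken c s n n' P P' :
  runs c s n P -> n <= n' -> (forall s', P s' -> P' s') -> runs c s n' P'.
Proof.
by move=> [t [s' [ex le_t Ps']]] le_n PP'; exists t, s'; split; [|exact: leq_trans le_n|exact: PP'].
Qed.

Lemma runs_seq c1 c2 s n1 n2 P1 P2 : runs c1 s n1 P1 ->
  (forall s', P1 s' -> runs c2 s' n2 P2) -> runs (Seq c1 c2) s (n1 + n2) P2.
Proof.
move=> [t1 [s1 [ex1 le1 P1s]]] /(_ _ P1s)[t2 [s2 [ex2 le2 P2s]]].
by exists (t1 + t2), s2; split; [apply: ExecSeq ex1 ex2|apply: leq_add|].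
Qed.

Lemma runs_if a c1 c2 s n P :
  runs (if eval w s a != 0 then c1 else c2) s n P -> runs (If a c1 c2) s n.+1 P.
Proof. by move=> [t [s' [ex le_t Ps']]]; exists t.+1, s'; split; [apply: ExecIf|..]. Qed.

Lemma runs_while_done a c s P : eval w s a = 0 -> P s -> runs (While a c) s 1 P.
Proof. by move=> a0 Ps; exists 1, s; split; [apply: ExecWhileF|..]. Qed.

Lemma runs_while_step a c s n1 n2 P1 P2 : eval w s a != 0 -> runs c s n1 P1 ->
  (forall s', P1 s' -> runs (While a c) s' n2 P2) -> runs (While a c) s (n1 + n2).+1 P2.
Proof.
move=> a0 [t1 [s1 [ex1 le1 P1s]]] /(_ _ P1s)[t2 [s2 [ex2 le2 P2s]]].
exists (t1 + t2).+1, s2; split; [apply: ExecWhileT ex1 ex2 => //| |] => //.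
by rewrite ltnS leq_add.
Qed.

Definition simple c : bool :=
  match c with
  | Op _ _ _ _ | Fetch _ _ _ | Store _ _ _ | Probe _ _ _ | Emit _ => true
  | _ => false
  end.

Definition act s c : state :=
  match c with
  | Op r o a b => set_reg s r (binop_fun w o (eval w s a) (eval w s b))
  | Fetch r a b => set_reg s r (mem s (eval w s a) (eval w s b))
  | Store a b v => set_mem s (eval w s a) (eval w s b) (eval w s v)
  | Probe r i j => set_reg s r (D (eval w s i) (eval w s j))
  | Emit a => add_out s (eval w s a)
  | _ => s
  end.

Definition block (cs : seq cmd) : cmd := foldr Seq Skip cs.

#[global] Arguments block : simpl never.

Lemma runs_block cs s P : all simple cs -> P (foldl act s cs) ->
  runs (block cs) s (size cs).+1 P.
Proof.
elim: cs s => [|c cs IH] s /=; first by exists 1, s; split=> //; apply: ExecSkip.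
move=> /andP[sc scs] Ps; have [t [s' [ex le_t Ps']]] := IH _ scs Ps.
exists (1 + t), s'; split=> //; apply: ExecSeq ex.
by case: c sc {Ps} => // *; constructor.
Qed.

Lemma acts_op r o a b cs s v P : binop_fun w o (eval w s a) (eval w s b) = v ->
  P (foldl act (set_reg s r v) cs) -> P (foldl act s (Op r o a b :: cs)).
Proof. by move=> <-. Qed.

Lemma acts_probe r a b cs s v P : D (eval w s a) (eval w s b) = v ->
  P (foldl act (set_reg s r v) cs) -> P (foldl act s (Probe r a b :: cs)).
Proof. by move=> <-. Qed.

Definition targets (cs : seq cmd) : seq nat :=
  flatten [seq match c with Op r _ _ _ | Fetch r _ _ | Probe r _ _ => [:: r] | _ => [::] end
          | c <- cs].

Definition frame (rs : seq nat) s s' : Prop :=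
  [/\ forall r, r \notin rs -> regs s' r = regs s r, mem s' = mem s & out s' = out s].

Lemma frame_refl rs s : frame rs s s.
Proof. by []. Qed.

Lemma frame_trans rs s1 s2 s3 : frame rs s1 s2 -> frame rs s2 s3 -> frame rs s1 s3.
Proof.
move=> [r12 m12 o12] [r23 m23 o23]; split; rewrite ?m23 ?o23 // => r rrs.
by rewrite r23 // r12.
Qed.

Lemma frame_sub rs rs' s s' : {subset rs <= rs'} -> frame rs s s' -> frame rs' s s'.
Proof. by move=> sub [rE mE oE]; split=> // r rrs; apply: rE; apply: contra rrs => /sub. Qed.

Lemma regs_set_reg s r v r' : regs (set_reg s r v) r' = if r' == r then v else regs s r'.
Proof. by []. Qed.

Lemma frame_set_reg rs s r v : r \in rs -> frame rs s (set_reg s r v).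
Proof.
move=> rrs; split=> // r' r'rs; rewrite regs_set_reg.
by case: eqP => // E; rewrite -E in rrs; rewrite rrs in r'rs.
Qed.

Definition pure c : bool := match c with Op _ _ _ _ | Fetch _ _ _ | Probe _ _ _ => true | _
  => false end.

Lemma frame_acts cs s : all pure cs -> frame (targets cs) s (foldl act s cs).
Proof.
elim: cs s => [|c cs IH] s //= /andP[pc pcs].
apply: frame_trans (frame_sub _ (IH _ pcs)).
  case: c pc {IH pcs} => // r *; apply: frame_set_reg; exact: mem_head.
by move=> r rrs; rewrite /targets /= mem_cat rrs orbT.
Qed.

Lemma frame_block rs cs s : all pure cs -> all [in rs] (targets cs) ->
  frame rs s (foldl act s cs).
Proof. by move=> pcs /allP sub; apply: frame_sub sub (frame_acts _ pcs). Qed.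

Definition for_loop (j c n : nat) (body : cmd) : cmd :=
  Seq (block [:: Op j OpMul (Cst 0) (Cst 0); Op c OpLt (Reg j) (Reg n)])
    (While (Reg c)
      (Seq body (block [:: Op j OpAdd (Reg j) (Cst 1); Op c OpLt (Reg j) (Reg n)]))).

(** The invariant has to tolerate changes of the counter and of the test register, which the loop
    itself writes. Besides the body a round costs 4 steps: the test, two instructions and the
    closing [Skip]. *)
Lemma runs_for (Inv : nat -> state -> Prop) (j c n : nat) body m tb s :
  0 < w -> m < 2 ^ w -> uniq [:: j; c; n] ->
  (forall i s, Inv i s -> regs s n = m) ->
  (forall i s s', frame [:: j; c] s s' -> Inv i s -> Inv i s') ->
  (forall i s, i < m -> regs s j = i -> Inv i s ->
    runs body s tb (fun s' => regs s' j = i /\ Inv i.+1 s')) ->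
  Inv 0 s -> runs (for_loop j c n body) s (m * (tb + 4) + 4) (Inv m).
Proof.
move=> w0 lt_m; rewrite /= !inE negb_or andbT => /andP[/andP[jc jn] cn] Invn Invf Invb Inv0.
have w1 : 1 < 2 ^ w by rewrite -{1}(expn0 2) ltn_exp2l.
have bmod (b : bool) : b %% 2 ^ w = b by rewrite modn_small //; case: b => //; exact: ltnW.
pose P i s' := [/\ Inv i s', regs s' j = i & regs s' c = (i < m)].
have -> : m * (tb + 4) + 4 = 3 + (m * (tb + 4) + 1) by lia.
apply: (@runs_seq _ _ _ _ _ (P 0)).
  apply: runs_block => //=; split.
  - by apply: Invf Inv0; split=> // r;
    rewrite !inE negb_or => /andP[/negbTE rj /negbTE rc] /=; rewrite rc rj.
  - by rewrite /= eqxx (negbTE jc) /binop_fun ?(mod0n, mul0n).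
  - by rewrite /= !eqxx [n == j]eq_sym (negbTE jn) (Invn _ _ Inv0) /binop_fun ?(mod0n,
    mul0n, eqxx) bmod.
suff F k i s' : k + i = m -> P i s' ->
    runs (While (Reg c) (Seq body (block [:: Op j OpAdd (Reg j) (Cst 1);
      Op c OpLt (Reg j) (Reg n)])))
      s' (k * (tb + 4) + 1) (Inv m).
  by move=> s' Ps'; apply: (F m 0); rewrite ?addn0.
elim: k i s' => [|k IH] i s' E [Invi ji ci].
  by apply: runs_while_done => /=; [rewrite ci -E ltnn|rewrite -E].
have lt_i : i < m by rewrite -E; lia.
have -> : k.+1 * (tb + 4) + 1 = ((tb + 3) + (k * (tb + 4) + 1)).+1 by lia.
apply: (@runs_while_step _ _ _ _ _ (P i.+1)); first by rewrite /= ci lt_i.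
  apply: runs_seq (Invb _ _ lt_i ji Invi) _ => s2 [j2 Inv2].
  apply: runs_block => //=.
  have E1 : (i + 1 %% 2 ^ w) %% 2 ^ w = i.+1.
    by rewrite (modn_small w1) modn_small addn1 // (leq_ltn_trans lt_i).
  split.
  - by apply: Invf Inv2; split=> // r;
    rewrite !inE negb_or => /andP[/negbTE rj /negbTE rc] /=; rewrite rc rj.
  - by rewrite /= (negbTE jc) eqxx j2 /binop_fun E1.
  - by rewrite /= !eqxx [n == j]eq_sym (negbTE jn) (Invn _ _ Inv2) j2 /binop_fun E1 bmod.
by move=> s2 P2; apply: (IH i.+1) => //; lia.
Qed.

End Machine.

(** * Navigating a packed trie in constant time *)

(* Registers 0-13 hold the constants [consts] below; a lookup reads the set in
   20, the node in 21 and the side in 22, and leaves the bit in 23 and the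
   number of the child in 24. *)
Definition lookup_code : seq cmd := [::
  Op 30 OpDiv (Reg 21) (Reg 5);
  Op 31 OpMod (Reg 21) (Reg 5);
  Op 32 OpDiv (Reg 30) (Reg 8);
  Op 33 OpMod (Reg 30) (Reg 8);
  Op 34 OpDiv (Reg 32) (Reg 4);
  Op 35 OpAdd (Reg 32) (Reg 34);
  Probe 36 (Reg 20) (Reg 35);
  Op 37 OpMul (Reg 33) (Reg 7);
  Op 36 OpShr (Reg 36) (Reg 37);
  Op 38 OpMod (Reg 36) (Reg 9);
  Op 36 OpShr (Reg 36) (Reg 6);
  Op 36 OpMod (Reg 36) (Reg 10);
  Op 31 OpAdd (Reg 31) (Reg 31);
  Op 31 OpAdd (Reg 31) (Reg 22);
  Op 23 OpShr (Reg 36) (Reg 31);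
  Op 23 OpMod (Reg 23) (Cst 2);
  Op 39 OpShl (Cst 1) (Reg 31);
  Op 36 OpMod (Reg 36) (Reg 39);
  Op 36 OpMul (Reg 36) (Reg 11);
  Op 36 OpAnd (Reg 36) (Reg 12);
  Op 36 OpMod (Reg 36) (Reg 13);
  Op 39 OpAdd (Reg 4) (Cst 1);
  Op 39 OpMul (Reg 34) (Reg 39);
  Op 39 OpSub (Reg 39) (Cst 1);
  Probe 39 (Reg 20) (Reg 39);
  Op 40 OpLt (Cst 0) (Reg 34);
  Op 39 OpMul (Reg 39) (Reg 40);
  Op 24 OpAdd (Reg 39) (Reg 38);
  Op 24 OpAdd (Reg 24) (Reg 36);
  Op 24 OpAdd (Reg 24) (Cst 1)].

Section WordParameters.

Variable w : nat.
Hypothesis w_gt0 : 0 < w.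
Hypothesis w_large : data_bits w * (data_bits w).+1 <= w.

Local Notation lam := (wordlog w).
Local Notation h := (node_field w).
Local Notation b := (data_bits w).
Local Notation c := (count_bits w).
Local Notation phi := (field_bits w).
Local Notation q := (word_fields w).

Definition popcount_copies : nat := \sum_(i < b) (2 ^ b) ^ i.
Definition popcount_mask : nat := \sum_(i < b) (2 ^ b.+1) ^ i.

Definition consts (k u : nat) : seq nat :=
  [:: k; u; w; up_log 2 u; lam; h; c; phi; q; 2 ^ c; 2 ^ b; popcount_copies; popcount_mask;
    2 ^ b.+1 - 1].

Definition env k u (s : state) : Prop := forall r, r < 14 -> regs s r = nth 0 (consts k u) r.

Lemma env_frame k u rs s s' : all (leq 14) rs -> frame rs s s' -> env k u s -> env k u s'.
Proof.
move=> /allP ge14 [rE _ _] envs r lt_r; rewrite rE ?envs //.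
by apply: contraTN lt_r => /ge14; rewrite -leqNgt.
Qed.

Lemma exp_gt1 : 1 < 2 ^ w.
Proof. by rewrite -{1}(expn0 2) ltn_exp2l. Qed.

Lemma le_w_lt x : x <= w -> x < 2 ^ w.
Proof. by move=> le_x; apply: leq_ltn_trans le_x (ltn_expl _ _). Qed.

Lemma lam_gt1 : 1 < lam.
Proof.
have b2 := b_gt0 w_gt0; have := bitlen_lt w; rewrite -/(wordlog w).
have : 4 <= w by move: w_large b2; rewrite /data_bits -muln2; nia.
by case: (wordlog w) => [|[|]] //; rewrite ?expn0 ?expn1; lia.
Qed.

Lemma b_le_w : b <= w.
Proof. by apply: leq_trans w_large; rewrite leq_pmulr. Qed.

Lemma phi_le_w : phi <= w.
Proof.
have := q_phi_le w; have := q_gt0 w_gt0 w_large.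
by move: q phi => [|q'] p // _; rewrite mulSn; lia.
Qed.

Lemma lam_le_c : lam <= c. Proof. by rewrite /count_bits -addnn leq_addr. Qed.

Lemma c_le_w : c <= w.
Proof. by apply: leq_trans phi_le_w; rewrite /field_bits leq_addr. Qed.

Lemma h_le_w : h <= w.
Proof. by apply: leq_trans b_le_w; rewrite /data_bits -addnn leq_addr. Qed.

Lemma b2E : b = h * 2. Proof. by rewrite /data_bits muln2. Qed.

Lemma h_gt0 : 0 < h.
Proof. by rewrite /node_field muln_gt0 lam_gt0. Qed.

Variables (k u : nat) (D : nat -> nat -> nat) (B : bitseq) (i n : nat) (e : bool).
Hypothesis D_word : forall j, D i j = word w B j.
Hypothesis lt_size : n.*2 + e < size B.
Hypothesis lt_n : n < 2 ^ w.

Let K := n.*2 + e.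
Let F := n %/ h.
Let J := F %/ q.
Let t := J %/ lam.

Let FE : K %/ b = F.
Proof. by rewrite /K b2E (mulnC h) divnMA -muln2 divnMDl // [e %/ 2]divn_small ?addn0 //;
  case: e. Qed.

Let KmodE : K %% b = (n %% h).*2 + e.
Proof.
have h0 := h_gt0.
rewrite /K b2E {1}(divn_eq n h) doubleD -muln2 -mulnA -addnA modnMDl modn_small //.
by have := ltn_pmod n h0; case: e; rewrite muln2; lia.
Qed.

(** A word has at least two fields. Hence J + t and t (lam + 1), both at most 2 J, do not
    overflow. *)
Let lt_J : J.*2 <= n.
Proof.
have q2 : 1 < q := leq_trans lam_gt1 (lam_le_q w_gt0 w_large).
rewrite -muln2; apply: leq_trans (leq_mul (leqnn J) q2) _.
by apply: leq_trans (leq_divM F q) _; apply: leq_div.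
Qed.

Lemma lookup_acts s : env k u s -> regs s 20 = i -> regs s 21 = n -> regs s 22 = e ->
  let s' := foldl (act w D) s lookup_code in
  regs s' 23 = nth false B K /\ regs s' 24 = (ones B K).+1 %% 2 ^ w.
Proof.
move=> env_s s20 s21 s22.
have {}env_s r : r < 14 -> regs s r = nth 0 (consts k u) r by apply: env_s.
pose P s' := regs s' 23 = nth false B K :> nat /\ regs s' 24 = (ones B K).+1 %% 2 ^ w.
change (P (foldl (act w D) s lookup_code)).
have [b0 h0] := (b_gt0 w_gt0, h_gt0).
have lt1 := exp_gt1.
have lt2 : 2 %% 2 ^ w = 2.
  by rewrite modn_small // (@leq_trans (2 ^ 2)) // leq_exp2l // (leq_trans lam_gt1) //
    (leq_trans lam_le_c c_le_w).
have divlt x y : x < 2 ^ w -> (x %/ y) %% 2 ^ w = x %/ y.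
  by move=> lt_x; rewrite modn_small // (leq_ltn_trans (leq_div _ _)).
have modlt x y : x < 2 ^ w -> (x %% y) %% 2 ^ w = x %% y.
  by move=> lt_x; rewrite modn_small // (leq_ltn_trans (leq_mod _ _)).
have boollt (x : bool) : x %% 2 ^ w = x by rewrite modn_small //; case: x => //; exact: ltnW.
have lt_F : F < 2 ^ w by apply: leq_ltn_trans lt_n; exact: leq_div.
have lt_J2 : J < 2 ^ w by move: lt_J lt_n; lia.
have le_t : t <= J by exact: leq_div.
have lam_t : t * lam <= J by exact: leq_divM.
have lt_Kb : K %% b < b by rewrite ltn_mod.
have lt_Kw : K %% b < w by apply: leq_trans lt_Kb b_le_w.
have lt_data := field_data_lt w B F.
have le_bw : 2 ^ b <= 2 ^ w by rewrite leq_exp2l // b_le_w.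
pose X := word w B (J + t) %/ 2 ^ (F %% q * phi).
pose pop := \sum_(j < b) ((j < K %% b) && nth false B (F * b + j)).
have count_eq : X %% 2 ^ c = field_count w B F.
  by have := lookup_count B w_gt0 w_large K; rewrite FE.
have data_eq : X %/ 2 ^ c %% 2 ^ b = field_data w B F.
  by have := lookup_data B w_gt0 w_large K; rewrite FE.
have bit_eq : field_data w B F %/ 2 ^ (K %% b) %% 2 = nth false B K.
  by have := lookup_bit B w_gt0 K; rewrite FE.
have low_eq : field_data w B F %% 2 ^ (K %% b) =
    bval b (fun i => (i < K %% b) && nth false B (F * b + i)).
  by have := lookup_low B w_gt0 K; rewrite FE.
have ones_eq : ones B (super_start w t) + field_count w B F + pop = ones B K.
  by have := lookup_ones w_gt0 lt_size; rewrite -/K FE.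
have start_eq : super_start w t < size B.
  by have := super_start_lookup w lt_size; rewrite -/K FE.
have lt_word j : word w B j < 2 ^ w by exact: word_lt.
have q0 := q_gt0 w_gt0 w_large.
rewrite /lookup_code.
apply: (acts_op (v := F)); first by rewrite /= s21 env_s //= /binop_fun divlt.
apply: (acts_op (v := n %% h)); first by rewrite /= s21 env_s //= /binop_fun modlt.
apply: (acts_op (v := J)); first by rewrite /= env_s //= /binop_fun divlt.
apply: (acts_op (v := F %% q)); first by rewrite /= env_s //= /binop_fun modlt.
apply: (acts_op (v := t)); first by rewrite /= env_s //= /binop_fun divlt.
apply: (acts_op (v := J + t)).
  by rewrite /= /binop_fun modn_small //; move: lt_J lt_n le_t; clear; lia.
apply: (acts_probe (v := word w B (J + t))); first by rewrite /= s20 D_word.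
apply: (acts_op (v := F %% q * phi)).
  rewrite /= env_s //= /binop_fun modn_small // le_w_lt // (leq_trans _ (q_phi_le w)) //.
  by rewrite leq_mul2r ltnW ?orbT // ltn_mod.
apply: (acts_op (v := X)); first by rewrite /= /binop_fun divlt.
have lt_X : X < 2 ^ w by apply: leq_ltn_trans (leq_div _ _) _.
apply: (acts_op (v := field_count w B F)).
  by rewrite /= env_s //= /binop_fun modlt.
apply: (acts_op (v := X %/ 2 ^ c)); first by rewrite /= env_s //= /binop_fun divlt.
apply: (acts_op (v := field_data w B F)).
  by rewrite /= env_s //= /binop_fun data_eq modn_small // (leq_trans lt_data).
apply: (acts_op (v := (n %% h).*2)).
  rewrite /= /binop_fun addnn modn_small // (leq_ltn_trans _ (le_w_lt (ltnW lt_Kw))) //.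
  by rewrite KmodE leq_addr.
apply: (acts_op (v := K %% b)).
  by rewrite /= s22 /binop_fun -KmodE modn_small // le_w_lt // ltnW.
apply: (acts_op (v := field_data w B F %/ 2 ^ (K %% b))).
  by rewrite /= /binop_fun divlt // (leq_trans lt_data).
apply: (acts_op (v := nth false B K)).
  by rewrite /= lt2 /binop_fun bit_eq boollt.
apply: (acts_op (v := 2 ^ (K %% b))).
  by rewrite /= /binop_fun (modn_small lt1) mul1n modn_small // ltn_exp2l.
apply: (acts_op (v := bval b (fun i => (i < K %% b) && nth false B (F * b + i)))).
  by rewrite /= /binop_fun modlt ?low_eq // (leq_trans lt_data).
(* [b] copies of [b] bits fit in a word by [w_large]. *)
have lt_copies f : bval b f * popcount_copies < 2 ^ w.
  rewrite /popcount_copies bval_copies //; apply: leq_trans (bval_lt _ _) _.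
  by rewrite leq_exp2l // (leq_trans _ w_large) // leq_mul2l leqnSn orbT.
apply: (acts_op (v := bval b (fun i => (i < K %% b) && nth false B (F * b + i)) * popcount_copies)).
  by rewrite /= env_s //= /binop_fun modn_small.
apply: (acts_op (v := Nat.land (bval b (fun i => (i < K %% b) && nth false B (F * b + i)) *
  popcount_copies) popcount_mask)).
  rewrite /= env_s //= /binop_fun modn_small //; apply: leq_ltn_trans (lt_copies _).
  exact/leP/PeanoNat.Nat.land_le_l.
apply: (acts_op (v := pop)).
  rewrite /= env_s //= /binop_fun popcount // modn_small //.
  apply: (@leq_ltn_trans b); last by rewrite le_w_lt // b_le_w.
  by rewrite -[leqRHS]card_ord -sum1_card; apply: leq_sum => j _; case: (_ && _).
apply: (acts_op (v := lam.+1)).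
  rewrite /= env_s //= /binop_fun (modn_small lt1) addn1 modn_small // le_w_lt //.
  by apply: leq_trans c_le_w; rewrite /count_bits -addnn -addn1 leq_add2l (ltnW lam_gt1).
apply: (acts_op (v := t * lam.+1)).
  by rewrite /= /binop_fun modn_small // mulnS; move: lt_J lt_n le_t lam_t; clear; lia.
(* For t = 0 the index wraps around and the probe returns an arbitrary word, which the product with
   the flag [0 < t] erases. *)
apply: (acts_op (v := (t * lam.+1 + (2 ^ w - 1)) %% 2 ^ w)).
  by rewrite /= /binop_fun (modn_small lt1).
apply: (acts_probe (v := word w B ((t * lam.+1 + (2 ^ w - 1)) %% 2 ^ w))).
  by rewrite /= s20 D_word.
apply: (acts_op (v := (0 < t))).
  by rewrite /= mod0n /binop_fun boollt.
apply: (acts_op (v := ones B (super_start w t) %% 2 ^ w)).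
  rewrite /= /binop_fun; case: (posnP t) => [->|t0].
    by rewrite muln0 /super_start !mul0n /ones take0.
  rewrite muln1 modn_small // -(word_header t0) //; congr word.
  rewrite addnBA ?expn_gt0 // -addnBAC ?modnDr; last by rewrite muln_gt0 t0.
  by rewrite modn_small // mulnS; move: lt_J lt_n le_t lam_t; clear; lia.
(* The superblock count is known only modulo 2^w, so the three sums are reduced together at the
   end. *)
do 3 (apply: acts_op; first by []).
rewrite /P /= /binop_fun; split => //.
by rewrite (modn_small lt1) !modnDml -!addnA modnDml !addnA ones_eq addn1.
Qed.

End WordParameters.

(** * Computing the word parameters *)

Lemma bitlen_half n : 0 < n -> bitlen n = (bitlen n./2).+1.
Proof.
move=> n0; apply: up_log_eq => //; rewrite !ltnS; apply/andP; split.
  case: (posnP n./2) => [->|h0]; first by rewrite /bitlen up_log1 expn0.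
  have /andP[+ _] := up_log_bounds (isT : 1 < 2) (h0 : 1 < n./2.+1).
  rewrite -/(bitlen n./2) ltnS => le_h.
  have : 2 ^ bitlen n./2 = 2 * 2 ^ (bitlen n./2).-1.
    by rewrite -expnS prednK // up_log_gt0.
  by move: le_h; lia.
have := bitlen_lt n./2; rewrite expnS; lia.
Qed.

Lemma bitlen0 : bitlen 0 = 0.
Proof. exact: up_log1. Qed.

Lemma bitlen_le_exp n w : n < 2 ^ w -> bitlen n <= w.
Proof. exact: up_log_min. Qed.

(** The number of halvings down to 0 is [bitlen]. Applied to u - 1 it is the ceiling of lg u, and
    applied to [w] it is [lam]. *)
Definition shift_loop (o : nat) : cmd :=
  While (Reg 30) (block [:: Op 30 OpShr (Reg 30) (Cst 1); Op o OpAdd (Reg o) (Cst 1)]).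

(** The program is not told its word size: 1 doubled modulo 2^w vanishes after exactly [w]
    rounds. *)
Definition width_loop : cmd :=
  While (Reg 30) (block [:: Op 30 OpAdd (Reg 30) (Reg 30); Op 2 OpAdd (Reg 2) (Cst 1)]).

Definition params_code : seq cmd := [::
  Op 5 OpMul (Reg 4) (Reg 4);
  Op 6 OpAdd (Reg 4) (Reg 4);
  Op 31 OpAdd (Reg 5) (Reg 5);
  Op 7 OpAdd (Reg 6) (Reg 31);
  Op 8 OpDiv (Reg 2) (Reg 7);
  Op 9 OpShl (Cst 1) (Reg 6);
  Op 10 OpShl (Cst 1) (Reg 31);
  Op 33 OpSub (Reg 10) (Cst 1);
  Op 32 OpMul (Reg 31) (Reg 31);
  Op 11 OpShl (Cst 1) (Reg 32);
  Op 11 OpSub (Reg 11) (Cst 1);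
  Op 11 OpDiv (Reg 11) (Reg 33);
  Op 34 OpAdd (Reg 31) (Cst 1);
  Op 13 OpShl (Cst 1) (Reg 34);
  Op 13 OpSub (Reg 13) (Cst 1);
  Op 32 OpMul (Reg 31) (Reg 34);
  Op 12 OpShl (Cst 1) (Reg 32);
  Op 12 OpSub (Reg 12) (Cst 1);
  Op 12 OpDiv (Reg 12) (Reg 13)].

Definition setup : cmd :=
  Seq (block [:: Op 30 OpAdd (Cst 1) (Cst 0)])
  (Seq width_loop
  (Seq (block [:: Op 30 OpSub (Reg 1) (Cst 1)])
  (Seq (shift_loop 3)
  (Seq (block [:: Op 30 OpAdd (Reg 2) (Cst 0)])
  (Seq (shift_loop 4) (block params_code)))))).

Section Setup.
Variables (w : nat) (D : nat -> nat -> nat).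
Hypothesis w_gt0 : 0 < w.

Lemma runs_shift_loop o n s : o != 30 -> regs s 30 = n -> n < 2 ^ w ->
  regs s o + bitlen n < 2 ^ w ->
  runs w D (shift_loop o) s (bitlen n * 4 + 1)
    (fun s' => regs s' o = regs s o + bitlen n /\ frame [:: o; 30] s s').
Proof.
move=> o30; have lt1 := exp_gt1 w_gt0.
have [m] := ubnP n; elim: m n s => // m IH n s lt_m s30 lt_n lt_o.
case: (posnP n) => [n0|n_gt0].
  by rewrite n0 bitlen0; apply: runs_while_done; rewrite /= ?s30 // addn0; split.
rewrite bitlen_half // in lt_o *.
have -> : (bitlen n./2).+1 * 4 + 1 = (3 + (bitlen n./2 * 4 + 1)).+1 by lia.
pose s1 := set_reg (set_reg s 30 n./2) o (regs s o).+1.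
apply: (@runs_while_step _ _ _ _ _ _ _ (eq s1)); first by rewrite /= s30 -lt0n.
  apply: runs_block => //=.
  rewrite /s1 s30 /binop_fun (negbTE o30) (modn_small lt1) expn1 divn2 addn1 !modn_small //; lia.
move=> _ <-; have E o' : regs s1 o' = if o' == o then (regs s o).+1 else if o' == 30 then
  n./2 else regs s o'.
  by [].
apply: runs_weaken (IH n./2 s1 _ _ _ _) _ _ => //; try lia.
- by rewrite E eq_sym (negbTE o30) eqxx.
- by rewrite E eqxx; lia.
move=> s' [so fr]; split; first by rewrite so E eqxx; lia.
apply: frame_trans fr; split => // r; rewrite !inE negb_or E => /andP[/negbTE-> /negbTE->] //.
Qed.

Lemma runs_width_loop s : regs s 2 = 0 -> regs s 30 = 1 ->
  runs w D width_loop s (w * 4 + 1) (fun s' => regs s' 2 = w /\ frame [:: 2; 30] s s').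
Proof.
have lt1 := exp_gt1 w_gt0.
suff F m i s' : i + m = w -> regs s' 2 = i -> regs s' 30 = 2 ^ i %% 2 ^ w ->
  runs w D width_loop s' (m * 4 + 1) (fun s2 => regs s2 2 = w /\ frame [:: 2; 30] s' s2).
  by move=> s2 s30; apply: (F w 0) => //; rewrite s30 expn0 modn_small.
elim: m i s' => [|m IH] i s' E s2 s30.
  by apply: runs_while_done; rewrite /= ?s30 ?s2 -{1}E addn0 ?modnn.
have lt_i : i < w by lia.
have -> : m.+1 * 4 + 1 = (3 + (m * 4 + 1)).+1 by lia.
pose s1 := set_reg (set_reg s' 30 (2 ^ i.+1 %% 2 ^ w)) 2 i.+1.
apply: (@runs_while_step _ _ _ _ _ _ _ (eq s1)).
- by rewrite /= s30 modn_small ?ltn_exp2l // -lt0n expn_gt0.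
- apply: runs_block => //=; rewrite /s1 s30 s2 /binop_fun modnDm addnn -mul2n -expnS.
  rewrite (modn_small lt1) addn1 [i.+1 %% _]modn_small // (leq_trans _ (ltn_expl w _)) //.
move=> _ <-; apply: runs_weaken (IH i.+1 s1 _ _ _) _ _ => //; first by lia.
move=> s3 [so fr]; split=> //; apply: frame_trans fr; split=> // r.
by rewrite !inE negb_or => /andP[/negbTE r2 /negbTE r30] /=; rewrite r2 r30.
Qed.

Hypothesis w_large : data_bits w * (data_bits w).+1 <= w.
Local Notation lam := (wordlog w).
Local Notation h := (node_field w).
Local Notation b := (data_bits w).
Local Notation c := (count_bits w).
Local Notation phi := (field_bits w).
Local Notation q := (word_fields w).

Lemma params_acts s : regs s 2 = w -> regs s 4 = lam ->
  let s' := foldl (act w D) s params_code in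
  [/\ [/\ regs s' 5 = h, regs s' 6 = c, regs s' 7 = phi & regs s' 8 = q],
      regs s' 9 = 2 ^ c, regs s' 10 = 2 ^ b &
      [/\ regs s' 11 = popcount_copies w, regs s' 12 = popcount_mask w & regs s' 13 = 2 ^
        b.+1 - 1]].
Proof.
move=> s2 s4.
pose P s' := [/\ [/\ regs s' 5 = h, regs s' 6 = c, regs s' 7 = phi & regs s' 8 = q],
      regs s' 9 = 2 ^ c, regs s' 10 = 2 ^ b &
      [/\ regs s' 11 = popcount_copies w, regs s' 12 = popcount_mask w & regs s' 13 = 2 ^
        b.+1 - 1]].
change (P (foldl (act w D) s params_code)).
have lt1 := exp_gt1 w_gt0; have b0 := b_gt0 w_gt0.
have lt x : x <= w -> x %% 2 ^ w = x by move=> le_x; rewrite modn_small // le_w_lt.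
have [[bw phiw] [cw hw]] := ((b_le_w w_large, phi_le_w w_gt0 w_large), (c_le_w w_gt0
  w_large, h_le_w w_large)).
have b1w : b.+1 <= w by apply: leq_trans w_large; rewrite leq_pmull.
have bbw : b * b < w.
  by apply: leq_trans w_large; rewrite ltn_pmul2l.
have c_lt : c < w by apply: leq_trans _ phiw; rewrite /field_bits -addn1 leq_add2l.
(* If b (b + 1) = w, the power 2^w is stored as 0, but subtracting 1 wraps around to the intended
   2^w - 1. *)
have sub1 x : 0 < x -> x <= 2 ^ w -> (x %% 2 ^ w + (2 ^ w - 1)) %% 2 ^ w = x - 1.
  move=> x0; rewrite leq_eqVlt => /orP[/eqP->|lt_x].
    by rewrite modnn add0n modn_small // subn1 prednK // expn_gt0.
  rewrite (modn_small lt_x) addnBA ?expn_gt0 // addnC -addnBA // modnDl modn_small //.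
  by rewrite (leq_ltn_trans (leq_subr _ _)).
have exp1 x : (1 %% 2 ^ w * 2 ^ x) %% 2 ^ w = 2 ^ x %% 2 ^ w by rewrite (modn_small lt1) mul1n.
have explt x : x < w -> (1 %% 2 ^ w * 2 ^ x) %% 2 ^ w = 2 ^ x.
  by move=> lt_x; rewrite exp1 modn_small // ltn_exp2l.
have exple x : x <= w -> (2 ^ x %% 2 ^ w + (2 ^ w - 1)) %% 2 ^ w = 2 ^ x - 1.
  by move=> le_x; rewrite sub1 ?expn_gt0 // leq_exp2l.
have lt2b : 1 < 2 ^ b by rewrite -{1}(expn0 2) ltn_exp2l.
have lt2b1 : 1 < 2 ^ b.+1 by rewrite -{1}(expn0 2) ltn_exp2l.
rewrite /params_code.
apply: (acts_op (v := h)); first by rewrite /= s4 /binop_fun lt.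
apply: (acts_op (v := c)); first by rewrite /= s4 /binop_fun addnn lt.
apply: (acts_op (v := b)); first by rewrite /= /binop_fun addnn lt.
apply: (acts_op (v := phi)); first by rewrite /= /binop_fun lt.
apply: (acts_op (v := q)); first by rewrite /= s2 /binop_fun lt // leq_div.
apply: (acts_op (v := 2 ^ c)); first by rewrite /= /binop_fun explt.
apply: (acts_op (v := 2 ^ b)); first by rewrite /= /binop_fun explt.
apply: (acts_op (v := 2 ^ b - 1)).
  by rewrite /= /binop_fun (modn_small lt1) -[X in X + _](modn_small (d := 2 ^ w)) ?exple
    // ltn_exp2l.
apply: (acts_op (v := b * b)); first by rewrite /= /binop_fun lt // ltnW.
apply: (acts_op (v := 2 ^ (b * b) %% 2 ^ w)); first by rewrite /= /binop_fun exp1.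
apply: (acts_op (v := 2 ^ (b * b) - 1)).
  by rewrite /= /binop_fun (modn_small lt1) exple // ltnW.
apply: (acts_op (v := popcount_copies w)).
  rewrite /= /binop_fun expnM geometric_quotient // -/(popcount_copies w).
  have := bval_copies b (fun i => i == 0).
  rewrite bval_single // => [|d]; last by case: d.
  rewrite mul1n -/(popcount_copies w) => ->; rewrite modn_small // (leq_trans (bval_lt _ _)) //.
  by rewrite leq_exp2l // ltnW.
apply: (acts_op (v := b.+1)); first by rewrite /= /binop_fun (modn_small lt1) addn1 lt.
apply: (acts_op (v := 2 ^ b.+1 %% 2 ^ w)); first by rewrite /= /binop_fun exp1.
apply: (acts_op (v := 2 ^ b.+1 - 1)); first by rewrite /= /binop_fun (modn_small lt1) exple.
apply: (acts_op (v := b * b.+1)); first by rewrite /= /binop_fun lt.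
apply: (acts_op (v := 2 ^ (b * b.+1) %% 2 ^ w)); first by rewrite /= /binop_fun exp1.
apply: (acts_op (v := 2 ^ (b * b.+1) - 1)).
  by rewrite /= /binop_fun (modn_small lt1) exple.
apply: (acts_op (v := popcount_mask w)).
  rewrite /= /binop_fun mulnC expnM geometric_quotient // -/(popcount_mask w) modn_small //.
  rewrite /popcount_mask -geometric_quotient // -expnM mulnC; apply: leq_ltn_trans (leq_div _ _) _.
  by rewrite (leq_trans _ (leq_pexp2l _ w_large)) // subn1 prednK // expn_gt0.
by rewrite /P /=.
Qed.

Variables (k u : nat).
Hypothesis (u_gt0 : 0 < u) (u_lt : u < 2 ^ w).

Lemma runs_setup s : (forall r, regs s r = if r is 0 then k else if r is 1 then u else 0) ->
  runs w D setup s (12 * w + 30)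
    (fun s' => [/\ env w k u s', mem s' = mem s & out s' = out s]).
Proof.
move=> sE; have lt1 := exp_gt1 w_gt0.
have le_l : up_log 2 u <= w by apply: up_log_min => //; exact: ltnW.
have le_lam : bitlen w <= w by apply: bitlen_le_exp; exact: ltn_expl.
have -> : 12 * w + 30 = 2 + ((w * 4 + 1) + (2 + ((w * 4 + 1) + (2 + ((w * 4 + 1) + 21))))) by lia.
apply: (@runs_seq _ _ _ _ _ _ _ (fun s1 => regs s1 30 = 1 /\ frame [:: 30] s s1)).
  apply: runs_block => //=; split; first by rewrite /= /binop_fun mod0n addn0 modn_mod modn_small.
  by apply: frame_set_reg; rewrite inE.
move=> s1 [s1_30 f1].
have s1_2 : regs s1 2 = 0 by case: f1 => -> //; rewrite sE.
apply: runs_seq (runs_width_loop s1_2 s1_30) _ => s2 [s2_2 f2].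
have {}f2 : frame [:: 2; 30] s s2.
  by apply: frame_trans f2; apply: frame_sub f1; exact/allP.
apply: (@runs_seq _ _ _ _ _ _ _ (fun s3 => regs s3 30 = u - 1 /\ frame [:: 30] s2 s3)).
  apply: runs_block => //=; split; last by apply: frame_set_reg; rewrite inE.
  have -> : regs s2 1 = u by case: f2 => -> //; rewrite sE.
  rewrite /= /binop_fun (modn_small lt1) addnBA ?expn_gt0 // addnC -addnBA // modnDl modn_small //.
  by rewrite (leq_ltn_trans (leq_subr _ _)).
move=> s3 [s3_30 f3]; have s3_2 : regs s3 2 = w by case: f3 => ->.
have {}f3 : frame [:: 2; 30] s s3.
  by apply: frame_trans f2 _; apply: frame_sub f3; exact/allP.
have s3_3 : regs s3 3 = 0 by case: f3 => -> //; rewrite sE.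
have lE : bitlen (u - 1) = up_log 2 u by rewrite /bitlen subn1 prednK.
have := @runs_shift_loop 3 (u - 1) s3 isT s3_30 (leq_ltn_trans (leq_subr _ _) u_lt).
rewrite s3_3 lE add0n => /(_ (le_w_lt le_l)) run3.
apply: (runs_seq (runs_weaken run3 _ (fun s' (H : _ s') => H)));
  first by rewrite leq_add2r leq_mul2r le_l.
move=> s4 [s4_3 f4].
have s4_2 : regs s4 2 = w by case: f4 => ->.
have {}f4 : frame [:: 2; 3; 30] s s4.
  by apply: (@frame_trans _ _ s3); [apply: frame_sub f3|apply: frame_sub f4]; exact/allP.
apply: (@runs_seq _ _ _ _ _ _ _ (fun s5 => regs s5 30 = w /\ frame [:: 30] s4 s5)).
  apply: runs_block => //=; split; last by apply: frame_set_reg; rewrite inE.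
  by rewrite /= /binop_fun s4_2 mod0n addn0 modn_small // ltn_expl.
move=> s5 [s5_30 f5].
have [s5_2 s5_3] : regs s5 2 = w /\ regs s5 3 = up_log 2 u by case: f5 => rE _ _; rewrite !rE.
have {}f5 : frame [:: 2; 3; 30] s s5.
  by apply: frame_trans f4 _; apply: frame_sub f5; exact/allP.
have s5_4 : regs s5 4 = 0 by case: f5 => -> //; rewrite sE.
have := @runs_shift_loop 4 w s5 isT s5_30 (ltn_expl w (isT : 1 < 2)).
rewrite s5_4 add0n => /(_ (le_w_lt le_lam)) run5.
apply: (runs_seq (runs_weaken run5 _ (fun s' (H : _ s') => H)));
  first by rewrite leq_add2r leq_mul2r le_lam.
move=> s6 [s6_4 f6].
have [s6_2 s6_3] : regs s6 2 = w /\ regs s6 3 = up_log 2 u by case: f6 => rE _ _; rewrite !rE.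
have {}f6 : frame [:: 2; 3; 4; 30] s s6.
  by apply: (@frame_trans _ _ s5); [apply: frame_sub f5|apply: frame_sub f6]; exact/allP.
have [s6_0 s6_1] : regs s6 0 = k /\ regs s6 1 = u by case: f6 => rE _ _; rewrite !rE // !sE.
apply: (runs_weaken (n := 20)) => //; last first.
  move=> s' H; exact: H.
apply: runs_block => //.
have [[p5 p6 p7 p8] p9 p10 [p11 p12 p13]] := params_acts s6_2 s6_4.
have [rE mE oE] := frame_acts w D s6 (isT : all pure params_code).
split; [|by rewrite mE; case: f6|by rewrite oE; case: f6].
move=> r; do 5 (case: r => [|r]; first by rewrite rE //).
by do 9 (case: r => [|r] //).
Qed.

End Setup.

(** * The intersection program *)

(* Registers 14, 15 and 16 hold the depth and the prefix of a node and whether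
   it is still to be visited (1) or has been left (0).
   Row [e.+1] of the working memory holds the numbers of the current nodes at
   depth [e]; row [l.+2] holds the numbers of the first leaves. *)
Definition first_leaves : cmd :=
  for_loop 17 18 0
    (Seq (block [:: Fetch 20 (Cst 0) (Reg 17); Op 21 OpMul (Cst 0) (Cst 0);
                    Op 22 OpMul (Cst 0) (Cst 0)])
    (Seq (for_loop 27 28 3
           (Seq (block lookup_code) (block [:: Op 21 OpAdd (Reg 24) (Cst 0)])))
         (block [:: Op 41 OpAdd (Reg 3) (Cst 2); Store (Reg 41) (Reg 17) (Reg 21)]))).

Definition emit_ranks : cmd :=
  for_loop 17 18 0
    (block [:: Op 41 OpAdd (Reg 14) (Cst 1); Fetch 21 (Reg 41) (Reg 17);
               Op 41 OpAdd (Reg 3) (Cst 2); Fetch 20 (Reg 41) (Reg 17);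
               Op 24 OpSub (Reg 21) (Reg 20); Op 24 OpAdd (Reg 24) (Cst 1);
               Emit (Reg 24)]).

(** All sets are tested, without early exit: register 19 collects the product of the bits. The
    numbers of the children are stored in any case, and are not read if one of the children is
    missing. *)
Definition try_node : cmd :=
  for_loop 17 18 0
    (Seq (block [:: Fetch 20 (Cst 0) (Reg 17); Fetch 21 (Reg 14) (Reg 17)])
    (Seq (block lookup_code)
         (block [:: Op 41 OpAdd (Reg 14) (Cst 1); Store (Reg 41) (Reg 17) (Reg 24);
                    Op 19 OpMul (Reg 19) (Reg 23)]))).

Definition advance : cmd :=
  Seq (block [:: Op 30 OpMod (Reg 15) (Cst 2)])
    (If (Reg 30)
       (block [:: Op 15 OpDiv (Reg 15) (Cst 2); Op 14 OpSub (Reg 14) (Cst 1)])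
       (block [:: Op 15 OpAdd (Reg 15) (Cst 1); Op 16 OpAdd (Cst 1) (Cst 0)])).

Definition leave : cmd := block [:: Op 16 OpMul (Cst 0) (Cst 0)].

Definition visit (rk : bool) : cmd :=
  Seq (block [:: Op 19 OpAdd (Cst 1) (Cst 0); Op 22 OpMod (Reg 15) (Cst 2)])
  (Seq try_node
    (If (Reg 19)
       (Seq (block [:: Op 30 OpEq (Reg 14) (Reg 3)])
         (If (Reg 30)
            (Seq (block [:: Emit (Reg 15)])
              (Seq (if rk then emit_ranks else Skip) leave))
            (block [:: Op 14 OpAdd (Reg 14) (Cst 1); Op 15 OpAdd (Reg 15) (Reg 15)])))
       leave)).

(** The depth serves as loop test: the walk starts at the left child of the root and stops on
    returning to depth 0. *)
Definition search (rk : bool) : cmd :=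
  While (Reg 14) (If (Reg 16) (visit rk) advance).

Definition trie_prog (rk : bool) : cmd :=
  Seq setup (Seq first_leaves
    (Seq (block [:: Op 14 OpAdd (Cst 1) (Cst 0); Op 15 OpMul (Cst 0) (Cst 0);
                    Op 16 OpAdd (Cst 1) (Cst 0)])
      (search rk))).

Section TrieProgram.
Variables (w : nat) (u N : nat) (S : 'I_N -> {set 'I_u}) (Q : seq 'I_N).
Variable D : nat -> nat -> nat.
Hypothesis w_gt0 : 0 < w.
Hypothesis w_large : data_bits w * (data_bits w).+1 <= w.
Hypothesis (u_gt1 : 1 < u) (u_lt : u < 2 ^ w) (N_lt : N < 2 ^ w).
Hypothesis (Q_uniq : uniq Q) (Q_gt0 : 0 < size Q).

Local Notation l := (up_log 2 u).
Local Notation T i := (trie_node (S i)).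
Local Notation k := (size Q).
Hypothesis D_word : forall (i : 'I_N) j, D i j = word w (trie_bits (T i) l) j.

Variable i0 : 'I_N.

Local Notation qi j := (nth i0 Q j).

(** Row 0 keeps the indices of the queried sets, whence the shift by one in [row_ok]. Row 1, for the
    roots, is never written: their number is 0, like the initial cells. *)
Definition root_nodes (s : state) : Prop := forall j, j < k -> mem s 0 j = qi j.
(** An empty set has no node below its root, so computing its first leaf may probe past its bits.
    Its entry is left unspecified; it is not read, since no leaf is then common. *)
Definition leaf_starts (n : nat) (s : state) : Prop :=
  forall j, j < n -> S (qi j) != finset.set0 -> mem s l.+2 j = start (T (qi j)) l.
Definition row_ok (s : state) (d v : nat) : Prop :=
  forall j, j < k -> mem s d.+1 j = node_index (T (qi j)) d v %% 2 ^ w.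

Let lt1 : 1 < 2 ^ w := exp_gt1 w_gt0.

Let k_lt : k < 2 ^ w.
Proof.
have := uniq_leq_size (s2 := enum 'I_N) Q_uniq (fun i _ => mem_enum _ i).
by rewrite size_enum_ord => /leq_ltn_trans; apply.
Qed.

Let l_le_w : l <= w.
Proof. by apply: up_log_min => //; exact: ltnW. Qed.

Let l_gt0 : 0 < l.
Proof. by rewrite up_log_gt0. Qed.

Let w_ge4 : 4 <= w.
Proof. by have := b_gt0 w_gt0; move: w_large; rewrite /data_bits -muln2; nia. Qed.

Let small_lt x : x <= w.+2 -> x < 2 ^ w.
Proof.
move=> le_x; apply: leq_ltn_trans le_x _; have -> : w = (w - 2).+2 by lia.
by rewrite !expnS; have := ltn_expl (w - 2) (isT : 1 < 2); lia.
Qed.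

Let mod2 : 2 %% 2 ^ w = 2.
Proof. by rewrite modn_small // small_lt. Qed.

Let size_bits i : size (trie_bits (T i) l) = (start (T i) l).*2.
Proof. exact: size_trie_bits. Qed.

Let start_bound i d : d <= l -> start (T i) d < 2 ^ w.
Proof.
move=> le_d; apply: leq_trans (start_lt _ _) _.
by rewrite leq_exp2l // (leq_trans le_d).
Qed.

Definition lookup_regs : seq nat := [:: 23; 24] ++ iota 30 11.

Lemma runs_lookup s : env w k u s -> runs w D (block lookup_code) s 31
  (fun s' => frame lookup_regs s s' /\ forall (i : 'I_N) n (e : bool),
     regs s 20 = i -> regs s 21 = n -> regs s 22 = e ->
     n < start (T i) l ->
     regs s' 23 = nth false (trie_bits (T i) l) (n.*2 + e) /\
     regs s' 24 = (ones (trie_bits (T i) l) (n.*2 + e)).+1 %% 2 ^ w).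
Proof.
move=> env_s; apply: runs_block => //; split.
  by apply: frame_sub (frame_acts _ _ _ _) => //; exact/allP.
move=> i n e s20 s21 s22 lt_n.
apply: (lookup_acts (i := i) w_gt0 w_large (D_word i) _ _ env_s) => //.
  by rewrite size_bits; case: e {s22}; lia.
by apply: ltn_trans lt_n _; exact: start_bound.
Qed.

Lemma env_regs s s' : (forall r, r < 14 -> regs s' r = regs s r) -> env w k u s -> env w k u s'.
Proof. by move=> E env_s r lt_r; rewrite E // env_s. Qed.

Lemma level_gt0 i d : S i != finset.set0 -> d <= l -> 0 < before (T i) d (2 ^ d).
Proof.
move=> /set0Pn[x xS] le_d.
have Tx := trie_node_in xS le_d.
have := before_mono (T i) d (node_lt (trie_node0 (S i)) (@trie_nodeS _ (S i)) Tx).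
by rewrite beforeS Tx addn1; apply: leq_ltn_trans.
Qed.

Lemma runs_first_leaves s : env w k u s -> root_nodes s ->
  runs w D first_leaves s (k * (l * 37 + 15) + 4)
    (fun s' => [/\ env w k u s', leaf_starts k s',
       forall a b, a != l.+2 -> mem s' a b = mem s a b & out s' = out s]).
Proof.
move=> env_s row0.
pose Inv n s' := [/\ env w k u s', leaf_starts n s',
  forall a b, a != l.+2 -> mem s' a b = mem s a b & out s' = out s].
apply: runs_weaken (@runs_for w D Inv 17 18 0 _ k (l * 37 + 11) s w_gt0 k_lt _ _ _ _ _) _ _ => //.
- by move=> i s' [env' _ _ _]; rewrite env'.
- move=> i s1 s2 fr [env1 ls1 m1 o1]; have [rE mE oE] := fr.
  split; rewrite ?mE ?oE //; first by apply: env_frame fr env1.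
  by move=> j; rewrite mE; apply: ls1.
- move=> j s1 lt_j s1_17 [env1 ls1 m1 o1].
  have -> : l * 37 + 11 = 4 + ((l * (33 + 4) + 4) + 3) by lia.
  apply: (@runs_seq _ _ _ _ _ _ _ (fun s2 => [/\ regs s2 20 = qi j, regs s2 21 = 0, regs s2
    22 = 0 & frame [:: 20; 21; 22] s1 s2])).
    have m0 : mem s1 0 j = qi j by rewrite m1 // row0.
    apply: runs_block => //; split; last exact: frame_block.
    + by rewrite /= mod0n s1_17 m0.
    + by rewrite /= /binop_fun !mod0n.
    + by rewrite /= /binop_fun !mod0n.
  move=> s2 [s2_20 s2_21 s2_22 fr2].
  have env2 : env w k u s2 by apply: env_frame fr2 env1.
  pose Inv2 e s3 := [/\ frame ([:: 21; 27; 28] ++ lookup_regs) s2 s3 &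
    S (qi j) != finset.set0 -> regs s3 21 = start (T (qi j)) e].
  apply: (@runs_seq _ _ _ _ _ _ _ (Inv2 l)).
    apply: (@runs_for w D Inv2 27 28 3 _ l 33) => //.
    + exact: leq_ltn_trans l_le_w (ltn_expl _ _).
    + by move=> e s3 [[rE _ _] _]; rewrite rE // env2.
    + move=> e s3 s4 fr [fr3 s3_21]; split; last by case: fr => rE _ _; rewrite rE.
      by apply: frame_trans fr3 _; apply: frame_sub fr; exact/allP.
    + move=> e s3 lt_e s3_27 [fr3 s3_21].
      have env3 : env w k u s3 by apply: env_frame fr3 env2.
      apply: (@runs_seq _ _ _ _ _ 31 2 _ _ (runs_lookup env3)) => s4 [fr4 val4].
      apply: runs_block => //; have [rE4 _ _] := fr4.
      split; first by rewrite /= rE4.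
      split.
        apply: frame_trans fr3 _; apply: (@frame_trans _ _ s4); last exact: frame_block.
        by apply: frame_sub fr4; exact/allP.
      move=> neq0; rewrite /=.
      have [s3_20 s3_22] : regs s3 20 = qi j /\ regs s3 22 = 0 by case: fr3 => rE _ _; rewrite !rE.
      (* In a nonempty set level [e] has a node, so its first node is internal and the lookup stays
         within the bits. *)
      have lt_s : start (T (qi j)) e < start (T (qi j)) l.
        have /(start_le (T (qi j))) := lt_e; rewrite startS.
        by apply: leq_trans; rewrite -addn1 leq_add2l level_gt0 // ltnW.
      have [_ ->] := val4 (qi j) _ false s3_20 (s3_21 neq0) s3_22 lt_s.
      rewrite /binop_fun mod0n !addn0 modn_mod (ones_trie_bits_start (trie_node0 (S _))
        (@trie_nodeS _ (S _))) //.
      by rewrite modn_small // start_bound.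
    split; first exact: frame_refl.
    by move=> _; rewrite s2_21 /start big_ord0.
  move=> s3 [fr3 s3_21].
  have env3 : env w k u s3 by apply: env_frame fr3 env2.
  apply: runs_block => //.
  have s3_3 : regs s3 3 = l by rewrite env3.
  have s3_17 : regs s3 17 = j.
    by case: fr3 => -> // _ _; case: fr2 => ->.
  have [m3 o3] : mem s3 = mem s1 /\ out s3 = out s1.
    by case: fr2 => _ <- <-; case: fr3.
  have l2 : binop_fun w OpAdd l (2 %% 2 ^ w) = l.+2.
    by rewrite /binop_fun mod2 addn2 modn_small // small_lt.
  split; first by rewrite /= s3_17.
  split.
  - apply: env_regs env3 => r lt_r /=.
    by case: eqP => // E; rewrite E in lt_r.
  - move=> j'; rewrite ltnS leq_eqVlt /= s3_3 l2 s3_17 eqxx.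
    case: eqP => [-> _|_]; first exact: s3_21.
    by rewrite /= m3; apply: ls1.
  - by move=> a b neq; rewrite /= s3_3 l2 (negbTE neq) m3 m1.
  - by rewrite /= o3.
by rewrite -addnA.
Qed.

Definition ready (s : state) : Prop := [/\ env w k u s, root_nodes s & leaf_starts k s].

(** Only the rows of proper ancestors are required; [try_node] writes the row of the node itself. *)
Definition at_node (s : state) (d v : nat) : Prop :=
  [/\ ready s, regs s 14 = d, regs s 15 = v &
      forall e, e < d -> row_ok s e (v %/ 2 ^ (d - e))].

Lemma at_node_eq s s' d v : at_node s d v ->
  (forall r, r < 16 -> regs s' r = regs s r) ->
  (forall a b, a <= d \/ a = l.+2 -> mem s' a b = mem s a b) -> at_node s' d v.
Proof.
move=> [[env_s row0 ls] s14 s15 rows] rE mE; split.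
- split; first by apply: env_regs env_s => r lt_r; rewrite rE // ltnW // ltnW.
  + by move=> j lt_j; rewrite mE ?row0 //; left.
  + by move=> j lt_j neq; rewrite mE ?ls //; right.
- by rewrite rE.
- by rewrite rE.
by move=> e lt_e j lt_j; rewrite mE ?rows //; left.
Qed.

Local Notation alive := (alive S Q).

Definition try_regs : seq nat := [:: 17; 18; 19; 20; 21; 41] ++ lookup_regs.

Lemma runs_try_node s d v : 0 < d -> d <= l -> at_node s d v ->
  alive d.-1 v./2 -> regs s 19 = 1 -> regs s 22 = odd v ->
  runs w D try_node s (k * 42 + 4)
    (fun s' => [/\ at_node s' d v, regs s' 16 = regs s 16, regs s' 19 = alive d v,
       (alive d v -> row_ok s' d v) & out s' = out s]).
Proof.
case: d => // d _ le_d at_s al s19 s22; rewrite [d.+1.-1]/= in al.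
have [[env_s row0 ls] s14 s15 rows] := at_s.
pose Inv j s' := [/\ forall r, r \notin try_regs -> regs s' r = regs s r,
  forall a b, a != d.+2 -> mem s' a b = mem s a b, out s' = out s,
  regs s' 19 = all (fun i => T i d.+1 v) (take j Q) &
  forall j', j' < j -> T (qi j') d.+1 v ->
    mem s' d.+2 j' = node_index (T (qi j')) d.+1 v %% 2 ^ w].
have env_inv j s' : Inv j s' -> env w k u s'.
  move=> [rE _ _ _ _]; apply: env_regs env_s => r lt_r; apply: rE.
  by apply: contraTN lt_r => /(allP (isT : all (leq 14) try_regs)); rewrite -leqNgt.
apply: runs_weaken (@runs_for w D Inv 17 18 0 _ k 38 s w_gt0 k_lt _ _ _ _ _) _ _ => //.
- by move=> j s' inv; rewrite (env_inv _ _ inv).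
- move=> j s1 s2 [rE mE oE] [r1 m1 o1 s1_19 row1]; split; rewrite ?mE ?oE //.
  + move=> r rn; rewrite rE ?r1 //; apply: contra rn.
    exact: (allP (isT : all [in try_regs] [:: 17; 18])).
  + by rewrite rE.
- move=> j s1 lt_j s1_17 inv; have env1 := env_inv _ _ inv.
  move: inv => [r1 m1 o1 s1_19 row1].
  have -> : 38 = 3 + (31 + 4) by [].
  have Td : T (qi j) d v./2 by exact: (allP al) (mem_nth i0 lt_j).
  have lt_idx := node_index_lt (trie_node0 (S (qi j))) (@trie_nodeS _ (S (qi j))) le_d Td.
  (* The parent is internal, so its number fits in a word and is stored unreduced. *)
  have s1_21 : mem s1 d.+1 j = node_index (T (qi j)) d v./2.
    rewrite m1 ?ltn_eqF // rows // subSnn expn1 divn2 modn_small //.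
    by apply: ltn_trans lt_idx _; exact: start_bound.
  have s1_14 : regs s1 14 = d.+1 by rewrite r1.
  apply: (@runs_seq _ _ _ _ _ _ _ (fun s2 => [/\ regs s2 20 = qi j,
      regs s2 21 = node_index (T (qi j)) d v./2 & frame [:: 20; 21] s1 s2])).
    apply: runs_block => //; split; last exact: frame_block.
    + by rewrite /= mod0n s1_17 m1 ?row0.
    + by rewrite /= s1_17 s1_14 s1_21.
  move=> s2 [s2_20 s2_21 fr2]; have env2 : env w k u s2 by apply: env_frame fr2 env1.
  apply: runs_seq (runs_lookup env2) _ => s3 [fr3 val3].
  have s2_22 : regs s2 22 = odd v by case: fr2 => -> //; rewrite r1.
  have [s3_23 s3_24] := val3 _ _ _ s2_20 s2_21 s2_22 lt_idx.
  move: s3_23 s3_24.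
  rewrite (nth_trie_bits (trie_node0 (S (qi j))) (@trie_nodeS _ (S (qi j)))) //.
  rewrite (ones_trie_bits (trie_node0 (S (qi j))) (@trie_nodeS _ (S (qi j)))) //.
  rewrite addnC odd_double_half => s3_23 s3_24.
  have E3 r : r \notin [:: 20; 21] ++ lookup_regs -> regs s3 r = regs s1 r.
    rewrite mem_cat negb_or => /andP[r2 r3].
    by case: fr3 => -> // _ _; case: fr2 => ->.
  have [m3 o3] : mem s3 = mem s1 /\ out s3 = out s1.
    by case: fr2 => _ <- <-; case: fr3.
  have [s3_14 s3_17 s3_19] : [/\ regs s3 14 = d.+1, regs s3 17 = j & regs s3 19 = all (fun
    i => T i d.+1 v) (take j Q)].
    by rewrite !E3.
  have d2 : binop_fun w OpAdd d.+1 (1 %% 2 ^ w) = d.+2.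
    by rewrite /binop_fun (modn_small lt1) addn1 modn_small // small_lt //;
      move: le_d l_le_w; clear; lia.
  apply: runs_block => //.
  split; first by rewrite /= s3_17.
  split.
  + move=> r rn.
    have [n19 n41] : r != 19 /\ r != 41 by split; apply: contraNN rn => /eqP->.
    rewrite /= (negbTE n19) (negbTE n41) E3 ?r1 //.
    by apply: contra rn; exact: (allP (isT : all [in try_regs] ([:: 20; 21] ++ lookup_regs))).
  + by move=> a b neq; rewrite /= s3_14 d2 (negbTE neq) m3 m1.
  + by rewrite /= o3.
  + rewrite /= s3_19 s3_23 (take_nth i0 lt_j) all_rcons /binop_fun -mulnb mulnC mulnb.
    by case: (_ && _); [exact: modn_small|exact: mod0n].
  + move=> j'; rewrite ltnS leq_eqVlt /= s3_14 d2 s3_17 eqxx s3_24.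
    by case: eqP => [->|_] //=; rewrite m3; apply: row1.
- by split=> //; rewrite take0.
move=> s' [rE mE oE s'_19 rows'].
have rE' r : r < 17 -> regs s' r = regs s r.
  move=> lt_r; apply: rE; apply: contraTN lt_r => /(allP (isT : all (leq 17) try_regs)).
  by rewrite -leqNgt.
split => //.
- apply: at_node_eq at_s _ _ => [r lt_r|a c [le_a| ->]]; first by rewrite rE' // ltnW.
  + by rewrite mE // ltn_eqF.
  + by rewrite mE // gtn_eqF // !ltnS.
- by rewrite rE'.
- by rewrite s'_19 take_size.
by move=> al' j lt_j; apply: rows' => //; exact: (allP al') (mem_nth i0 lt_j).
Qed.

Lemma alive_leaf_lt v : alive l v -> v < u.
Proof. by move/(alive_first_lt (ltnW u_gt1) Q_gt0 (leqnn l)); rewrite subnn muln1. Qed.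

Definition leaf_ranks (v : nat) : seq nat := [seq (before (T i) l v).+1 | i <- Q].

(** A leaf number may exceed a word and is kept modulo 2^w, but its distance from the first leaf is
    below [u], so modular subtraction returns it exactly. Adding 1 counts the element itself. *)
Lemma runs_emit_ranks s v : at_node s l v -> alive l v -> row_ok s l v ->
  runs w D emit_ranks s (k * 12 + 4)
    (fun s' => [/\ at_node s' l v, row_ok s' l v & out s' = out s ++ leaf_ranks v]).
Proof.
move=> at_s al row_s.
have [[env_s row0 ls] s14 s15 rows] := at_s.
pose er := [:: 17; 18; 41; 21; 20; 24].
pose Inv j s' := [/\ forall r, r \notin er -> regs s' r = regs s r, mem s' = mem s &
  out s' = out s ++ [seq (before (T i) l v).+1 | i <- take j Q]].
apply: runs_weaken (@runs_for w D Inv 17 18 0 _ k 8 s w_gt0 k_lt _ _ _ _ _) _ _ => //.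
- by move=> j s' [rE _ _]; rewrite rE // env_s.
- move=> j s1 s2 [rE mE oE] [r1 m1 o1]; split; rewrite ?mE ?oE //.
  move=> r rn; rewrite rE ?r1 //; apply: contra rn.
  exact: (allP (isT : all [in er] [:: 17; 18])).
- move=> j s1 lt_j s1_17 [r1 m1 o1].
  have [s1_14 s1_3] : regs s1 14 = l /\ regs s1 3 = l.
    by rewrite !r1 // s14 env_s.
  have l1 : binop_fun w OpAdd l (1 %% 2 ^ w) = l.+1.
    by rewrite /binop_fun (modn_small lt1) addn1 modn_small // small_lt // ltnW // !ltnS.
  have l2 : binop_fun w OpAdd l (2 %% 2 ^ w) = l.+2.
    by rewrite /binop_fun mod2 addn2 modn_small // small_lt.
  have Tv : T (qi j) l v by exact: (allP al) (mem_nth i0 lt_j).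
  have neq0 : S (qi j) != finset.set0.
    by move: Tv; rewrite trie_node_leaf // => /existsP[x /andP[xS _]]; apply/set0Pn; exists x.
  have leb : before (T (qi j)) l v < u := leq_ltn_trans (before_le _ _ _) (alive_leaf_lt al).
  have sub_eq : binop_fun w OpSub (node_index (T (qi j)) l v %% 2 ^ w) (start (T (qi j)) l) =
      before (T (qi j)) l v.
    have lt_s := start_bound (qi j) (leqnn l).
    rewrite /binop_fun modnDml /node_index addnBA ?(ltnW lt_s) // [_ + 2 ^ w]addnC addnCA addnC.
    by rewrite addnK modnDl modn_small // (ltn_trans leb).
  apply: runs_block => //; split; [|split] => //.
  + move=> r rn; rewrite -r1 //.
    have [-> //] := @frame_block w D er [:: Op 41 OpAdd (Reg 14) (Cst 1);
      Fetch 21 (Reg 41) (Reg 17);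
               Op 41 OpAdd (Reg 3) (Cst 2); Fetch 20 (Reg 41) (Reg 17);
               Op 24 OpSub (Reg 21) (Reg 20); Op 24 OpAdd (Reg 24) (Cst 1)] s1 isT isT.
  + rewrite /= s1_14 l1 s1_3 l2 s1_17 m1 row_s // ls // sub_eq o1 rcons_cat; congr (_ ++ _).
    rewrite (take_nth i0 lt_j) map_rcons; congr rcons.
    by rewrite /binop_fun (modn_small lt1) addn1 modn_small // (leq_ltn_trans leb).
- by split=> //; rewrite take0 cats0.
move=> s' [rE mE oE]; split.
- apply: at_node_eq at_s _ _ => [r lt_r|a b _]; last by rewrite mE.
  rewrite rE //; apply: contraTN lt_r => /(allP (isT : all (leq 16) er)).
  by rewrite -leqNgt.
- by move=> j lt_j; rewrite mE row_s.
by rewrite oE take_size.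
Qed.

Variable rk : bool.

Definition leaf_output (v : nat) : seq nat := v :: if rk then leaf_ranks v else [::].

Definition visit_cost : nat := k * 54 + 30.

Lemma at_node_frame rs s s' d v : at_node s d v -> frame rs s s' ->
  all (leq 16) rs -> at_node s' d v.
Proof.
move=> at_s [rE mE _] /allP ge; apply: at_node_eq at_s _ _ => [r lt_r|a b _]; last by rewrite mE.
by rewrite rE //; apply: contraTN lt_r => /ge; rewrite -leqNgt.
Qed.

Lemma row_ok_mem s s' d v : mem s' = mem s -> row_ok s d v -> row_ok s' d v.
Proof. by move=> mE row j lt_j; rewrite mE row. Qed.

Lemma runs_leave s d v : at_node s d v ->
  runs w D leave s 2 (fun s' => [/\ at_node s' d v, regs s' 16 = 0 & out s' = out s]).
Proof.
move=> at_s; apply: runs_block => //; split => //=; last by rewrite /binop_fun !mod0n.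
apply: at_node_frame at_s (frame_set_reg _ _ (mem_head 16 [::])) _ => //.
Qed.

Lemma runs_visit s d v : 0 < d -> d <= l -> v < 2 ^ d -> at_node s d v ->
  regs s 16 = 1 -> alive d.-1 v./2 ->
  runs w D (visit rk) s (k * 54 + 28)
    (fun s' => if alive d v && (d < l) then
        [/\ at_node s' d.+1 v.*2, regs s' 16 = 1 & out s' = out s]
      else [/\ at_node s' d v, regs s' 16 = 0 &
               out s' = out s ++ if alive d v then leaf_output v else [::]]).
Proof.
move=> d0 le_d lt_v at_s s16 al; rewrite /visit.
have -> : k * 54 + 28 = 3 + ((k * 42 + 4) + (k * 12 + 20).+1) by lia.
apply: (@runs_seq _ _ _ _ _ _ _ (fun s1 => [/\ frame [:: 19;
  22] s s1, regs s1 19 = 1 & regs s1 22 = odd v])).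
  apply: runs_block => //; split; first exact: frame_block.
  - by rewrite /= /binop_fun mod0n addn0 modn_mod modn_small.
  - have [_ _ s15 _] := at_s.
    rewrite /= s15 /binop_fun mod2 modn2.
    by case: (odd v); [exact: modn_small|exact: mod0n].
move=> s1 [fr1 s1_19 s1_22].
have at1 : at_node s1 d v by apply: at_node_frame at_s fr1 _.
have [s1_16 s1_out] : regs s1 16 = 1 /\ out s1 = out s by case: fr1 => -> // _ ->.
apply: runs_seq (runs_try_node d0 le_d at1 al s1_19 s1_22) _.
move=> s2 [at2 s2_16 s2_19 row2 s2_out]; rewrite {}s1_16 in s2_16; rewrite {}s1_out in s2_out.
apply: runs_if; rewrite /= s2_19; case: (boolP (alive d v)) => [al'|nal] /=; last first.
  apply: runs_weaken (runs_leave at2) _ _; first by rewrite ltn_addl.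
  by move=> s' [at' s'16 ->]; rewrite s2_out cats0.
have {}row2 := row2 al'.
apply: (@runs_weaken _ _ _ _ (2 + (k * 12 + 10).+1) _
  (fun s' => if d < l then [/\ at_node s' d.+1 v.*2, regs s' 16 = 1 & out s' = out s]
      else [/\ at_node s' d v, regs s' 16 = 0 & out s' = out s ++ leaf_output v])); [|by lia|by []].
apply: (@runs_seq _ _ _ _ _ _ _ (fun s3 => frame [:: 30] s2 s3 /\ regs s3 30 = (d == l))).
  apply: runs_block => //; split; first exact: frame_block.
  have [[env2 _ _] s2_14 _ _] := at2.
  rewrite /= s2_14 env2 //= /binop_fun.
  by case: (d == l); [exact: modn_small|exact: mod0n].
move=> s3 [fr3 s3_30]; apply: runs_if; rewrite /= s3_30.
have at3 : at_node s3 d v by apply: at_node_frame at2 fr3 _.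
have [s3_16 m3 o3] : [/\ regs s3 16 = 1, mem s3 = mem s2 & out s3 = out s].
  by case: fr3 => -> // -> ->.
have {}row2 := row_ok_mem m3 row2.
case: (ltngtP d l) le_d => // [lt_d|Ed] _ /=.
  apply: (runs_weaken (n := 3)) (fun s' H => H); last by rewrite ltn_addl.
  have [[env3 row0 ls] s3_14 s3_15 rows3] := at3.
  have lt_v2 : v.*2 < 2 ^ w.
    by apply: (@leq_trans (2 ^ d.+1)); rewrite ?leq_exp2l ?(leq_trans lt_d) // expnS; lia.
  have lt_d1 : d.+1 < 2 ^ w by apply: small_lt; move: lt_d l_le_w; clear; lia.
  apply: runs_block => //; split; last by [].
    split; last first.
    + move=> e; rewrite ltnS leq_eqVlt => /orP[/eqP->|lt_e] j lt_j /=.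
        by rewrite subSnn expn1 divn2 doubleK row2.
      by rewrite subSn ?(ltnW lt_e) // expnS divnMA divn2 doubleK rows3.
    + by rewrite /= s3_15 /binop_fun addnn modn_small.
    + by rewrite /= s3_14 /binop_fun (modn_small lt1) addn1 modn_small.
    split=> //; apply: env_regs env3 => r lt_r /=.
    by rewrite !ifN //; apply: contraTneq lt_r => ->.
  by rewrite /= s3_16.
rewrite Ed in at3 row2 al' *.
have -> : k * 12 + 10 = 2 + ((k * 12 + 6) + 2) by lia.
apply: (@runs_seq _ _ _ _ _ _ _ (fun s4 => [/\ at_node s4 l v, row_ok s4 l v & out s4 =
  rcons (out s) v])).
  have [_ _ s3_15 _] := at3.
  apply: runs_block => //=; split; last by rewrite o3 s3_15.
    by apply: at_node_eq at3 _ _.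
  exact: row_ok_mem row2.
move=> s4 [at4 row4 o4].
apply: (@runs_seq _ _ _ _ _ _ _ (fun s5 => at_node s5 l v /\ out s5 = out s ++ leaf_output v)).
  rewrite /leaf_output; case: rk.
    apply: runs_weaken (runs_emit_ranks at4 al' row4) _ _; first by rewrite leq_add2l.
    by move=> s5 [at5 _ ->]; rewrite o4 cat_rcons.
  apply: (runs_weaken (n := 1)) (fun s' H => H); last by rewrite ltn_addl.
  by apply: (@runs_block w D [::]) => //=; rewrite o4 cats1.
move=> s5 [at5 o5]; apply: runs_weaken (runs_leave at5) _ _ => //.
by move=> s' [at' s'16 ->].
Qed.

Lemma runs_advance s d v : 0 < d -> d <= l -> v < 2 ^ d -> at_node s d v -> regs s 16 = 0 ->
  runs w D advance s 6
    (fun s' => if odd v then [/\ at_node s' d.-1 v./2, regs s' 16 = 0 & out s' = out s]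
      else [/\ at_node s' d v.+1, regs s' 16 = 1 & out s' = out s]).
Proof.
move=> d0 le_d lt_v at_s s16; have [[env_s row0 ls] s14 s15 rows] := at_s.
have v_lt : v < 2 ^ w by apply: leq_trans lt_v _; rewrite leq_exp2l // (leq_trans le_d).
rewrite -[6]/(2 + 3.+1).
apply: (@runs_seq _ _ _ _ _ _ _ (fun s1 => frame [:: 30] s s1 /\ regs s1 30 = odd v)).
  apply: runs_block => //; split; first exact: frame_block.
  rewrite /= s15 /binop_fun mod2 modn2.
  by case: (odd v); [exact: modn_small|exact: mod0n].
move=> s1 [fr1 s1_30]; apply: runs_if; rewrite /= s1_30.
have at1 : at_node s1 d v by apply: at_node_frame at_s fr1 _.
have [s1_16 m1 o1] : [/\ regs s1 16 = 0, mem s1 = mem s & out s1 = out s].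
  by case: fr1 => -> // -> ->.
have [[env1 row1 ls1] s1_14 s1_15 rows1] := at1.
case: (boolP (odd v)) => [odd_v|even_v] /=; apply: runs_block => //.
  have v2 : binop_fun w OpDiv v (2 %% 2 ^ w) = v./2.
    by rewrite /binop_fun mod2 modn_small ?divn2 // -divn2 (leq_ltn_trans (leq_div _ _)).
  have d1 : binop_fun w OpSub d (1 %% 2 ^ w) = d.-1.
    rewrite /binop_fun (modn_small lt1) addnBA ?(ltnW lt1) // addnC -addnBA // modnDl subn1.
    by rewrite modn_small // small_lt //; move: le_d l_le_w; clear; lia.
  split; [split|by rewrite /= s1_16|by rewrite /= o1].
  - by split=> //; apply: env_regs env1 => r lt_r /=; rewrite !ifN //; apply: contraTneq lt_r => ->.
  - by rewrite /= s1_14.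
  - by rewrite /= s1_15.
  move=> e lt_e j lt_j /=; rewrite rows1 //; last by move: lt_e; clear; lia.
  have -> : d - e = (d.-1 - e).+1 by move: lt_e; clear; lia.
  by rewrite expnS divnMA divn2.
(* [v] is even and below the even number 2^d, so its successor is below 2^d too. *)
have v1_lt : v.+1 < 2 ^ w.
  apply: (@leq_trans (2 ^ d)); last by rewrite leq_exp2l // (leq_trans le_d).
  move: lt_v; rewrite -(prednK d0) expnS -[v]odd_double_half (negbTE even_v) /=.
  by move: (v./2) (2 ^ _) => x y; lia.
split; [|by rewrite /= /binop_fun mod0n addn0 modn_mod modn_small|by rewrite /= o1].
  split; last first.
  - move=> e lt_e j lt_j /=; rewrite rows1 //.
    have -> : d - e = (d - e.+1).+1 by move: lt_e; clear; lia.
    by rewrite expnS !divnMA !divn2 /= uphalf_half (negbTE even_v).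
  - by rewrite /= s1_15 /binop_fun (modn_small lt1) addn1 modn_small.
  - by rewrite /= s1_14.
  split=> //; apply: env_regs env1 => r lt_r /=.
  by rewrite !ifN //; apply: contraTneq lt_r => ->.
Qed.

(** * Cost and output of the depth-first walk *)

Lemma alive_ancestor n d x : alive (d + n) x -> alive d (x %/ 2 ^ n).
Proof.
elim: n d x => [|n IH] d x; first by rewrite addn0 expn0 divn1.
rewrite expnS divnMA divn2 addnS => al; apply: IH; apply/allP => i iQ.
by apply: trie_nodeS; apply: (allP al).
Qed.

(** Rounds of the main loop: an alive inner node takes one visit and two advances, one between its
    children and one back up from the second; a leaf or a pruned node takes one visit. *)
Fixpoint visits (n d v : nat) : nat :=
  if alive d v then
    if n is n'.+1 then 3 + visits n' d.+1 v.*2 + visits n' d.+1 v.*2.+1 else 1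
  else 1.

Definition below (n d v : nat) : nat :=
  \sum_(e < n.+1) count (alive (d + e)) (iota (v * 2 ^ e) (2 ^ e)).

Lemma iota_halves n v : iota (v * 2 ^ n.+1) (2 ^ n.+1) =
  iota (v.*2 * 2 ^ n) (2 ^ n) ++ iota (v.*2.+1 * 2 ^ n) (2 ^ n).
Proof.
by rewrite mulSn [2 ^ n + _]addnC -iotaD addnn -[(2 ^ n).*2]mul2n -[v.*2]muln2 -mulnA -expnS.
Qed.

Lemma belowS n d v :
  below n.+1 d v = alive d v + (below n d.+1 v.*2 + below n d.+1 v.*2.+1).
Proof.
rewrite /below big_ord_recl /= !addn0 muln1; congr (_ + _).
rewrite -big_split; apply: eq_bigr => e _ /=.
by rewrite -count_cat -iota_halves /bump /= add1n addSnnS.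
Qed.

(** A pruned node is met only below an alive parent; charging four rounds to every alive node leaves
    one round over, that of [v] itself. *)
Lemma visits_le n d v : visits n d v <= 4 * below n d v + 1.
Proof.
elim: n d v => [|n IH] d v; first by rewrite /=; case: ifP => _; rewrite leq_addl.
rewrite belowS /=; case: (alive d v); last by rewrite leq_addl.
have := IH d.+1 v.*2; have := IH d.+1 v.*2.+1.
by move: (visits _ _ _) (visits _ _ _) (below _ _ _) (below _ _ _) => a b c e; lia.
Qed.

Definition subtree_output (n v : nat) : seq nat :=
  flatten [seq leaf_output x | x <- iota (v * 2 ^ n) (2 ^ n) & alive l x].

Lemma subtree_outputS n v :
  subtree_output n.+1 v = subtree_output n v.*2 ++ subtree_output n v.*2.+1.
Proof.
by rewrite /subtree_output -flatten_cat -map_cat -filter_cat -iota_halves.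
Qed.

Lemma subtree_output_dead n d v : d + n = l -> ~~ alive d v -> subtree_output n v = [::].
Proof.
move=> E nal; rewrite /subtree_output (_ : [seq x <- _ | _] = [::]) //.
apply/eqP; rewrite -[_ == _]negbK -has_filter; apply/hasPn => x.
rewrite mem_iota => /andP[ge_x lt_x]; apply: contra nal; rewrite -{1}E => /alive_ancestor.
suff -> : x %/ 2 ^ n = v by [].
apply/eqP; rewrite eqn_leq -ltnS ltn_divLR ?expn_gt0 // leq_divRL ?expn_gt0 // ge_x andbT.
by rewrite mulSn addnC.
Qed.

(** The whole walk is a single loop, so a subtree has no command of its own; the rest of the run, of
    cost [m], enters as a hypothesis on the state in which the subtree has been left. *)
Lemma search_visit n d v s m (P : state -> Prop) : d + n = l -> 0 < d -> v < 2 ^ d ->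
  at_node s d v -> regs s 16 = 1 -> alive d.-1 v./2 ->
  (forall s', at_node s' d v -> regs s' 16 = 0 -> out s' = out s ++ subtree_output n v ->
     runs w D (search rk) s' m P) ->
  runs w D (search rk) s (visits n d v * visit_cost + m) P.
Proof.
elim: n d v s m => [|n IH] d v s m E d0 lt_v at_s s16 al next.
  have s14 : regs s 14 = d by case: at_s.
  have -> : visits 0 d v * visit_cost + m = ((k * 54 + 28).+1 + m).+1.
    by rewrite /=; case: (alive d v); rewrite mul1n /visit_cost; lia.
  apply: (runs_while_step (P1 := fun s' => [/\ at_node s' d v, regs s' 16 = 0 &
      out s' = out s ++ if alive d v then leaf_output v else [::]])).
  - by rewrite /= s14 -lt0n.
  - apply: runs_if; rewrite /= s16 /=.
    have le_d : d <= l by rewrite -E addn0.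
    apply: runs_weaken (runs_visit d0 le_d lt_v at_s s16 al) _ _ => // s'.
    by rewrite -[l in d < l]E addn0 ltnn andbF.
  move=> s' [at' s'16 o']; apply: next => //; rewrite o' /subtree_output expn0 muln1 /=.
  by rewrite -E addn0; case: (alive d v) => //=; rewrite cats0.
have le_d : d <= l by rewrite -E leq_addr.
have lt_d : d < l by rewrite -E addnS ltnS leq_addr.
have s14 : regs s 14 = d by case: at_s.
have run1 := runs_visit d0 le_d lt_v at_s s16 al.
rewrite lt_d andbT in run1.
have body16 P1 : runs w D (visit rk) s (k * 54 + 28) P1 ->
    runs w D (If (Reg 16) (visit rk) advance) s (k * 54 + 29) P1.
  by move=> r1; rewrite addnS; apply: runs_if; rewrite /= s16.
case: (boolP (alive d v)) run1 => [al'|nal] run1; last first.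
  rewrite /= (negbTE nal) mul1n.
  have -> : visit_cost + m = ((k * 54 + 29) + m).+1 by rewrite /visit_cost; lia.
  apply: (runs_while_step _ (body16 _ run1)); first by rewrite /= s14 -lt0n.
  move=> s' [at' s'16 o']; apply: next => //.
  by rewrite o' (subtree_output_dead E nal).
have -> : visits n.+1 d v * visit_cost + m =
   ((k * 54 + 29) + (visits n d.+1 v.*2 * visit_cost + (((k * 54 + 29) +
     (visits n d.+1 v.*2.+1 * visit_cost + ((k * 54 + 29) + m).+1)).+1))).+1.
  by rewrite /= al' /visit_cost; move: (visits _ _ _) (visits _ _ _) => a b; lia.
apply: (runs_while_step _ (body16 _ run1)); first by rewrite /= s14 -lt0n.
move=> s1 [at1 s1_16 o1].
have E1 : d.+1 + n = l by rewrite addSnnS.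
have lt_v2 c : c <= 1 -> v.*2 + c < 2 ^ d.+1 by rewrite expnS; lia.
apply: (IH) => //; first by have := lt_v2 0 isT; rewrite addn0.
  by rewrite doubleK.
move=> s2 at2 s2_16 o2.
have s2_14 : regs s2 14 = d.+1 by case: at2.
have adv P1 s' : runs w D advance s' 6 P1 -> regs s' 16 = 0 ->
    runs w D (If (Reg 16) (visit rk) advance) s' (k * 54 + 29) P1.
  move=> r1 s'16; apply: (@runs_weaken _ _ _ _ 7 _ P1) => //; last by rewrite ltn_addl.
  by apply: runs_if; rewrite /= s'16.
have := runs_advance (ltn0Sn d) lt_d (lt_v2 0 isT) _ s2_16; rewrite addn0 => /(_ at2).
rewrite odd_double => /adv/(_ s2_16) run2.
apply: (runs_while_step _ run2); first by rewrite /= s2_14.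
move=> s3 [at3 s3_16 o3].
apply: IH => //; first by have := lt_v2 1 isT; rewrite addn1.
  by rewrite /= uphalf_double.
move=> s4 at4 s4_16 o4.
have s4_14 : regs s4 14 = d.+1 by case: at4.
have := runs_advance (ltn0Sn d) lt_d (lt_v2 1 isT) _ s4_16; rewrite addn1 => /(_ at4).
rewrite /= odd_double /= uphalf_double => /adv/(_ s4_16) run4.
apply: (runs_while_step _ run4); first by rewrite /= s4_14.
move=> s5 [at5 s5_16 o5]; apply: next => //.
by rewrite o5 o4 o3 o2 o1 subtree_outputS catA.
Qed.

Lemma runs_search s : at_node s 1 0 -> regs s 16 = 1 ->
  runs w D (search rk) s (4 * start alive l.+1 * visit_cost + 1)
    (fun s' => out s' = out s ++ flatten [seq leaf_output x | x <- iota 0 (2 ^ l) & alive l x]).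
Proof.
move=> at_s s16.
have [n En] : exists n, l = n.+1 by case: l l_gt0 => // n _; exists n.
have alive0 : alive 0 0 by apply/allP.
have -> : start alive l.+1 = below l 0 0.
  by rewrite /start /below; apply: eq_bigr => e _; rewrite mul0n.
rewrite {1}En belowS alive0 /=.
have le1 := visits_le n 1 0; have le2 := visits_le n 1 1.
(* The root is alive but not visited: its four rounds in the bound pay for two advances and for the
   extra round of each child. *)
apply: (@runs_weaken _ _ _ _ (visits n 1 0 * visit_cost + ((k * 54 + 29) +
   (visits n 1 1 * visit_cost + ((k * 54 + 29) + 1).+1)).+1) _
   (fun s' => out s' = out s ++ subtree_output l 0)); last 2 first.
- move: le1 le2; rewrite /visit_cost;
  move: (visits _ _ _) (visits _ _ _) (below _ _ _) (below _ _ _).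
  by move=> a b c e; nia.
- by move=> s' ->; rewrite /subtree_output mul0n.
have adv P1 s' : runs w D advance s' 6 P1 -> regs s' 16 = 0 ->
    runs w D (If (Reg 16) (visit rk) advance) s' (k * 54 + 29) P1.
  move=> r1 s'16; apply: (@runs_weaken _ _ _ _ 7 _ P1) => //; last by rewrite ltn_addl.
  by apply: runs_if; rewrite /= s'16.
apply: search_visit => // s2 at2 s2_16 o2.
have s2_14 : regs s2 14 = 1 by case: at2.
have /adv/(_ s2_16) run2 := runs_advance (isT : 0 < 1) l_gt0 (isT : 0 < 2 ^ 1) at2 s2_16.
apply: (runs_while_step _ run2); first by rewrite /= s2_14.
move=> s3 [at3 s3_16 o3].
apply: search_visit => // s4 at4 s4_16 o4.
have s4_14 : regs s4 14 = 1 by case: at4.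
have /adv/(_ s4_16) run4 := runs_advance (isT : 0 < 1) l_gt0 (isT : 1 < 2 ^ 1) at4 s4_16.
apply: (runs_while_step _ run4); first by rewrite /= s4_14.
move=> s5 [at5 s5_16 o5].
apply: runs_while_done; first by case: at5.
by rewrite o5 o4 o3 o2 En subtree_outputS catA.
Qed.

Lemma runs_trie_prog :
  runs w D (trie_prog rk) (query_state u Q)
    (12 * w + k * (l * 37 + 15) + 4 * start alive l.+1 * visit_cost + 40)
    (fun s' => out s' = flatten [seq leaf_output x | x <- iota 0 (2 ^ l) & alive l x]).
Proof.
have -> : 12 * w + k * (l * 37 + 15) + 4 * start alive l.+1 * visit_cost + 40 =
    (12 * w + 30) + ((k * (l * 37 + 15) + 4) + (4 + (4 * start alive l.+1 * visit_cost +
      2))) by lia.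
have u0 : 0 < u := ltnW u_gt1.
apply: runs_seq (runs_setup D w_gt0 w_large u0 u_lt _) _ => [|s1 [env1 m1 o1]].
  by case=> [|[|r]].
have row1 : root_nodes s1.
  by move=> j lt_j; rewrite m1 /= (nth_map i0).
apply: runs_seq (runs_first_leaves env1 row1) _ => s2 [env2 ls2 m2 o2].
apply: (@runs_seq _ _ _ _ _ _ _ (fun s3 => [/\ at_node s3 1 0, regs s3 16 = 1 & out s3 = [::]])).
  apply: runs_block => //; split; last by rewrite /= o2 o1.
    split.
    - split=> //.
      + by apply: env_regs env2 => r lt_r /=; rewrite !ifN //; apply: contraTneq lt_r => ->.
      + by move=> j lt_j; rewrite /= m2 ?row1.
    - by rewrite /= /binop_fun mod0n addn0 modn_mod modn_small.
    - by rewrite /= /binop_fun !mod0n.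
    move=> e; rewrite ltnS leqn0 => /eqP-> j lt_j /=.
    by rewrite m2 // m1 div0n /node_index /start big_ord0 mod0n.
  by rewrite /= /binop_fun mod0n addn0 modn_mod modn_small.
move=> s3 [at3 s3_16 o3]; apply: runs_weaken (runs_search at3 s3_16) _ _.
  by rewrite leq_add2l.
by move=> s' ->; rewrite o3.
Qed.

End TrieProgram.

(** * Small universes: bitmaps *)

Definition set_has u (A : {set 'I_u}) (x : nat) : bool := [exists y in A, val y == x].

Lemma set_has_lt u (A : {set 'I_u}) x : set_has A x -> x < u.
Proof. by move=> /existsP[y /andP[_ /eqP<-]]; apply: ltn_ord. Qed.

(** One whole word per point, so that a probe returns membership as 0 or 1. The waste is harmless
    where [u] is below a constant. *)
Definition bitmap w u (A : {set 'I_u}) : bitseq :=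
  mkseq (fun p => (p %% w == 0) && set_has A (p %/ w)) (u * w).

Lemma bval_bitmap w u (A : {set 'I_u}) j : 0 < w ->
  bval w (fun d => nth false (bitmap w A) (j * w + d)) = set_has A j.
Proof.
move=> w0; have nthE d : d < w -> nth false (bitmap w A) (j * w + d) = (d == 0) && set_has A j.
  move=> lt_d; case: (ltnP (j * w + d) (u * w)) => [lt_p|ge_p].
    by rewrite nth_mkseq // modnMDl divnMDl // divn_small // modn_small // addn0.
  rewrite nth_default ?size_mkseq //; case: (boolP (set_has A j)) => [/set_has_lt lt_j|];
    last by rewrite andbF.
  by move: ge_p; rewrite leqNgt; case/negP; nia.
rewrite bval_single // ?nthE // => d d0 lt_d.
by rewrite nthE // gtn_eqF.
Qed.

(** Row 1 of the memory counts the elements of each set met so far, so that the ranks of a point are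
    at hand when it is emitted. *)
Definition bitmap_prog (rk : bool) : cmd :=
  for_loop 2 3 1
    (Seq (block [:: Op 4 OpAdd (Cst 1) (Cst 0)])
    (Seq (for_loop 5 6 0
           (block [:: Fetch 7 (Cst 0) (Reg 5); Probe 8 (Reg 7) (Reg 2);
                      Op 4 OpMul (Reg 4) (Reg 8); Fetch 9 (Cst 1) (Reg 5);
                      Op 9 OpAdd (Reg 9) (Reg 8); Store (Cst 1) (Reg 5) (Reg 9)]))
         (If (Reg 4)
            (Seq (block [:: Emit (Reg 2)])
              (if rk then
                 for_loop 5 6 0 (block [:: Fetch 9 (Cst 1) (Reg 5); Emit (Reg 9)])
               else Skip))
            Skip))).

Section BitmapProgram.
Variables (w : nat) (u N : nat) (S : 'I_N -> {set 'I_u}) (Q : seq 'I_N).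
Variable D : nat -> nat -> nat.
Hypothesis w_gt0 : 0 < w.
Hypothesis (u_lt : u < 2 ^ w) (N_lt : N < 2 ^ w) (Q_uniq : uniq Q).
Local Notation k := (size Q).
Hypothesis D_bit : forall (i : 'I_N) j, D i j = set_has (S i) j.
Variable i0 : 'I_N.
Variable rk : bool.
Local Notation qi j := (nth i0 Q j).

Definition rank_below (i : 'I_N) (x : nat) : nat := count (set_has (S i)) (iota 0 x).

Definition in_all (x : nat) : bool := all (fun i => set_has (S i) x) Q.

Definition element_output (x : nat) : seq nat :=
  x :: if rk then [seq rank_below i x.+1 | i <- Q] else [::].

Let lt1 : 1 < 2 ^ w := exp_gt1 w_gt0.

Let k_lt : k < 2 ^ w.
Proof.
have := uniq_leq_size (s2 := enum 'I_N) Q_uniq (fun i _ => mem_enum _ i).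
by rewrite size_enum_ord => /leq_ltn_trans; apply.
Qed.

Lemma rank_belowS i x : rank_below i x.+1 = rank_below i x + set_has (S i) x.
Proof. by rewrite /rank_below -[x.+1]addn1 iotaD count_cat /= addn0. Qed.

Lemma rank_below_le i x : rank_below i x <= x.
Proof. by rewrite -[leqRHS](size_iota 0) count_size. Qed.

Lemma runs_bitmap_prog :
  runs w D (bitmap_prog rk) (query_state u Q) (u * (k * 18 + 18) + 4)
    (fun s' => out s' = flatten [seq element_output x | x <- iota 0 u & in_all x]).
Proof.
pose Inv x s := [/\ regs s 0 = k, regs s 1 = u, forall j, j < k -> mem s 0 j = qi j,
  forall j, j < k -> mem s 1 j = rank_below (qi j) x &
  out s = flatten [seq element_output x | x <- iota 0 x & in_all x]].
have -> : u * (k * 18 + 18) + 4 = u * (2 + ((k * 11 + 4) + (k * 7 + 7).+1) + 4) + 4 by lia.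
apply: (@runs_weaken _ _ _ _ _ _ (Inv u)); [|exact: leqnn|by move=> s' []].
apply: (@runs_for w D Inv 2 3 1 _ u) => //.
- by move=> x s [].
- by move=> x s s' [rE mE oE] [s0 s1 m0 m1 o]; split; rewrite ?rE ?mE ?oE.
- move=> x s lt_x s2 [s0 s1 m0 m1 o].
  apply: (@runs_seq _ _ _ _ _ _ _ (fun s' => frame [:: 4] s s' /\ regs s' 4 = 1)).
    apply: runs_block => //; split; first exact: frame_block.
    by rewrite /= /binop_fun mod0n addn0 modn_mod modn_small.
  move=> sa [[ra ma oa] sa4].
  (* The summand [j' < j] records that the sets before [j] have already counted [x]. *)
  pose Inv2 j s' := [/\ [/\ regs s' 0 = k, regs s' 1 = u & regs s' 2 = x],
    regs s' 4 = all (fun i => set_has (S i) x) (take j Q),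
    forall j, j < k -> mem s' 0 j = qi j,
    forall j', j' < k -> mem s' 1 j' = rank_below (qi j') (x + (j' < j)) & out s' = out s].
  apply: (@runs_seq _ _ _ _ _ _ _ (Inv2 k)).
    apply: (@runs_for w D Inv2 5 6 0 _ k 7) => //.
    + by move=> j s' [[]].
    + by move=> j s' s'' [rE mE oE] [[a0 a1 a2] a4 n0 n1 a_o]; split; rewrite ?rE ?mE ?oE.
    + move=> j sb lt_j sb5 [[b0 b1 b2] b4 n0 n1 b_o].
      have m1w : 1 %% 2 ^ w = 1 by rewrite modn_small.
      have bool_lt (b : bool) : b %% 2 ^ w = b by case: b; [exact: m1w|exact: mod0n].
      have n1j : mem sb 1 j = rank_below (qi j) x by rewrite n1 // ltnn addn0.
      have addE : binop_fun w OpAdd (rank_below (qi j) x) (set_has (S (qi j)) x) =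
        rank_below (qi j) x.+1.
        rewrite /binop_fun -rank_belowS modn_small // (leq_ltn_trans (rank_below_le _ _)) //.
        exact: leq_ltn_trans u_lt.
      apply: runs_block => //; split; first by rewrite /= sb5.
      split; first by [].
      * rewrite /= mod0n sb5 n0 // b2 D_bit b4 (take_nth i0 lt_j) all_rcons.
        by rewrite /binop_fun mulnb bool_lt andbC.
      * by move=> j' lt_j'; rewrite /= m1w n0.
      * move=> j' lt_j'; rewrite /= m1w mod0n sb5 n0 // b2 D_bit n1j addE ltnS leq_eqVlt eqxx.
        by case: eqP => [->|_] /=; [rewrite addn1|rewrite n1].
      * by rewrite /= b_o.
    split; rewrite ?sa4 ?ra ?ma ?take0 //.
    by move=> j lt_j; rewrite ltn0 addn0 m1.
  move=> sb [[b0 b1 b2] b4 n0 n1 b_o]; rewrite take_size -/(in_all x) in b4.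
  have {}n1 j : j < k -> mem sb 1 j = rank_below (qi j) x.+1.
    by move=> lt_j; rewrite n1 // lt_j addn1.
  have iotaS : [seq y <- iota 0 x.+1 | in_all y] = [seq y <- iota 0 x | in_all y] ++ if
    in_all x then [:: x] else [::].
    by rewrite -[x.+1]addn1 iotaD filter_cat /=.
  apply: runs_if; rewrite /= b4; case: (boolP (in_all x)) => [al|nal] /=; last first.
    apply: (runs_weaken (n := 1) (P := eq sb));
      [exact: (@runs_block w D [::])|by rewrite ltn_addl|].
    move=> _ <-; split=> //; split => //.
    by rewrite iotaS (negbTE nal) cats0 b_o o.
  have -> : k * 7 + 7 = 2 + (k * 7 + 5) by lia.
  apply: (@runs_seq _ _ _ _ _ _ _ (fun sc => [/\ regs sc = regs sb, mem sc = mem sb & out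
    sc = rcons (out sb) x])).
    by apply: runs_block => //=; rewrite b2.
  move=> sc [rc mc oc].
  apply: (@runs_weaken _ _ _ _ (k * 7 + 5) _ (fun s' =>
     [/\ [/\ regs s' 0 = k, regs s' 1 = u & regs s' 2 = x], mem s' = mem sb & out s' = out
       sb ++ element_output x])) => //; last first.
    move=> s' [[c0 c1 c2] mc' oc']; split=> //; split=> //; rewrite ?mc' //.
    by rewrite iotaS al map_cat flatten_cat /= cats0 oc' b_o o.
  rewrite /element_output; case: rk; last first.
    apply: (runs_weaken (n := 1) (P := eq sc));
      [exact: (@runs_block w D [::])|by rewrite ltn_addl|].
    by move=> _ <-; rewrite rc mc oc cats1.
  pose Inv3 j s' := [/\ [/\ regs s' 0 = k, regs s' 1 = u & regs s' 2 = x], mem s' = mem sb &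
     out s' = out sb ++ x :: [seq rank_below i x.+1 | i <- take j Q]].
  apply: runs_weaken (@runs_for w D Inv3 5 6 0 _ k 3 sc w_gt0 k_lt _ _ _ _ _) _ _ => //.
  + by move=> j s' [[]].
  + by move=> j s' s'' [rE mE oE] [[a0 a1 a2] m' o']; split; rewrite ?rE ?mE ?oE.
  + move=> j sd lt_j sd5 [[d0 d1 d2] md od].
    apply: runs_block => //; split; first by rewrite /= sd5.
    split => //.
    by rewrite /= (modn_small lt1) sd5 md n1 // od rcons_cat (take_nth i0 lt_j) map_rcons.
  + by split; rewrite ?rc // oc take0 cats1.
  + by rewrite leq_add2l.
  by move=> s' [? ? ?]; rewrite -{2}[Q]take_size.
split => //; first by move=> j lt_j; rewrite /= (nth_map i0).
Qed.

End BitmapProgram.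

(** * The representation and the query programs *)

(** With m = n / 8, 16 n^4 <= 16 (8 (m + 1))^4 = 16^4 (m + 1)^4 <= (m + 1)^8 <= 2^(8 m) as soon as m
    + 1 >= 16; hence the threshold 8 * 15. *)
Lemma quartic_lt_exp : exists n0, forall n, n0 <= n -> 16 * n ^ 4 <= 2 ^ n.
Proof.
exists (8 * 15) => n le_n; pose m := n %/ 8.
have lt_n : n <= 8 * m.+1 by rewrite mulnC ltnW // ltn_ceil.
have le_m : 15 <= m by rewrite leq_divRL // mulnC.
have le_mn : m * 8 <= n by exact: leq_divM.
apply: (@leq_trans ((2 ^ m) ^ 8)); last by rewrite -expnM leq_exp2l.
apply: (@leq_trans (m.+1 ^ 8)); last by rewrite leq_exp2r // ltn_expl.
have le4 : n ^ 4 <= (8 * m.+1) ^ 4 by rewrite leq_exp2r.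
apply: leq_trans (leq_mul (leqnn 16) le4) _.
rewrite expnMn mulnA -[8]/(4 + 4) [in leqRHS]expnD leq_mul2r; apply/orP; right.
by rewrite (_ : 16 * (4 + 4) ^ 4 = 16 ^ 4) ?leq_exp2r // -[16]/(2 ^ 4) -[4 + 4]/(2 ^ 3)
  -!expnM -expnD.
Qed.

(** As b = 2 lam^2 and 2^(lam - 1) <= w, it suffices that b (b + 1) <= 8 lam^4 <= 2^(lam - 1). *)
Lemma word_large : exists2 w0, 0 < w0 & forall w, w0 <= w -> data_bits w * (data_bits w).+1 <= w.
Proof.
have [n0 n0P] := quartic_lt_exp; exists (2 ^ n0); first by rewrite expn_gt0.
move=> w le_w; have w0 : 0 < w by apply: leq_trans le_w; rewrite expn_gt0.
have lt_n0 : n0 < bitlen w.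
  by rewrite -(ltn_exp2l (m := 2)) // (leq_ltn_trans le_w) // bitlen_lt.
have := n0P _ (ltnW lt_n0).
have /andP[+ _] := up_log_bounds (isT : 1 < 2) (w0 : 1 < w.+1).
rewrite -/(bitlen w) ltnS => le2.
have -> : 2 ^ bitlen w = 2 * 2 ^ (bitlen w).-1 by rewrite -expnS prednK // (leq_ltn_trans _ lt_n0).
rewrite /data_bits /node_field /wordlog -muln2.
have lam0 : 0 < bitlen w by exact: leq_ltn_trans lt_n0.
rewrite -[4]/(2 + 2) expnD -mulnn; move: (bitlen w * bitlen w) (muln_gt0 (bitlen w) (bitlen w)).
by rewrite lam0 => x x0; nia.
Qed.

(** The empty string of an empty set reads as zeros; the trie bits of that set are zeros too, so
    queries need not single it out. *)
Lemma word_zeros w (B : bitseq) j : (forall p, nth false B p = false) -> word w B j = 0.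
Proof.
move=> B0; have ones0 p : ones B p = 0.
  apply/eqP; rewrite /ones -leqn0 leqNgt -has_count; apply/hasPn => x xB.
  move: (mem_take xB) => {}xB; have := B0 (seq.index x B); rewrite nth_index // => ->.
  by [].
have field0 F : field w B F = 0.
  rewrite /field /field_count ones0 sub0n if_same /field_data (eq_bval (c := fun=> false)) //.
  by rewrite /bval big1.
rewrite /word ones0 mod0n if_same; case: ifP => // _.
by rewrite /data_word big1 // => f _; rewrite field0.
Qed.

Lemma trie_bits_empty u n : 1 < u -> forall p, nth false (trie_bits (trie_node (finset.set0
  : {set 'I_u})) n) p = false.
Proof.
move=> u1 p; case: (ltnP p (size (trie_bits (trie_node (finset.set0 : {set 'I_u})) n))); last first.
  exact: nth_default.
move/(mem_nth false); move: (nth _ _ _) => x /flattenP[s /mapP[[d v] _ ->]].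
have T0 v' : trie_node (finset.set0 : {set 'I_u}) d.+1 v' = false.
  by apply/negbTE; rewrite negb_and orbC; apply/orP; left; apply/existsPn => y; rewrite inE.
by rewrite /kids !T0 !inE => /orP[] /eqP.
Qed.

Section Representation.
Variables (w0 : nat) (w : nat -> nat).

(** The empty set has no edges, hence a constant space budget, which a single count of [packed]
    would exceed as [w] grows. *)
Definition trie_rep u (A : {set 'I_u}) : bitseq :=
  if u < 2 ^ w0 then bitmap (w u) A
  else if A == finset.set0 then [::] else packed (w u) (trie_bits (trie_node A) (up_log 2 u)).

(* On words of at most [w0] bits, [Cst (2 ^ w0)] evaluates to 0. *)
Definition inter_cmd (rk : bool) : cmd :=
  If (Cst (2 ^ w0))
    (Seq (block [:: Op 30 OpLt (Reg 1) (Cst (2 ^ w0))])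
      (If (Reg 30)
         (Seq (block [:: Op 30 OpMul (Cst 0) (Cst 0)]) (bitmap_prog rk))
         (trie_prog rk)))
    (bitmap_prog rk).

Hypothesis w0_gt0 : 0 < w0.
Hypothesis w_word : forall u, u < 2 ^ w u.
Hypothesis w0_large : forall n, w0 <= n -> data_bits n * (data_bits n).+1 <= n.

Lemma w_pos u : 0 < u -> 0 < w u.
Proof. by move=> u0; have := w_word u; case: (w u) => //; rewrite expn0 ltnNge u0. Qed.

Lemma w_ge u : 2 ^ w0 <= u -> w0 <= w u.
Proof. by move=> le_u; rewrite ltnW // -(ltn_exp2l (m := 2)) // (leq_ltn_trans le_u). Qed.

Variables (u N : nat) (S : 'I_N -> {set 'I_u}) (Q : seq 'I_N).
Hypothesis (u_gt0 : 0 < u) (N_lt : N < 2 ^ w u) (Q_uniq : uniq Q) (Q_gt0 : 0 < size Q).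

Local Notation D := (data_mem (w u) (fun i => trie_rep (S i))).
Local Notation k := (size Q).

Lemma data_memE (i : 'I_N) j :
  D i j = bval (w u) (fun d => nth false (trie_rep (S i)) (j * w u + d)).
Proof. by rewrite /data_mem valK. Qed.

Lemma data_bitmap (i : 'I_N) j : u < 2 ^ w0 -> D i j = set_has (S i) j.
Proof. by move=> lt_u; rewrite data_memE /trie_rep lt_u bval_bitmap // w_pos. Qed.

Lemma data_trie (i : 'I_N) j : 2 ^ w0 <= u ->
  D i j = word (w u) (trie_bits (trie_node (S i)) (up_log 2 u)) j.
Proof.
move=> le_u; rewrite data_memE /trie_rep ltnNge le_u /=.
case: eqP => [E|_]; last by rewrite bval_packed ?w_pos // w0_large // w_ge.
rewrite word_zeros; last first.
  move=> p; rewrite E trie_bits_empty //; apply: leq_trans le_u.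
  by rewrite -{1}(expn0 2) ltn_exp2l.
by rewrite /bval big1 // => d _; rewrite nth_nil.
Qed.

Let i0 : 'I_N.
Proof. by case: Q Q_gt0. Qed.

(** * From program outputs to sets and ranks *)

Definition result_output (rk : bool) : seq nat :=
  flatten [seq val x :: if rk then [seq setrank (S i) x | i <- Q] else [::]
          | x : 'I_u <- enum (inter S Q)].

Lemma enum_interE (P : pred nat) n : u <= n -> (forall x, P x -> x < u) ->
  (forall x : 'I_u, P x = (x \in inter S Q)) ->
  [seq val x | x <- enum (inter S Q)] = [seq x <- iota 0 n | P x].
Proof.
move=> le_n P_lt PE; rewrite -(subnKC le_n) iotaD filter_cat add0n.
have -> : [seq x <- iota u (n - u) | P x] = [::].
  apply/eqP; rewrite -[_ == _]negbK -has_filter; apply/hasPn => x.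
  by rewrite mem_iota => /andP[le_x _]; apply: contraL le_x => /P_lt; rewrite ltnNge.
rewrite cats0 -val_enum_ord filter_map; congr map.
by rewrite {1}/enum_mem -enumT; apply: seq.eq_filter => x; rewrite /= PE.
Qed.

Lemma setrankE i (x : 'I_u) :
  setrank (S i) x = count (set_has (S i)) (iota 0 x.+1).
Proof.
rewrite /setrank -size_filter cardE -(size_map val); apply: perm_size.
apply: uniq_perm; first by rewrite (map_inj_uniq val_inj) enum_uniq.
  by rewrite filter_uniq ?iota_uniq.
move=> y; rewrite mem_filter mem_iota /= add0n ltnS; apply/mapP/andP => [[z]|].
  rewrite mem_enum inE => /andP[zS le_z] ->; split=> //.
  by apply/existsP; exists z; rewrite zS /=.
move=> [/existsP[z /andP[zS /eqP Ez]] le_y]; exists z => //.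
by rewrite mem_enum inE zS Ez.
Qed.

Lemma set_hasE i (x : 'I_u) : set_has (S i) x = (x \in S i).
Proof.
apply/existsP/idP => [[y /andP[yS /eqP/val_inj <-]] //|xS].
by exists x; rewrite xS /=.
Qed.

Lemma flatten_inter (F : nat -> seq nat) (G : 'I_u -> seq nat) :
  (forall x : 'I_u, x \in inter S Q -> F x = G x) ->
  flatten [seq F x | x <- [seq val x | x <- enum (inter S Q)]] =
  flatten [seq G x | x <- enum (inter S Q)].
Proof.
move=> FG; congr flatten; rewrite -map_comp; apply/eq_in_map => x.
by rewrite mem_enum => /FG.
Qed.

(** The test of the universe size uses register 30; once this is 0 again, the state is the initial
    one, from which both programs are known to run. *)
Lemma set_reg0 r : 1 < r -> set_reg (query_state u Q) r 0 = query_state u Q.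
Proof.
move=> r1; rewrite /set_reg /query_state /=; congr State; apply/funext => r' /=.
by case: eqP => // ->; case: r r1 => [|[|]].
Qed.

Lemma runs_bitmap_inter rk : u < 2 ^ w0 ->
  runs (w u) D (bitmap_prog rk) (query_state u Q) (u * (k * 18 + 18) + 4)
    (fun s => out s = result_output rk).
Proof.
move=> lt_u; have D_bit i j := data_bitmap i j lt_u.
apply: runs_weaken (runs_bitmap_prog (w_pos u_gt0) (w_word u) N_lt Q_uniq D_bit i0 rk) _ _
  => // s ->.
rewrite -enum_interE //.
- apply: flatten_inter => x _; congr (_ :: _); case: (rk) => //.
  by apply: eq_map => i; rewrite setrankE.
- by case: Q Q_gt0 => // i Q' _ x /andP[/set_has_lt].
move=> x; rewrite mem_inter; apply: eq_all => i; exact: set_hasE.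
Qed.

Local Notation l := (up_log 2 u).

Lemma runs_trie_inter rk : 2 ^ w0 <= u ->
  runs (w u) D (trie_prog rk) (query_state u Q)
    (12 * w u + k * (l * 37 + 15) + 4 * start (alive S Q) l.+1 * (k * 54 + 30) + 40)
    (fun s => out s = result_output rk).
Proof.
move=> le_u; have D_word i j := data_trie i j le_u.
have u1 : 1 < u by apply: leq_trans le_u; rewrite -{1}(expn0 2) ltn_exp2l.
have l0 : 0 < l by rewrite up_log_gt0.
have w_large := w0_large (w_ge le_u).
apply: runs_weaken (runs_trie_prog (w_pos u_gt0) w_large u1 (w_word u) N_lt Q_uniq Q_gt0
  D_word i0 rk) _ _ => // s ->.
have nodeE i x : trie_node (S i) l x = set_has (S i) x by rewrite trie_node_leaf.
rewrite -enum_interE; first last.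
- by move=> x; rewrite mem_inter; apply: eq_all => i; rewrite nodeE set_hasE.
- by move=> x; apply: alive_leaf_lt.
- exact: up_logP.
apply: flatten_inter => x xI; congr (_ :: _); case: (rk) => //.
(* Leaves are counted strictly below [x]; the successor counts [x] itself, which lies in every
   queried set. *)
apply/eq_in_map => i iQ; rewrite setrankE -/(rank_below S i x.+1) rank_belowS.
have -> : set_has (S i) x.
  by rewrite set_hasE; move: xI; rewrite mem_inter => /allP; apply.
by rewrite addn1; congr _.+1; apply: eq_count => y; rewrite nodeE.
Qed.

End Representation.

(** * Running time and space *)

Section Bounds.
Variables (w0 : nat) (w : nat -> nat) (Cw : nat).
Hypothesis w0_gt0 : 0 < w0.
Hypothesis w_word : forall u, u < 2 ^ w u.
Hypothesis w0_large : forall n, w0 <= n -> data_bits n * (data_bits n).+1 <= n.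
Hypothesis w_le : forall u, 1 < u -> w u <= Cw * up_log 2 u.

(** 12 Cw pays for the set-up loops, 40 * 2^w0 for the bitmaps; the trie program otherwise needs 37
    + 15 + 4 (54 + 30) + 44 = 432 units. *)
Definition time_factor : nat := 12 * Cw + 500 + 40 * 2 ^ w0.

Lemma time_factorE n : time_factor * n = 12 * (Cw * n) + 500 * n + 40 * (2 ^ w0 * n).
Proof. by rewrite /time_factor 2!mulnDl !mulnA. Qed.

Lemma runs_inter_cmd u N (S : 'I_N -> {set 'I_u}) (Q : seq 'I_N) rk :
  0 < u -> N < 2 ^ w u -> uniq Q -> 0 < size Q ->
  runs (w u) (data_mem (w u) (fun i => trie_rep w0 w (S i))) (inter_cmd w0 rk)
    (query_state u Q)
    (time_factor * (size Q * alternation S Q * (height_excess S Q).+2))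
    (fun s => out s = result_output S Q rk).
Proof.
move=> u0 N_lt Q_uniq Q_gt0; set D := data_mem _ _.
have wu0 : 0 < w u := w_pos w_word u0.
have delta0 : 0 < alternation S Q := alternation_gt0 S Q u0.
have mult_le x y : x <= y * size Q ->
    x <= y * (size Q * alternation S Q * (height_excess S Q).+2).
  move/leq_trans; apply; rewrite leq_mul2l -mulnA leq_pmulr ?orbT //.
  by rewrite muln_gt0 delta0.
case: (ltnP u (2 ^ w0)) => [lt_u|le_u].
  have small : runs (w u) D (bitmap_prog rk) (query_state u Q) (36 * 2 ^ w0 * size Q + 4)
      (fun s => out s = result_output S Q rk).
    apply: runs_weaken (runs_bitmap_inter w_word S u0 N_lt Q_uniq Q_gt0 rk lt_u) _ _ => //.
    rewrite leq_add2r -mulnA mulnCA; apply: leq_mul; first exact: ltnW.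
    by move: Q_gt0; lia.
  apply: (@runs_weaken _ _ _ _ (36 * 2 ^ w0 * size Q + 10) _ (fun s => out s =
    result_output S Q rk)) => //; last first.
    apply: mult_le; rewrite time_factorE -mulnA.
    by move: (2 ^ w0 * size Q) (Cw * size Q) (size Q) Q_gt0 => x y z; lia.
  have -> : 36 * 2 ^ w0 * size Q + 10 = (36 * 2 ^ w0 * size Q + 9).+1 by rewrite addnS.
  apply: runs_if => /=; case: (2 ^ w0 %% 2 ^ w u =P 0) => [_|neq0].
    by apply: runs_weaken small _ _ => //; rewrite leq_add2l.
  have lt_w : w0 < w u.
    rewrite ltnNge; apply/negP => le_w; case: neq0; apply/eqP.
    exact: dvdn_exp2l.
  have cst : 2 ^ w0 %% 2 ^ w u = 2 ^ w0 by rewrite modn_small // ltn_exp2l.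
  have -> : 36 * 2 ^ w0 * size Q + 9 = 2 + (2 + (36 * 2 ^ w0 * size Q + 4)).+1 by lia.
  apply: (@runs_seq _ _ _ _ _ _ _ (eq (set_reg (query_state u Q) 30 1))).
    by apply: runs_block => //=; rewrite /binop_fun cst lt_u modn_small // exp_gt1.
  move=> _ <-; apply: runs_if => /=.
  apply: (@runs_seq _ _ _ _ _ _ _ (eq (query_state u Q))); last by move=> _ <-.
  apply: runs_block => //=; rewrite -[LHS](set_reg0 u Q (isT : 1 < 30)).
  rewrite /binop_fun !mod0n /set_reg /=; congr State; apply/funext => r /=.
  by case: eqP.
have lt_w : w0 < w u.
  by rewrite -(ltn_exp2l (m := 2)) // (leq_ltn_trans le_u) // w_word.
have u1 : 1 < u by apply: leq_trans le_u; rewrite -{1}(expn0 2) ltn_exp2l.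
have cst : 2 ^ w0 %% 2 ^ w u = 2 ^ w0 by rewrite modn_small // ltn_exp2l.
set t := 12 * w u + size Q * (up_log 2 u * 37 + 15) +
  4 * start (alive S Q) (up_log 2 u).+1 * (size Q * 54 + 30) + 40.
have le_t : t + 4 <= time_factor * (size Q * alternation S Q * (height_excess S Q).+2).
  set X := size Q * alternation S Q * (height_excess S Q).+2.
  have kX c : c <= alternation S Q * (height_excess S Q).+2 -> size Q * c <= X.
    by move=> le_c; rewrite /X -mulnA leq_mul2l le_c orbT.
  have le_A := kX _ (total_alive S u0 Q_gt0).
  have le_l : size Q * up_log 2 u <= X.
    apply: kX; apply: leq_trans (height_le S u0 Q_gt0) _.
    by rewrite leq_mul2l leqnSn orbT.
  have le_k : size Q <= X by rewrite -[leqLHS]muln1; apply: kX; rewrite muln_gt0 delta0.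
  have le_w : w u <= Cw * X.
    apply: leq_trans (w_le u1) _; rewrite leq_mul2l (leq_trans _ le_l) ?orbT //.
    by rewrite leq_pmull.
  have le_A' : start (alive S Q) (up_log 2 u).+1 <= X.
    by apply: leq_trans le_A; rewrite leq_pmull.
  rewrite time_factorE; apply: leq_trans _ (leq_addr _ _).
  rewrite /t; move: {kX} Q_gt0 le_k le_l le_w le_A le_A'.
  move: X (up_log 2 u) (size Q) (start (alive S Q) (up_log 2 u).+1) => X l k a;
    move: (Cw * X) (w u) => y v; clear.
  lia.
apply: runs_weaken _ le_t (fun s H => H).
have -> : t + 4 = (2 + t.+1).+1 by lia.
apply: runs_if; rewrite /= cst -lt0n expn_gt0 /=.
apply: (@runs_seq _ _ _ _ _ _ _ (eq (query_state u Q))); last first.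
  by move=> _ <-; apply: runs_if => /=; apply: runs_trie_inter.
apply: runs_block => //=; rewrite -[LHS](set_reg0 u Q (isT : 1 < 30)).
rewrite /binop_fun cst ltnNge le_u mod0n /set_reg /=; congr State.
Qed.


(** Trades [lam], which depends on [u], for a double logarithm of [trie A]. For 2 I stored bits, lam
    times the overhead is at most 14 I + w, whence 14 + Cw. *)
Lemma trie_rep_size u (A : {set 'I_u}) : 2 ^ w0 <= u -> A != finset.set0 ->
  exists2 o, size (trie_rep w0 w A) = 2 * ((trie A).+1 - #|A|) + o &
    (bitlen (trunc_log 2 (trie A))).+1 * o <= 2 * (14 + Cw) * trie A.
Proof.
move=> le_u A0; rewrite /trie_rep ltnNge le_u (negbTE A0) /=.
have u1 : 1 < u by apply: leq_trans le_u; rewrite -{1}(expn0 2) ltn_exp2l.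
have l0 : 0 < up_log 2 u by rewrite up_log_gt0.
have E := trie_start A l0; set I := start _ _ in E; set m := trie A in E *.
have n0 : 0 < #|A| by rewrite card_gt0.
have sizeB : size (trie_bits (trie_node A) (up_log 2 u)) = 2 * I by rewrite size_trie_bits mul2n.
have w_large := w0_large (w_ge w_word le_u).
have wu0 : 0 < w u by apply: w_pos => //; exact: ltnW.
rewrite size_mkseq sizeB; exists (overhead (w u) (2 * I)); first by rewrite -E addnK.
have ov := overhead_le wu0 w_large (2 * I).
(* A nonempty set has a node at each of the internal depths, so that w = O(lg u) is O(I). *)
have le_I : up_log 2 u <= I.
  rewrite /I /start -[X in X <= _]card_ord -sum1_card; apply: leq_sum => d _.
  by apply: (@level_gt0 u 1 (fun=> A) ord0) => //; exact: ltnW.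
have le_m : m <= 2 ^ (up_log 2 u).+1 - 1.
  have := start_lt (trie_node A) (up_log 2 u).+1.
  rewrite -bsize_bintrie /m /trie /bedges; case: (bsize _) => // x; lia.
have le_lam : bitlen (trunc_log 2 m) <= wordlog (w u).
  have le_t : trunc_log 2 m <= w u.
    apply: (@leq_trans (up_log 2 u)); last by apply: up_log_min => //; exact: ltnW.
    rewrite -ltnS; have m0 : 0 < m by lia.
    rewrite -(ltn_exp2l (m := 2)) // (leq_ltn_trans (trunc_logP _ m0)) //.
    by move: le_m; have := expn_gt0 2 (up_log 2 u).+1; lia.
  by apply: bitlen_le_exp; apply: leq_ltn_trans le_t (bitlen_lt _).
have lam0 := lam_gt0 wu0.
have wle := w_le u1.
have Im : I <= m by lia.
have lm : Cw * up_log 2 u <= Cw * m by rewrite leq_mul2l (leq_trans le_I) ?orbT.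
(* The factor 2 absorbs the successor, as [lam] is at least 1. *)
apply: (@leq_trans (2 * (wordlog (w u) * overhead (w u) (2 * I)))).
  by rewrite mulnA leq_mul2r; apply/orP; right; lia.
rewrite -mulnA leq_mul2l /=; apply: leq_trans ov _.
by rewrite mulnDl; lia.
Qed.

End Bounds.

Import Order.TTheory GRing.Theory Num.Theory.
Import numFieldNormedType.Exports.

Local Open Scope classical_set_scope.
Local Open Scope ring_scope.

(** * Asymptotics *)

Lemma ln2_gt0 (R : realType) : 0 < ln (2 : R).
Proof. by apply: ln_gt0; lra. Qed.

Lemma lg_up_log (R : realType) (u : nat) : (0 < u)%N ->
  0 <= lg (u%:R : R) <= (up_log 2 u)%:R.
Proof.
move=> u0; have l2 := ln2_gt0 R; rewrite /lg; apply/andP; split.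
  by rewrite divr_ge0 ?(ltW l2) // ln_ge0 // ler1n.
rewrite ler_pdivrMr // mulr_natl -lnXn // ler_ln ?posrE ?exprn_gt0 ?ltr0n //.
by rewrite -natrX ler_nat up_logP.
Qed.

(** The finitely many [u] before the asymptotic regime are covered by adding all their word sizes to
    the constant. *)
Lemma word_le_log (R : realType) (w : nat -> nat)
    (w_Theta : (fun u : nat => (w u)%:R : R) =Theta_\oo
                 (fun u : nat => lg (u%:R : R))) :
  exists Cw : nat, forall u, (1 < u)%N -> (w u <= Cw * up_log 2 u)%N.
Proof.
move: w_Theta; rewrite eqThetaE bigThetaE => -[/eqOP[M [_ MP]] _].
pose K : R := Num.max M 0 + 1.
have lt_K : M < K by rewrite /K ltr_pwDr // le_max lexx.
have K0 : 0 <= K by rewrite addr_ge0 // le_max lexx orbT.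
have [n0 _ n0P] := MP _ lt_K.
exists ((Num.truncn K).+1 + \sum_(u < n0) w u)%N => u u1.
have l0 : (0 < up_log 2 u)%N by rewrite up_log_gt0.
case: (ltnP u n0) => [lt_u|le_u].
  apply: (@leq_trans (\sum_(u < n0) w u)%N); last first.
    by apply: leq_trans (leq_pmulr _ l0); rewrite leq_addl.
  by rewrite (bigD1 (Ordinal lt_u)) //= leq_addr.
apply: (@leq_trans ((Num.truncn K).+1 * up_log 2 u)%N); last first.
  by rewrite leq_mul2r leq_addr orbT.
have := n0P _ le_u => /=.
have /andP[lg0 lgl] := lg_up_log R (ltnW u1).
rewrite ger0_norm // ger0_norm // => le_w.
rewrite -(ler_nat R) natrM; apply: le_trans le_w _.
by apply: ler_pM => //; exact: ltW (truncnS_gt K).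
Qed.

(** Floor and ceiling lose a factor 2 each, so 2^n <= 4 u / d and n <= 2 + lg (u / d); then n + 2 <=
    4 + lg (u / d), which is at most 5 times [lg1]. *)
Lemma excess_le_lg1 (R : realType) (d u : nat) : (0 < d)%N -> (d <= u)%N ->
  ((up_log 2 u - trunc_log 2 d).+2)%:R <= 5 * lg1 (u%:R / d%:R : R).
Proof.
move=> d0 le_d; have l2 := ln2_gt0 R.
have u0 : (0 < u)%N by exact: leq_trans le_d.
have dR : 0 < d%:R :> R by rewrite ltr0n.
have uR : 0 < u%:R :> R by rewrite ltr0n.
set n := (up_log 2 u - trunc_log 2 d)%N.
have lt_d : (d < 2 ^ (trunc_log 2 d).+1)%N by exact: trunc_log_ltn.
have el : (trunc_log 2 d <= up_log 2 u)%N.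
  rewrite -(leq_exp2l (m := 2)) // (leq_trans (trunc_logP _ d0)) //.
  by rewrite (leq_trans le_d) // up_logP.
have lt_u : (2 ^ up_log 2 u <= 2 * u)%N.
  move: u0; rewrite leq_eqVlt => /orP[/eqP<-|u1]; first by rewrite up_log1.
  have /andP[+ _] := up_log_bounds (isT : 1 < 2)%N u1.
  have := expnS 2 (up_log 2 u).-1; rewrite prednK ?up_log_gt0 // => ->.
  by move: (2 ^ _)%N => x; lia.
have key : (2 ^ n * d <= 4 * u)%N.
  apply: (@leq_trans (2 ^ n * 2 ^ (trunc_log 2 d).+1)%N); first by rewrite leq_mul2l ltnW ?orbT.
  by rewrite -expnD addnS /n subnK // expnS; lia.
have : n%:R <= 2 + lg (u%:R / d%:R : R).
  have -> : 2 + lg (u%:R / d%:R : R) = ln (4 * (u%:R / d%:R)) / ln 2.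
    rewrite lnM ?posrE ?divr_gt0 // mulrDl /lg; congr (_ + _).
    rewrite (_ : 4 = 2 ^+ 2 :> R) ?lnXn //; last by rewrite -natrX.
    by rewrite mulr2n mulrDl divff ?gt_eqF.
  rewrite ler_pdivlMr // [n%:R * _]mulr_natl -lnXn // ler_ln ?posrE ?exprn_gt0 ?mulr_gt0
    ?invr_gt0 //.
  by rewrite mulrA ler_pdivlMr // -natrX -!natrM ler_nat.
have : 1 <= lg1 (u%:R / d%:R : R) by rewrite /lg1 le_max lexx.
have : lg (u%:R / d%:R) <= lg1 (u%:R / d%:R : R) by rewrite /lg1 le_max lexx orbT.
have -> : n.+2%:R = n%:R + 2 :> R by rewrite -natrD addn2.
move: (lg1 _) (lg _) => x y; lra.
Qed.

(** [K0] pays for the bitmaps, the quotient for the directory, of order m / lg lg m. The successor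
    keeps the denominator positive for m <= 1. *)
Definition slack (R : realType) (K0 K : nat) (m : nat) : R :=
  K0%:R + (K * m)%:R / (bitlen (trunc_log 2 m)).+1%:R.

Lemma slack_ge0 (R : realType) K0 K m : K0%:R <= slack R K0 K m.
Proof. by rewrite lerDl divr_ge0. Qed.

Lemma slack_littleo (R : realType) K0 K : slack R K0 K =o_\oo (fun m : nat => m%:R : R).
Proof.
apply/eqoP => eps eps0.
(* For m >= 2^(2^n) the denominator exceeds n > 2 K / eps; with m >= 2 K0 / eps, each summand of
   [slack] is at most eps m / 2. *)
pose n := (Num.truncn (2 * K%:R / eps)).+1.
have lt_n : 2 * K%:R / eps < n%:R by exact: truncnS_gt.
near=> m.
have m_exp : (2 ^ 2 ^ n <= m)%N by near: m; exact: nbhs_infty_ge.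
have m_K0 : 2 * K0%:R / eps <= m%:R by near: m; exact: nbhs_infty_ger.
have m0 : (0 < m)%N by apply: leq_trans m_exp; rewrite expn_gt0.
rewrite ger0_norm ?(le_trans _ (slack_ge0 _ _ _ _)) // ger0_norm //.
have le_t : (2 ^ n <= trunc_log 2 m)%N by exact: trunc_log_max.
have lt_b : (n < bitlen (trunc_log 2 m))%N.
  by rewrite -(ltn_exp2l (m := 2)) // (leq_ltn_trans le_t) // bitlen_lt.
have e2 : 0 < eps / 2 by lra.
rewrite /slack [eps](splitr eps) mulrDl; apply: lerD.
  by move: m_K0; rewrite ler_pdivrMr //; lra.
rewrite natrM mulrAC ler_wpM2r // ler_pdivrMr ?ltr0n //.
have : n%:R <= (bitlen (trunc_log 2 m)).+1%:R :> R by rewrite ler_nat ltnW // ltnW.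
move: lt_n; rewrite ltr_pdivrMr // => lt_n le_n.
have := ler_wpM2l (ltW eps0) le_n; lra.
Unshelve. all: by end_near. Qed.

Lemma card_le_trie (u : nat) (A : {set 'I_u}) : (0 < u)%N -> (#|A| <= (trie A).+1)%N.
Proof.
move=> u0; case: (ltnP 1 u) => [u1|le_u].
  by rewrite -trie_start ?up_log_gt0 // leq_addl.
by rewrite (leq_trans (max_card _)) // card_ord (leq_trans le_u).
Qed.

Lemma trie_rep_size_slack (R : realType) (w0 : nat) (w : nat -> nat) (Cw : nat) :
  (0 < w0)%N -> (forall u, (u < 2 ^ w u)%N) ->
  (forall n, (w0 <= n)%N -> (data_bits n * (data_bits n).+1 <= n)%N) ->
  (forall u, (1 < u)%N -> (w u <= Cw * up_log 2 u)%N) ->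
  forall (u : nat) (A : {set 'I_u}), (0 < u)%N ->
    (size (trie_rep w0 w A))%:R <= 2 * ((trie A)%:R - #|A|%:R + 1) +
      slack R (\sum_(v < 2 ^ w0) v * w v) (2 * (14 + Cw)) (trie A).
Proof.
move=> w0_gt0 w_word w0_large w_le u A u0; set K0 := (\sum_(v < _) _)%N.
have nonneg : 0 <= 2 * ((trie A)%:R - #|A|%:R + 1) :> R.
  have : #|A|%:R <= (trie A)%:R + 1 :> R by rewrite natr1 ler_nat card_le_trie.
  lra.
case: (ltnP u (2 ^ w0)) => [lt_u|le_u].
  (* [K0] adds up the bitmap sizes of all small universes, so it bounds each of them. *)
  have le_K0 : (size (trie_rep w0 w A) <= K0)%N.
    rewrite /trie_rep lt_u size_mkseq /K0 (bigD1 (Ordinal lt_u)) //=; exact: leq_addr.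
  apply: le_trans (_ : K0%:R <= _); first by rewrite ler_nat.
  by apply: le_trans (slack_ge0 R K0 (2 * (14 + Cw)) (trie A)) _; rewrite lerDr.
have [A0|A0] := eqVneq A finset.set0.
  rewrite {1}/trie_rep ltnNge le_u A0 eqxx /= -A0.
  by rewrite addr_ge0 // (le_trans _ (slack_ge0 _ _ _ _)).
have [ov size_ov le_ov] := trie_rep_size w0_gt0 w_word w0_large w_le le_u A0.
rewrite {}size_ov.
rewrite natrD natrM natrB ?card_le_trie // -natr1.
have : ov%:R <= slack R K0 (2 * (14 + Cw)) (trie A).
  apply: le_trans (_ : _ <= (2 * (14 + Cw) * trie A)%:R / (bitlen (trunc_log 2 (trie A))).+1%:R) _.
    by rewrite ler_pdivlMr ?ltr0n // -natrM ler_nat mulnC.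
  by rewrite /slack lerDr.
by move: (slack _ _ _ _) => x; lra.
Qed.

Lemma runs_real (R : realType) w D c s n b (P : state -> Prop) : runs w D c s n P -> n%:R
  <= b :> R ->
  exists (t : nat) (s' : state), [/\ exec w D c s t s', t%:R <= b & P s'].
Proof.
move=> [t [s' [ex le_t Ps']]] le_b; exists t, s'; split=> //.
by apply: le_trans le_b; rewrite ler_nat.
Qed.

Theorem theorem4p1 (R : realType) (w : nat -> nat)
    (w_Theta : (fun u : nat => (w u)%:R : R) =Theta_\oo
                 (fun u : nat => lg (u%:R : R)))
    (w_word : forall u : nat, (u < 2 ^ w u)%N) :
  exists (rep : forall u : nat, {set 'I_u} -> bitseq) (f : nat -> R)
         (inter_prog rank_prog : cmd) (C : R),
    [/\ f =o_\oo (fun m : nat => m%:R : R),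
        forall (u : nat) (A : {set 'I_u}), (0 < u)%N ->
          (size (rep u A))%:R <=
            2 * ((trie A)%:R - #|A|%:R + 1) + f (trie A) &
        forall (u N : nat) (S : 'I_N -> {set 'I_u}) (Q : seq 'I_N),
          (0 < u)%N -> (N < 2 ^ w u)%N -> uniq Q -> (0 < size Q)%N ->
          let D := data_mem (w u) (fun i => rep u (S i)) in
          let bound : R := C * ((size Q)%:R * (alternation S Q)%:R *
                                lg1 (u%:R / (alternation S Q)%:R)) in
          (exists (t : nat) (s : state),
             [/\ exec (w u) D inter_prog (query_state u Q) t s,
                 t%:R <= bound &
                 exists xs : seq 'I_u,
                   perm_eq xs (enum (inter S Q)) /\
                   out s = [seq val x | x <- xs]]) /\
          (exists (t : nat) (s : state),
             [/\ exec (w u) D rank_prog (query_state u Q) t s,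
                 t%:R <= bound &
                 exists xs : seq 'I_u,
                   perm_eq xs (enum (inter S Q)) /\
                   out s = flatten
                     [seq val x :: [seq setrank (S i) x | i <- Q] | x <- xs]])].
Proof.
have [Cw w_le] := word_le_log w_Theta.
have [w0 w0_gt0 w0_large] := word_large.
exists (@trie_rep w0 w), (slack R (\sum_(v < 2 ^ w0) v * w v) (2 * (14 + Cw))).
exists (inter_cmd w0 false), (inter_cmd w0 true), (5 * (time_factor w0 Cw)%:R).
split; [exact: slack_littleo|exact: trie_rep_size_slack|].
move=> u N S Q u0 N_lt Q_uniq Q_gt0 D bound.
have run rk := runs_inter_cmd w0_gt0 w_word w0_large w_le S rk u0 N_lt Q_uniq Q_gt0.
have le_bound : (time_factor w0 Cw * (size Q * alternation S Q * (height_excess S Q).+2))%:R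
    <= bound.
  have -> : bound = (time_factor w0 Cw)%:R * ((size Q)%:R * (alternation S Q)%:R *
      (5 * lg1 (u%:R / (alternation S Q)%:R))) by rewrite /bound; ring.
  rewrite natrM ler_wpM2l // natrM natrM ler_wpM2l ?mulr_ge0 //.
  apply: excess_le_lg1.
    exact: alternation_gt0.
  exact: alternation_le.
have run_b rk := runs_real (run rk) le_bound.
split.
  have [t [s [ex le_t o]]] := run_b false; exists t, s; split=> //.
  by exists (enum (inter S Q)); split=> //; rewrite o /result_output flatten_map1.
have [t [s [ex le_t o]]] := run_b true; exists t, s; split=> //.
by exists (enum (inter S Q)).
Qed.
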